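(* For every odd integer $q\ge3$, the minimal Sullivan algebra $M_q$ (defined in the context) satisfies $$\operatorname{cd}_{\mathbb Q}M_q=7q-3,\qquad e_0(M_q)=\operatorname{nil}_h(M_q)=3<4=\operatorname{Hnil}(M_q),$$ and $a_3(M_q)=5q-1$. Consequently, in the implication ''if $M=(\Lambda V,d)$ is a minimal Sullivan algebra of finite type, $q\ge2$, $N\ge0$, $n\ge1$ are integers with $V^{<q}=0$, $H^{>N}(M)=0$, $\operatorname{nil}_h(M)\le n$ and $N\le a_n(M)+2q-3$, then $\operatorname{Hnil}(M)\le n$'', the constant $-3$ cannot be replaced universally by $-2$; that is, the implication obtained by replacing $N\le a_n(M)+2q-3$ by $N\le a_n(M)+2q-2$ is false.
   Context: All CDGAs (commutative differential graded algebras) are over $\mathbb Q$, augmented, cohomologically graded in nonnegative degrees, with differential of degree $+1$, graded commutative, and connected ($A^0=\mathbb Q$). $A^+=\ker(A\to\mathbb Q)$. Finite type means each graded component is finite-dimensional. A minimal Sullivan algebra $(\Lambda V,d)$ is a free graded commutative algebra on a positively graded space $V$ with the usual Sullivan filtration condition and $dV\subseteq\Lambda^{\ge2}V$; it is simply connected if $V^1=0$. Ideals are graded; an ideal is differential if stable under $d$, and acyclic if its cohomology as a complex vanishes. Invariants of a simply connected minimal Sullivan algebra $M$ ($\inf\varnothing=+\infty$): $\operatorname{nil}_h(M)=\inf\{n\ge0\mid M\simeq B$ for some CDGA $B$ with $(B^+)^{n+1}=0\}$, $\simeq$ being a zigzag of augmented quasi-isomorphisms; $\operatorname{Hnil}(M)=\inf\{n\ge0\mid$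 there is an acyclic differential ideal $J$ of $M$ with $(M^+)^{n+1}\subseteq J\}$; $e_0(M)=\inf\{n\ge0\mid H(M)\to H(M/(M^+)^{n+1})$ is injective$\}$; $a_n(M)=\inf\{j\mid H^j((M^+)^{n+1})\ne0\}$ (cohomology of the ideal itself as a complex); $\operatorname{cd}_{\mathbb Q}M=\sup\{j\mid H^j(M)\ne0\}$. Construction of $M_q$. Fix an odd integer $q\ge3$; subscripts on generators denote degrees. Let $\mathcal F_q=\Lambda(s_q,x_q,y_q,a_{2q-1},t_{4q-2},r_{5q-3})$ be the free graded commutative algebra with the degree $+1$ derivation $\delta$ given by $\delta s=\delta x=\delta y=0$, $\delta a=xy$, $\delta t=ays$, $\delta r=xt$. Let $D_q$ be the quotient of $\mathcal F_q$ by the $\delta$-stable ideal $(\mathcal F_q^+)^4+\mathcal F_q^{>7q-3}$, with induced derivation $\bar\delta$; then $\bar\delta^2=0$ and $D_q$ is a CDGA. Let $P_q=(\Lambda(s_q,x_q,y_q,a_{2q-1},t_{4q-2}),d)$ with $ds=dx=dy=0$, $da=xy$, $dt=ays$ (a minimal Sullivan algebra), and let $\phi_0:P_q\to D_q$ send generators to their namesakes. $M_q=P_q\otimes\Lambda W$ is a finite-type minimal Sullivan algebra containing $P_q$ as a sub-CDGA, with $W^{\le5q-1}=0$, together with a quasi-isomorphism $\phi:M_q\to D_q$ extending $\phi_0$ (such a model exists). *)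

(* Defs.v *)
From HB Require Import structures.
From mathcomp Require Import all_boot all_order all_algebra.
From mathcomp Require Import boolp classical_sets constructive_ereal.

Set Implicit Arguments.
Unset Strict Implicit.
Unset Printing Implicit Defensive.

Import Order.TTheory GRing.Theory Num.Theory.
Local Open Scope classical_set_scope.
Local Open Scope ring_scope.

(** * Graded commutative algebras over Q *)

(* A = (+)_{i >= 0} A^i is given by the projections [comp i] onto the A^i;
   [compE] and [comp_sum] say exactly that A is the direct sum of the ranges.
   Odd elements square to zero because 2 is invertible. *)
Record gca : Type := Gca {
  gca_sort :> algType rat;
  comp : nat -> {linear gca_sort -> gca_sort};
  compE : forall i j a, comp i (comp j a) = if i == j then comp j a else 0;
  comp_sum : forall a, exists n, a = \sum_(i < n) comp i a;
  comp_one : comp 0 1 = 1;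
  comp_mul : forall i j a b, comp i a = a -> comp j b = b ->
    comp (i + j) (a * b) = a * b;
  gca_comm : forall i j a b, comp i a = a -> comp j b = b ->
    a * b = (-1) ^+ (i * j) *: (b * a)
}.

Definition homog (A : gca) (i : nat) (a : A) : Prop := comp A i a = a.

(* The elements of positive degree.  When A^0 = Q.1, the projection
   [comp A 0] is the (only) augmentation, and this is its kernel. *)
Definition pos (A : gca) : set A := [set a | comp A 0 a = 0].

Record ghom (A B : gca) : Type := Ghom {
  ghom_fun :> {lrmorphism A -> B};
  ghom_comp : forall i a, ghom_fun (comp A i a) = comp B i (ghom_fun a)
}.

Definition derivation (A : gca) (d : A -> A) : Prop :=
  (forall i a, homog i a -> homog i.+1 (d a)) /\
  (forall i a b, homog i a -> d (a * b) = d a * b + (-1) ^+ i *: (a * d b)).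

(** * Subspaces, ideals, generated subobjects *)

Definition subspace (A : gca) (X : set A) : Prop :=
  X 0 /\ forall (c : rat) u v, X u -> X v -> X (c *: u + v).

Definition gsubspace (A : gca) (X : set A) : Prop :=
  subspace X /\ forall i x, X x -> X (comp A i x).

Definition subalgebra (A : gca) (X : set A) : Prop :=
  [/\ subspace X, X 1 & forall u v, X u -> X v -> X (u * v)].

Definition gideal (A : gca) (J : set A) : Prop :=
  gsubspace J /\ forall a x, J x -> J (a * x) /\ J (x * a).

Definition span (A : gca) (X : set A) : set A := smallest (@subspace A) X.

Definition subalg (A : gca) (X : set A) : set A := smallest (@subalgebra A) X.

Definition sumset (A : gca) (X Y : set A) : set A :=
  [set z | exists x y, [/\ X x, Y y & z = x + y]].

(* If X is an ideal and k >= 1 this is the power X^k of the ideal; if X = V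
   generates a free algebra it is the word-length component Lambda^k V. *)
Definition prods (A : gca) (X : set A) (k : nat) : set A :=
  span [set a | exists f : 'I_k -> A,
                  (forall i, X (f i)) /\ a = \prod_(i < k) f i].

Definition prods_ge (A : gca) (X : set A) (k : nat) : set A :=
  span (\bigcup_(l in [set l | (k <= l)%N]) prods X l).

Definition deg_gt (A : gca) (n : nat) : set A :=
  [set a | forall i, (i <= n)%N -> comp A i a = 0].

(** * Free graded commutative algebras *)

(* A = Lambda V for the graded subspace V of A: every degree-preserving linear
   map V -> B extends uniquely to a morphism A -> B.  Only the values of [f]
   on V matter. *)
Definition free_on (A : gca) (V : set A) : Prop :=
  forall (B : gca) (f : A -> B),
    (forall (c : rat) u v, V u -> V v -> f (c *: u + v) = c *: f u + f v) ->
    (forall i v, V v -> homog i v -> homog i (f v)) ->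
    exists g : ghom A B, (forall v, V v -> g v = f v) /\
      forall g' : ghom A B, (forall v, V v -> g' v = f v) -> g' =1 g.

Definition homog_seq (A : gca) (ds : seq nat) (gs : seq A) : Prop :=
  size gs = size ds /\
  forall i, (i < size ds)%N -> homog (nth 0%N ds i) (nth 0 gs i).

(* A = Lambda(gs), the generators gs having degrees ds. *)
Definition free_gens (A : gca) (ds : seq nat) (gs : seq A) : Prop :=
  homog_seq ds gs /\
  forall (B : gca) (bs : seq B), homog_seq ds bs ->
    exists g : ghom A B, map g gs = bs /\
      forall g' : ghom A B, map g' gs = bs -> g' =1 g.

(** * CDGAs *)

(* By [cdga_conn] the augmentation is the projection onto A^0 = Q.1, and every
   morphism below preserves it. *)
Record cdga : Type := Cdga {
  cdga_gca :> gca;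
  diff : {linear cdga_gca -> cdga_gca};
  diff_der : derivation diff;
  diff_diff : forall a, diff (diff a) = 0;
  cdga_conn : forall a : cdga_gca, homog 0 a -> exists c : rat, a = c%:A
}.

Record dghom (A B : cdga) : Type := Dghom {
  dghom_fun :> ghom A B;
  dghom_diff : forall a, dghom_fun (diff A a) = diff B (dghom_fun a)
}.

Definition finite_type (A : gca) : Prop :=
  forall i, exists s : seq A, forall a, homog i a -> span [set x | x \in s] a.

Definition dgideal (A : cdga) (J : set A) : Prop :=
  gideal J /\ forall x, J x -> J (diff A x).

(** * Cohomology *)

(* Cocycles and coboundaries of the subcomplex X of A. *)
Definition cocycle (A : cdga) (X : set A) : set A :=
  [set z | X z /\ diff A z = 0].

Definition coboundary (A : cdga) (X : set A) : set A :=
  [set z | exists w, X w /\ diff A w = z].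

(* H^j(X) <> 0 *)
Definition Hnz (A : cdga) (X : set A) (j : nat) : Prop :=
  exists z, [/\ homog j z, cocycle X z & ~ coboundary X z].

Definition acyclic (A : cdga) (X : set A) : Prop :=
  cocycle X `<=` coboundary X.

(* H(f) : ker d / im d -> ker d / im d is injective and surjective. *)
Definition quasi_iso (A B : cdga) (f : dghom A B) : Prop :=
  (forall z, cocycle setT z -> coboundary setT (f z) -> coboundary setT z) /\
  (forall z', cocycle setT z' ->
     exists z, cocycle setT z /\ coboundary setT (z' - f z)).

(* H(A) -> H(A/J) is injective, for a differential ideal J: a cocycle of A
   whose class modulo J is a coboundary of A/J is a coboundary of A. *)
Definition H_inj_quot (A : cdga) (J : set A) : Prop :=
  forall z, cocycle setT z -> (exists w, J (z - diff A w)) ->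
    coboundary setT z.

Inductive zigzag (A : cdga) : cdga -> Prop :=
| zigzag_refl : zigzag A A
| zigzag_fwd B C (f : dghom B C) : zigzag A B -> quasi_iso f -> zigzag A C
| zigzag_bwd B C (f : dghom C B) : zigzag A B -> quasi_iso f -> zigzag A C.

(** * Minimal Sullivan algebras *)

Definition sullivan_filtration (M : cdga) (V : set M) : Prop :=
  exists F : nat -> set M,
    [/\ forall k, gsubspace (F k),
        forall k, F k `<=` F k.+1,
        V = \bigcup_k F k,
        forall v, F 0%N v -> diff M v = 0
      & forall k v, F k.+1 v -> subalg (F k) (diff M v)].

(* M = (Lambda V, d) is a minimal Sullivan algebra. *)
Definition minimal_sullivan (M : cdga) (V : set M) : Prop :=
  [/\ gsubspace V, V `<=` @pos M, free_on V, sullivan_filtration V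
    & forall v, V v -> prods_ge V 2 (diff M v)].

Definition zero_in_deg (A : gca) (V : set A) (i : nat) : Prop :=
  forall v, V v -> homog i v -> v = 0.

(** * Numerical invariants, in Z extended by +oo and -oo *)

Definition enat (n : nat) : \bar int := (n%:Z)%:E.

Definition einf (P : set nat) : \bar int := infimum +oo%E (enat @` P).

Definition esup (P : set nat) : \bar int := supremum -oo%E (enat @` P).

Definition nilh (M : cdga) : \bar int :=
  einf [set n | exists B : cdga, zigzag M B /\ prods (@pos B) n.+1 = [set 0]].

Definition Hnil (M : cdga) : \bar int :=
  einf [set n | exists J : set M,
    [/\ dgideal J, acyclic J & prods (@pos M) n.+1 `<=` J]].

Definition e0 (M : cdga) : \bar int :=
  einf [set n | H_inj_quot (prods (@pos M) n.+1)].

Definition a_ (n : nat) (M : cdga) : \bar int :=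
  einf [set j | Hnz (prods (@pos M) n.+1) j].

Definition cd (M : cdga) : \bar int := esup [set j | @Hnz M setT j].

(** * The algebras D_q, P_q and M_q *)

(* D = F_q / ((F_q^+)^4 + F_q^{>7q-3}) with the induced differential, where
   F_q = Lambda(s, x, y, a, t, r); [gs] lists the images of s, x, y, a, t.
   The derivation of F_q does not square to zero, so F_q is not a CDGA. *)
Definition is_Dq (q : nat) (D : cdga) (gs : seq D) : Prop :=
  exists (F : gca) (delta : {linear F -> F}) (s x y a t r : F) (p : ghom F D),
    [/\ free_gens [:: q; q; q; 2 * q - 1; 4 * q - 2; 5 * q - 3]%N
          [:: s; x; y; a; t; r],
        derivation delta,
        [/\ delta s = 0, delta x = 0 & delta y = 0] /\
        [/\ delta a = x * y, delta t = a * y * s & delta r = x * t]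
      & [/\ forall b, exists f, p f = b,
            forall f, p f = 0 <->
              sumset (prods (@pos F) 4) (@deg_gt F (7 * q - 3)) f,
            forall f, p (delta f) = diff D (p f)
          & gs = map p [:: s; x; y; a; t]]].

(* P = (Lambda(s, x, y, a, t), d); [gs] lists the generators. *)
Definition is_Pq (q : nat) (P : cdga) (gs : seq P) : Prop :=
  exists s x y a t : P,
    [/\ gs = [:: s; x; y; a; t],
        free_gens [:: q; q; q; 2 * q - 1; 4 * q - 2]%N gs,
        [/\ diff P s = 0, diff P x = 0 & diff P y = 0],
        diff P a = x * y
      & diff P t = a * y * s].

(* M = P_q (x) Lambda W = Lambda (<s, x, y, a, t> (+) W), where [iota] embeds P_q
   in M; the sum is direct because W lives in degrees above 5q-1 > 4q-2. *)
Definition is_Mq (q : nat) (M : cdga) : Prop :=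
  exists (D P : cdga) (gD : seq D) (gP : seq P) (phi0 : dghom P D)
         (iota : dghom P M) (W : set M) (phi : dghom M D),
    [/\ is_Dq q gD, is_Pq q gP & map phi0 gP = gD] /\
    [/\ injective iota,
        gsubspace W,
        forall i, (i <= 5 * q - 1)%N -> zero_in_deg W i,
        minimal_sullivan (sumset (span [set v | v \in map iota gP]) W)
      & finite_type M] /\
    [/\ quasi_iso phi & forall b, phi (iota b) = phi0 b].

(** * The implication whose constant is at stake *)

Definition Hnil_implication (c : int) : Prop :=
  forall (M : cdga) (V : set M) (q N n : nat),
    minimal_sullivan V -> finite_type M -> (2 <= q)%N -> (1 <= n)%N ->
    (forall i, (i < q)%N -> zero_in_deg V i) ->
    (forall j, (N < j)%N -> ~ @Hnz M setT j) ->
    (nilh M <= enat n)%E ->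
    (enat N <= a_ n M + (2 * q%:Z + c)%:E)%E ->
    (Hnil M <= enat n)%E.

(* Main.v *)
(* Everything about M_q is read off D_q through the quasi-isomorphism phi : M -> D
   and off P_q in low degrees.  Since W lives in degrees >= 5q, M agrees with P_q
   below 5q, (M^+)^4 vanishes below 5q - 1, where it contains the cocycle x a y s,
   and (M^+)^5 vanishes up to 7q - 3.

   As (D^+)^4 = 0, e_0 and nil_h are at most 3.  The cocycle x y a of (M^+)^3 is not
   exact in D, so e_0 >= 3; with da = xy, its class is independent of all choices
   and is carried along zigzags, so nil_h >= 3.

   Hnil <= 4: everything above degree N = 7q - 3, plus a complement of the cocycles
   in degree N, is an acyclic ideal containing (M^+)^5.  Hnil >= 4: an acyclic ideal
   J containing (M^+)^4 contains w of degree 5q - 2 with dw = x a y s, that is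
   w = c1 xt + c0 st + c2 yt with c1 <> 0.  The cocycle w y of J must be exact, which
   forces c0 = 0; then w a is a cocycle of J as well, but in D the class of
   c1 xta + c2 yta is exact only if c1 = 0.

   For the failure of the implication one needs M_3 to exist.  It is built inside
   one big free algebra U by choosing, degree by degree, a basis of the lowest
   cohomology of the cone of Lambda(u) -> D as new generators. *)

From HB Require Import structures.
Require Import Defs.
From mathcomp Require Import all_boot all_order all_algebra.
From mathcomp Require Import boolp classical_sets constructive_ereal.
From mathcomp Require Import finmap.
From mathcomp.multinomials Require monalg.
From mathcomp Require Import zify.
Import (canonicals) monalg.
Import Defs.

Set Implicit Arguments.
Unset Strict Implicit.
Unset Printing Implicit Defensive.

Import Order.TTheory GRing.Theory Num.Theory.
Local Open Scope classical_set_scope.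
Local Open Scope ring_scope.

(** * Graded commutative algebras on words *)

(** [free_gens] and [free_on] are universal properties, and D is known only as a quotient of F, so
    neither the non-vanishing of a monomial nor a degree bound is visible in the definitions. This
    is why word algebras with an explicit basis of sorted monomials are constructed and compared
    with the given algebras by universality. Non-exactness in D is tested by coefficient functionals
    on F that kill the kernel of F -> D and the image of delta.

    The example rests on delta^2 r = delta (x t) = - x a y s, a word of length 4 that is zero in D
    but not in M. In P the boundary of x t is - x a y s, while in D the element x t is itself the
    boundary of r. Since d (a r) = x y r + x a t, the product x a t is cohomologous to - x y r in D,
    and this class is not zero.

    The truncation degree 7q - 3 is the degree of x a t, y a t and x y r. It equals a_3 + 2q - 2, so
    the weakened hypothesis of the implication holds with equality. *)

Lemma signr_odd_eq (R : pzRingType) m n :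
  odd m = odd n -> (-1) ^+ m = (-1) ^+ n :> R.
Proof. by move=> e; rewrite -signr_odd e signr_odd. Qed.

Lemma signr_scale (V : lmodType rat) (v : V) m n :
  odd m = odd n -> (-1) ^+ m *: v = (-1) ^+ n *: v.
Proof. by move=> e; rewrite (signr_odd_eq _ e). Qed.

(** * Signs of sorting a word *)

Section Words.
Variable par : nat -> bool.

Definition inv1 (i : nat) (w : seq nat) : nat :=
  if par i then count (fun j => par j && (j < i)%N) w else 0.

Fixpoint inv (w : seq nat) : nat :=
  if w is i :: w' then inv1 i w' + inv w' else 0.

Definition cross (w1 w2 : seq nat) : nat := \sum_(i <- w1) inv1 i w2.

Lemma inv1_cat i w1 w2 : inv1 i (w1 ++ w2) = (inv1 i w1 + inv1 i w2)%N.
Proof. by rewrite /inv1; case: ifP => // _; rewrite count_cat. Qed.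

Lemma inv_cat w1 w2 : inv (w1 ++ w2) = (inv w1 + inv w2 + cross w1 w2)%N.
Proof.
rewrite /cross; elim: w1 => [|i w IH] /=; first by rewrite big_nil addn0.
by rewrite big_cons inv1_cat IH; lia.
Qed.

(** The mixed term of [inv_cat] depends only on the multisets of letters. Hence sorting one factor
    of a concatenation costs exactly the sign of sorting that factor alone, which makes the product
    well defined. *)
Lemma cross_perm w1 w1' w2 w2' : perm_eq w1 w1' -> perm_eq w2 w2' ->
  cross w1 w2 = cross w1' w2'.
Proof.
move=> p1 p2; rewrite /cross (perm_big _ p1) /=; apply: eq_bigr => i _.
by rewrite /inv1; case: ifP => // _; exact/permP.
Qed.

Lemma inv1_small i w : all (leq i) w -> inv1 i w = 0%N.
Proof.
rewrite /inv1; case: ifP => // _; elim: w => //= j w IH /andP[ij /IH ->].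
by rewrite ltnNge ij andbF.
Qed.

Lemma inv_sorted w : sorted leq w -> inv w = 0%N.
Proof.
elim: w => //= i w IH; rewrite (path_sortedE leq_trans) => /andP[al sw].
by rewrite inv1_small ?IH.
Qed.

Lemma sort_cons_le i w : sorted leq (i :: w) -> sort leq (i :: w) = i :: w.
Proof. exact: (sorted_sort leq_trans). Qed.

Lemma sort_cons_gt i j w : sorted leq (j :: w) -> (j < i)%N ->
  sort leq (i :: j :: w) = j :: sort leq (i :: w).
Proof.
move=> sw ji; apply: (sorted_eq leq_trans anti_leq).
- exact: (sort_sorted leq_total).
- rewrite /sorted (path_sortedE leq_trans) (sort_sorted leq_total) andbT.
  rewrite all_sort /= (ltnW ji) /=.
  by move: sw; rewrite /sorted (path_sortedE leq_trans) => /andP[].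
- rewrite perm_sort (perm_catCA [:: i] [:: j] w) /= perm_cons.
  by rewrite perm_sym perm_sort.
Qed.

Lemma perm_sort_eq (w w' : seq nat) :
  perm_eq w w' -> sort leq w = sort leq w'.
Proof. by move=> p; apply/(perm_sortP leq_total leq_trans anti_leq). Qed.

Section Eval.
Variables (B : algType rat) (b : nat -> B).
Hypothesis bC : forall i j,
  b i * b j = (-1) ^+ (par i && par j) *: (b j * b i).

Definition evalw (w : seq nat) : B := \prod_(i <- w) b i.

Lemma evalw_cat w1 w2 : evalw (w1 ++ w2) = evalw w1 * evalw w2.
Proof. exact: big_cat. Qed.

Lemma evalw_cons i w : evalw (i :: w) = b i * evalw w.
Proof. exact: big_cons. Qed.

Lemma evalw_insert i w : sorted leq w ->
  b i * evalw w = (-1) ^+ inv1 i w *: evalw (sort leq (i :: w)).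
Proof.
elim: w => [|j w IH] sw.
  by rewrite sort_cons_le // evalw_cons /inv1 if_same scale1r.
case: (leqP i j) => ij.
  rewrite sort_cons_le; last by rewrite /= ij.
  rewrite inv1_small ?scale1r ?evalw_cons //= ij /=.
  move: sw; rewrite /= (path_sortedE leq_trans) => /andP[/allP al _].
  by apply/allP => k /al; apply: leq_trans.
rewrite sort_cons_gt // !evalw_cons mulrA bC -scalerAl -mulrA IH; last first.
  by move: sw; rewrite /= => /path_sorted.
rewrite -scalerAr scalerA -exprD; congr (_ *: _); apply: signr_odd_eq.
by rewrite /inv1 /= ij andbT; case: (par i); case: (par j).
Qed.

(** Insertion sort: an odd letter passes each smaller odd letter at the cost of one sign. So every
    graded commuting family satisfies the sorting relations of the word algebra. *)
Lemma evalw_sort w : evalw w = (-1) ^+ inv w *: evalw (sort leq w).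
Proof.
elim: w => [|i w IH]; first by rewrite scale1r.
rewrite evalw_cons IH -scalerAr evalw_insert ?(sort_sorted leq_total) //.
rewrite scalerA -exprD /= addnC; congr (_ ^+ (_ + _) *: evalw _).
  by rewrite /inv1; case: ifP => // _; apply/permP; rewrite perm_sort.
by apply: perm_sort_eq; rewrite perm_cons perm_sort.
Qed.
End Eval.
End Words.

(* The graded commutative algebra on letters i of degree [deg i] modulo the
   monomials which are not [adm]: a word is a list of letters, the sorted
   admissible words form the basis, and sorting a word w costs the sign
   (-1) ^ inv w, as [inv] counts the inversions between odd letters. *)
Record shape : Type := Shape {
  deg : nat -> nat;
  par : nat -> bool;
  adm : pred (seq nat);
  parE : forall i, par i = odd (deg i);
  adm_perm : forall w w', perm_eq w w' -> adm w = adm w';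
  adm_catl : forall w w', adm (w ++ w') -> adm w;
  adm_nil : adm [::];
  adm_sq : forall i, par i -> adm [:: i; i] = false
}.

Definition key (S : shape) : Type := {w : seq nat | adm S w && sorted leq w}.
HB.instance Definition _ S := Choice.on (key S).

Definition rawalg (S : shape) : Type := monalg.malg (key S) rat.
HB.instance Definition _ S := GRing.Lmodule.on (rawalg S).

(** * Ring axioms of a bilinear product that concatenates words *)

Section Bilinear.
Variables (V : lmodType rat) (e : seq nat -> V) (good : pred (seq nat)).
Variable mul : V -> V -> V.
Hypothesis ind : forall P : V -> Prop, P 0 ->
    (forall c u v, P u -> P v -> P (c *: u + v)) ->
    (forall w, good w -> sorted leq w -> P (e w)) -> forall a, P a.
Hypothesis mulPl : forall c u v b, mul (c *: u + v) b = c *: mul u b + mul v b.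
Hypothesis mulPr : forall a c u v, mul a (c *: u + v) = c *: mul a u + mul a v.
Hypothesis mul_e : forall w1 w2, mul (e w1) (e w2) = e (w1 ++ w2).

Lemma bil_0 b : mul 0 b = 0.
Proof. by have := mulPl (-1) 0 0 b; rewrite scaler0 addr0 scaleN1r addNr. Qed.

Lemma bil_r0 b : mul b 0 = 0.
Proof. by have := mulPr b (-1) 0 0; rewrite scaler0 addr0 scaleN1r addNr. Qed.

Lemma bil_assoc : associative mul.
Proof.
move=> a b c; elim/ind: a => [|k u v hu hv|w1 _ _].
- by rewrite !bil_0.
- by rewrite !mulPl hu hv.
elim/ind: b => [|k u v hu hv|w2 _ _].
- by rewrite !(bil_0, bil_r0).
- by rewrite !(mulPl, mulPr) hu hv.
elim/ind: c => [|k u v hu hv|w3 _ _].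
- by rewrite !bil_r0.
- by rewrite !mulPr hu hv.
by rewrite !mul_e catA.
Qed.

Lemma bil_1 : left_id (e [::]) mul.
Proof.
elim/ind => [|k u v hu hv|w2 _ _]; first exact: bil_r0.
  by rewrite mulPr hu hv.
by rewrite mul_e.
Qed.

Lemma bil_r1 : right_id (e [::]) mul.
Proof.
elim/ind => [|k u v hu hv|w2 _ _]; first exact: bil_0.
  by rewrite mulPl hu hv.
by rewrite mul_e cats0.
Qed.

Lemma bil_Dl : left_distributive mul +%R.
Proof. by move=> a b c; have := mulPl 1 a b c; rewrite !scale1r. Qed.

Lemma bil_Dr : right_distributive mul +%R.
Proof. by move=> a b c; have := mulPr a 1 b c; rewrite !scale1r. Qed.

Lemma bil_scalel (c : rat) a b : c *: mul a b = mul (c *: a) b.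
Proof. by have := mulPl c a 0 b; rewrite bil_0 !addr0. Qed.

Lemma bil_scaler (c : rat) a b : c *: mul a b = mul a (c *: b).
Proof. by have := mulPr a c b 0; rewrite bil_r0 !addr0. Qed.
End Bilinear.

(** * The word algebra as finitely supported functions on sorted words *)

Section RawAlg.
Variable S : shape.
Local Notation par := (par S).
Local Notation adm := (adm S).
Local Notation A := (rawalg S).
Implicit Types (a b : A) (w : seq nat).

Lemma adm_catr w w' : adm (w ++ w') -> adm w'.
Proof. by rewrite (adm_perm S (permEl (perm_catC w w'))); apply: adm_catl. Qed.

Lemma adm_sort w : adm (sort leq w) = adm w.
Proof. by apply: adm_perm; rewrite perm_sort. Qed.

Definition bas (w : seq nat) : A :=
  if insub (sort leq w) is Some k then monalg.mkmalgU k 1 else 0.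

Definition rawee (w : seq nat) : A := (-1) ^+ inv par w *: bas w.

Definition rawcf (w : seq nat) (a : A) : rat :=
  if insub w is Some k then monalg.mcoeff k a else 0.

Definition rawlin (V : lmodType rat) (f : seq nat -> V) (a : A) : V :=
  \sum_(k <- monalg.msupp a) monalg.mcoeff k a *: f (val k).

Lemma rawcf_is_linear w : linear_for *%R (rawcf w).
Proof.
move=> c u v; rewrite /rawcf; case: insub => [k|]; last by rewrite mulr0 addr0.
by rewrite monalg.mcoeffD monalg.mcoeffZ.
Qed.
HB.instance Definition _ w :=
  GRing.isLinear.Build rat A rat *%R (rawcf w) (rawcf_is_linear w).

Lemma insub_key w (p : adm w && sorted leq w) :
  insub w = Some (Sub w p : key S).
Proof. exact: insubT. Qed.

Lemma lin_wide (V : lmodType rat) (f : seq nat -> V) a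
    (d : {fset key S}) : (monalg.msupp a `<=` d)%fset ->
  rawlin f a = \sum_(k <- d) monalg.mcoeff k a *: f (val k).
Proof.
move=> sd; rewrite /rawlin; apply: big_fset_incl => // k _.
by move/monalg.mcoeff_outdom => ->; rewrite scale0r.
Qed.

Lemma lin_is_linear (V : lmodType rat) (f : seq nat -> V) : linear (rawlin f).
Proof.
move=> c u v.
pose d := (monalg.msupp u `|` monalg.msupp v)%fset.
have su : (monalg.msupp u `<=` d)%fset by apply: fsubsetUl.
have sv : (monalg.msupp v `<=` d)%fset by apply: fsubsetUr.
rewrite (@lin_wide _ f (c *: u + v) d); last first.
  apply: fsubset_trans (monalg.msuppD_le _ _) _.
  by rewrite fsubUset sv (fsubset_trans (monalg.msuppZ_le _ _) su).
rewrite (lin_wide f su) (lin_wide f sv) scaler_sumr -big_split /=.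
apply: eq_bigr => k _.
by rewrite monalg.mcoeffD monalg.mcoeffZ scalerDl scalerA.
Qed.
HB.instance Definition _ (V : lmodType rat) (f : seq nat -> V) :=
  GRing.isLinear.Build rat A V *:%R (rawlin f) (lin_is_linear f).

Lemma lin_bas (V : lmodType rat) (f : seq nat -> V) w :
  rawlin f (bas w) = if adm w then f (sort leq w) else 0.
Proof.
rewrite /bas; case: insubP => [k|].
  rewrite adm_sort => /andP[-> _] <-; rewrite /rawlin monalg.msuppU.
  rewrite (negPf (oner_neq0 _)) big_seq_fset1.
  by rewrite monalg.mcoeffUU scale1r.
rewrite adm_sort (sort_sorted leq_total) andbT => /negPf ->.
by rewrite linear0.
Qed.

Lemma bas_sorted w : sorted leq w -> rawee w = bas w.
Proof. by move=> s; rewrite /rawee inv_sorted ?scale1r. Qed.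

(** [rawlin] looks at [f] on sorted admissible words only. The two hypotheses say that [f] respects
    the relations of the word algebra, so the extension agrees with [f] on every word. *)
Lemma lin_ee (V : lmodType rat) (f : seq nat -> V) w :
  (forall w, f w = (-1) ^+ inv par w *: f (sort leq w)) ->
  (forall w, ~~ adm w -> f w = 0) -> rawlin f (rawee w) = f w.
Proof.
move=> fs f0; rewrite linearZ /= lin_bas [RHS]fs.
by case: ifPn => // /f0; rewrite fs => ->; rewrite scaler0.
Qed.

Lemma lin_rawee (V : lmodType rat) (f : seq nat -> V) w :
  adm w -> sorted leq w -> rawlin f (rawee w) = f w.
Proof.
by move=> aw sw; rewrite bas_sorted // lin_bas aw (sorted_sort leq_trans).
Qed.

Lemma algE a : a = rawlin rawee a.
Proof.
rewrite {1}[a]monalg.monalgE; apply: eq_bigr => k _.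
have /andP[ak sk] := valP k.
rewrite bas_sorted // /bas (sorted_sort leq_trans) // valK.
apply/monalg.malgP => l.
rewrite [RHS]monalg.mcoeffZ.
rewrite [LHS]monalg.mcoeffU.
rewrite [X in _ = _ * X]monalg.mcoeffU.
by case: (k == l); rewrite ?mulr1 ?mulr0.
Qed.

Lemma rawalg_ind (P : A -> Prop) : P 0 ->
  (forall c u v, P u -> P v -> P (c *: u + v)) ->
  (forall w, adm w -> sorted leq w -> P (rawee w)) -> forall a, P a.
Proof.
move=> P0 PD Pw a; rewrite [a]algE /rawlin.
have Ps (s : seq (key S)) : P (\sum_(k <- s) monalg.mcoeff k a *: rawee (val k)).
  elim: s => [|k s IH]; first by rewrite big_nil.
  by rewrite big_cons; apply: PD => //; have /andP[] := valP k; apply: Pw.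
exact: Ps.
Qed.

Lemma rawee_perm w w' : perm_eq w w' ->
  rawee w = (-1) ^+ (inv par w + inv par w') *: rawee w'.
Proof.
move=> p; rewrite /rawee /bas (perm_sort_eq p) scalerA -exprD.
by apply: signr_scale; rewrite -addnA addnn oddD odd_double addbF.
Qed.

Lemma rawee_nadm w : ~~ adm w -> rawee w = 0.
Proof.
move=> nw; rewrite /rawee /bas; case: insubP => [k|]; last by rewrite scaler0.
by rewrite adm_sort (negPf nw).
Qed.

Lemma rawee_sort_r w1 w2 :
  rawee (w1 ++ w2) = (-1) ^+ inv par w2 *: rawee (w1 ++ sort leq w2).
Proof.
rewrite (@rawee_perm _ (w1 ++ sort leq w2)); last first.
  by rewrite perm_cat2l perm_sym perm_sort.
apply: signr_scale; rewrite !inv_cat.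
rewrite (@cross_perm _ w1 w1 w2 (sort leq w2)) ?perm_refl //; last first.
  by rewrite perm_sym perm_sort.
rewrite (inv_sorted _ (sort_sorted leq_total w2)); set x := cross _ _ _; lia.
Qed.

Lemma rawee_sort_l w1 w2 :
  rawee (w1 ++ w2) = (-1) ^+ inv par w1 *: rawee (sort leq w1 ++ w2).
Proof.
rewrite (@rawee_perm _ (sort leq w1 ++ w2)); last first.
  by rewrite perm_cat2r perm_sym perm_sort.
apply: signr_scale; rewrite !inv_cat.
rewrite (@cross_perm _ w1 (sort leq w1) w2 w2) ?perm_refl //; last first.
  by rewrite perm_sym perm_sort.
rewrite (inv_sorted _ (sort_sorted leq_total w1)); set x := cross _ _ _; lia.
Qed.

Lemma rawcf_ee w w' : sorted leq w -> adm w ->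
  rawcf w (rawee w') = if sort leq w' == w then (-1) ^+ inv par w' else 0.
Proof.
move=> sw aw; rewrite /rawee linearZ /= /rawcf insub_key ?aw // => p.
rewrite /bas; case: insubP => [k _ e|].
  rewrite monalg.mcoeffU -val_eqE /= e.
  by case: eqP => _; rewrite ?mulr1 ?mulr0.
rewrite adm_sort (sort_sorted leq_total) andbT => nw.
rewrite monalg.mcoeff0 mulr0; case: eqP => // e.
by move: nw; rewrite -adm_sort e aw.
Qed.

Lemma eq_lin (V : lmodType rat) (f g : seq nat -> V) :
  f =1 g -> rawlin f =1 rawlin g.
Proof. by move=> fg a; apply: eq_bigr => k _; rewrite fg. Qed.

Lemma lin_comb (V : lmodType rat) c (f g : seq nat -> V) a :
  rawlin (fun w => c *: f w + g w) a = c *: rawlin f a + rawlin g a.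
Proof.
rewrite /rawlin scaler_sumr -big_split; apply: eq_bigr => k _ /=.
by rewrite scalerDr !scalerA mulrC.
Qed.

#[local] Opaque rawee rawlin rawcf bas.

Definition mulw w1 := rawlin (fun w2 => rawee (w1 ++ w2)).
Definition amul a b : A := rawlin (fun w1 => mulw w1 b) a.

Lemma mulw_ee w1 w2 : mulw w1 (rawee w2) = rawee (w1 ++ w2).
Proof.
rewrite /mulw lin_ee => [|w|w]; [by []|exact: rawee_sort_r|].
by move=> nw; apply: rawee_nadm; apply: contra nw; apply: adm_catr.
Qed.

Lemma amul_ee w1 w2 : amul (rawee w1) (rawee w2) = rawee (w1 ++ w2).
Proof.
rewrite /amul lin_ee => [|w|w nw]; rewrite ?mulw_ee; [by []|exact: rawee_sort_l|].
by apply: rawee_nadm; apply: contra nw; apply: adm_catl.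
Qed.

Lemma amulPl c u v b : amul (c *: u + v) b = c *: amul u b + amul v b.
Proof. by rewrite /amul linearP. Qed.

Lemma amulPr a c u v : amul a (c *: u + v) = c *: amul a u + amul a v.
Proof.
apply: etrans (lin_comb c (mulw^~ u) (mulw^~ v) a); apply: eq_lin => w.
exact: linearP.
Qed.

Definition amulA := bil_assoc rawalg_ind amulPl amulPr amul_ee.
Definition amul1 := bil_1 rawalg_ind amulPr amul_ee.
Definition amulr1 := bil_r1 rawalg_ind amulPl amul_ee.
Definition amulDl := bil_Dl amulPl.
Definition amulDr := bil_Dr amulPr.

Lemma rawee1_neq0 : rawee [::] != 0.
Proof.
apply/eqP => /(congr1 (rawcf [::])); rewrite rawcf_ee ?(adm_nil S) //= linear0.
by move/eqP; rewrite oner_eq0.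
Qed.

HB.instance Definition _ := GRing.Zmodule_isNzRing.Build A
  amulA amul1 amulr1 amulDl amulDr rawee1_neq0.
HB.instance Definition _ :=
  GRing.Lmodule_isLalgebra.Build rat A (bil_scalel amulPl).
HB.instance Definition _ :=
  GRing.Lalgebra_isAlgebra.Build rat A (bil_scaler amulPr).

End RawAlg.

(* [alg_specP] is opaque, since unification would otherwise unfold the finitely
   supported functions. *)
Record alg_spec (S : shape) : Type := AlgSpec {
  carrier : algType rat;
  word : seq nat -> carrier;
  spec_ind : forall P : carrier -> Prop, P 0 ->
    (forall c u v, P u -> P v -> P (c *: u + v)) ->
    (forall w, adm S w -> sorted leq w -> P (word w)) -> forall a, P a;
  spec_cat : forall w1 w2, word (w1 ++ w2) = word w1 * word w2;
  spec_nil : word [::] = 1;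
  spec_perm : forall w w', perm_eq w w' ->
    word w = (-1) ^+ (inv (par S) w + inv (par S) w') *: word w';
  spec_nadm : forall w, ~~ adm S w -> word w = 0;
  spec_lin : forall V : lmodType rat, (seq nat -> V) -> {linear carrier -> V};
  spec_linE : forall (V : lmodType rat) (f : seq nat -> V) w,
    adm S w -> sorted leq w -> spec_lin f (word w) = f w
}.

Lemma alg_specP (S : shape) : alg_spec S.
Proof.
apply: (@AlgSpec S (rawalg S) (@rawee S) (@rawalg_ind S) _ _ (@rawee_perm S)
  (@rawee_nadm S) (fun V f => @rawlin S V f)).
- by move=> w1 w2; apply/esym/amul_ee.
- by [].
- by move=> V f w aw sw; apply: lin_rawee.
Qed.

Definition alg (S : shape) : algType rat := carrier (alg_specP S).
Definition ee (S : shape) : seq nat -> alg S := word (alg_specP S).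

(** * Universal property and grading of the word algebra *)

Section AlgTheory.
Variable S : shape.
Local Notation A := (alg S).
Local Notation ee := (@ee S).
Local Notation deg := (deg S).
Local Notation par := (par S).
Local Notation adm := (adm S).
Implicit Types (a b : A) (w : seq nat).

Definition degw w := (\sum_(i <- w) deg i)%N.

Lemma degw_cat w1 w2 : degw (w1 ++ w2) = (degw w1 + degw w2)%N.
Proof. exact: big_cat. Qed.

Lemma degw_cons i w : degw (i :: w) = (deg i + degw w)%N.
Proof. exact: big_cons. Qed.

Lemma degw_nil : degw [::] = 0%N.
Proof. exact: big_nil. Qed.

Lemma degw_sort w : degw (sort leq w) = degw w.
Proof. by apply: perm_big; rewrite perm_sort. Qed.

Definition lina (V : lmodType rat) (f : seq nat -> V) : {linear A -> V} :=
  spec_lin (alg_specP S) f.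

Lemma lina_ee (V : lmodType rat) (f : seq nat -> V) w :
  adm w -> sorted leq w -> lina f (ee w) = f w.
Proof. exact: spec_linE. Qed.

Lemma ee_ind (P : A -> Prop) : P 0 ->
    (forall c u v, P u -> P v -> P (c *: u + v)) ->
    (forall w, adm w -> sorted leq w -> P (ee w)) -> forall a, P a.
Proof. exact: spec_ind. Qed.

Lemma ee_cat w1 w2 : ee (w1 ++ w2) = ee w1 * ee w2.
Proof. exact: spec_cat. Qed.

Lemma ee_cons i w : ee (i :: w) = ee [:: i] * ee w.
Proof. exact: (ee_cat [:: i]). Qed.

Lemma ee_nil : ee [::] = 1. Proof. exact: spec_nil. Qed.

Lemma ee_nadm w : ~~ adm w -> ee w = 0.
Proof. exact: spec_nadm. Qed.

Lemma ee_permE w w' : perm_eq w w' ->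
  ee w = (-1) ^+ (inv par w + inv par w') *: ee w'.
Proof. exact: spec_perm. Qed.

Lemma ee_sortE w : ee w = (-1) ^+ inv par w *: ee (sort leq w).
Proof.
rewrite {1}(@ee_permE _ (sort leq w)); last by rewrite perm_sym perm_sort.
by rewrite (inv_sorted _ (sort_sorted leq_total w)) addn0.
Qed.

Lemma ee_evalw w : ee w = evalw (fun i => ee [:: i]) w.
Proof.
elim: w => [|i w IH]; first by rewrite ee_nil /evalw big_nil.
by rewrite ee_cons IH evalw_cons.
Qed.

Lemma lina_word (V : lmodType rat) (f : seq nat -> V) w :
  (forall w, f w = (-1) ^+ inv par w *: f (sort leq w)) ->
  (forall w, ~~ adm w -> f w = 0) -> lina f (ee w) = f w.
Proof.
move=> fs f0; case: (boolP (adm w)) => aw; last first.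
  by rewrite ee_nadm // f0 // linear0.
rewrite ee_sortE linearZ /= lina_ee ?(sort_sorted leq_total) //.
by rewrite (@adm_perm S _ w) // perm_sort.
Qed.

Section Hom.
Variables (B : algType rat) (b : nat -> B).
Hypothesis bC : forall i j,
  b i * b j = (-1) ^+ (par i && par j) *: (b j * b i).
Hypothesis b0 : forall w, ~~ adm w -> evalw b w = 0.

Definition ahom : A -> B := lina (evalw b).
HB.instance Definition _ := GRing.Linear.on ahom.

Lemma ahom_ee w : ahom (ee w) = evalw b w.
Proof. by apply: lina_word => // v; apply: evalw_sort. Qed.

Lemma ahom_monoid : monoid_morphism ahom.
Proof.
split; first by rewrite -ee_nil ahom_ee /evalw big_nil.
move=> u v; elim/ee_ind: u => [|c u u' hu hv|w _ _].
- by rewrite mul0r !linear0 mul0r.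
- rewrite mulrDl -scalerAl !(linearP (lina _)) [lina _ (u * v)]hu.
  by rewrite [lina _ (u' * v)]hv mulrDl scalerAl.
elim/ee_ind: v => [|c v v' hu hv|w' _ _].
- by rewrite mulr0 !linear0 mulr0.
- rewrite mulrDr -scalerAr !(linearP (lina _)) [lina _ (_ * v)]hu.
  by rewrite [lina _ (_ * v')]hv mulrDr scalerAr.
by rewrite -ee_cat !ahom_ee evalw_cat.
Qed.
HB.instance Definition _ := GRing.isMonoidMorphism.Build A B ahom ahom_monoid.

Lemma hom_exists : exists g : {lrmorphism A -> B},
  forall w, g (ee w) = evalw b w.
Proof. by exists ahom => w; apply: ahom_ee. Qed.
End Hom.

Lemma letterC i j :
  ee [:: i] * ee [:: j] = (-1) ^+ (par i && par j) *: (ee [:: j] * ee [:: i]).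
Proof.
rewrite -!ee_cat /=; have [->|ij] := eqVneq i j.
  rewrite andbb; case: (boolP (par j)) => pj; last by rewrite scale1r.
  by rewrite ee_nadm ?scaler0 ?adm_sq.
rewrite (@ee_permE [:: i; j] [:: j; i]) ?(permEl (perm_catC [:: i] [:: j])) //.
apply: signr_scale; rewrite /= /inv1 /= !addn0.
by case: (par i); case: (par j) => //=; case: (ltngtP i j) ij.
Qed.

Definition acomp (i : nat) : {linear A -> A} :=
  lina (fun w => if degw w == i then ee w else 0).

Lemma acomp_ee i w : acomp i (ee w) = if degw w == i then ee w else 0.
Proof.
apply: (lina_word (f := fun w => if degw w == i then ee w else 0)) => v.
  by rewrite degw_sort; case: eqP; rewrite ?scaler0 // => _; apply: ee_sortE.
by move/ee_nadm ->; rewrite if_same.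
Qed.

Lemma acompE i j a : acomp i (acomp j a) = if i == j then acomp j a else 0.
Proof.
elim/ee_ind: a => [|c u v hu hv|w _ _].
- by rewrite !linear0 if_same.
- by rewrite !linearP hu hv; case: eqP => // _; rewrite scaler0 addr0.
rewrite !acomp_ee; have [e|ne] := eqVneq (degw w) j.
  by rewrite acomp_ee e eq_sym; case: eqP.
by rewrite linear0 if_same.
Qed.

Lemma acomp_sum a : exists n, a = \sum_(i < n) acomp i a.
Proof.
(* The claim is strengthened to all larger bounds, so that two summands can share one. *)
suff [n hn] : exists n, forall m, (n <= m)%N -> a = \sum_(i < m) acomp i a.
  by exists n; apply: hn.
elim/ee_ind: a => [|c u v [n hn] [m hm]|w _ _].
- by exists 0%N => m _; rewrite big1 // => i _; rewrite linear0.
- exists (maxn n m) => k; rewrite geq_max => /andP[nk mk].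
  under eq_bigr => i _ do rewrite linearP.
  by rewrite big_split -scaler_sumr /= -hn -?hm.
exists (degw w).+1 => m hm; rewrite (bigD1 (Ordinal hm)) //= acomp_ee eqxx.
rewrite big1 ?addr0 // => i ni; rewrite acomp_ee; case: eqP => // e.
by case/eqP: ni; apply: val_inj; rewrite /= e.
Qed.

Lemma acomp_one : acomp 0 1 = 1.
Proof. by rewrite -ee_nil acomp_ee degw_nil. Qed.

Lemma acomp_mul i j a b : acomp i a = a -> acomp j b = b ->
  acomp (i + j) (a * b) = a * b.
Proof.
move=> <- <-; elim/ee_ind: a => [|c u u' hu hv|w _ _].
- by rewrite !linear0 mul0r linear0.
- by rewrite linearP mulrDl -scalerAl linearP hu hv.
elim/ee_ind: b => [|c v v' hu hv|w' _ _].
- by rewrite linear0 mulr0 linear0.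
- by rewrite linearP mulrDr -scalerAr linearP hu hv.
rewrite !acomp_ee; case: eqP => [<-|_]; last by rewrite mul0r linear0.
case: eqP => [<-|_]; last by rewrite mulr0 linear0.
by rewrite -ee_cat acomp_ee degw_cat eqxx.
Qed.

Lemma wordC w1 w2 :
  ee w1 * ee w2 = (-1) ^+ (degw w1 * degw w2) *: (ee w2 * ee w1).
Proof.
have letw i w : ee [:: i] * ee w = (-1) ^+ (deg i * degw w) *: (ee w * ee [:: i]).
  elim: w => [|j w IH].
    by rewrite ee_nil degw_nil muln0 scale1r mulr1 mul1r.
  rewrite !(ee_cons j w) mulrA letterC -scalerAl -!mulrA IH -scalerAr scalerA.
  rewrite -exprD degw_cons; apply: signr_scale.
  by rewrite mulnDr !oddD !parE !oddM oddb.
elim: w1 => [|i w1 IH]; first by rewrite ee_nil degw_nil scale1r mulr1 mul1r.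
rewrite (ee_cons i w1) -mulrA IH -scalerAr (mulrA (ee [:: i])) letw -scalerAl.
rewrite scalerA -mulrA.
by rewrite -exprD degw_cons mulnDl addnC.
Qed.

Lemma acomp_comm i j a b : acomp i a = a -> acomp j b = b ->
  a * b = (-1) ^+ (i * j) *: (b * a).
Proof.
move=> <- <-; elim/ee_ind: a => [|c u u' hu hv|w _ _].
- by rewrite !linear0 mul0r mulr0 scaler0.
- by rewrite linearP mulrDl mulrDr -scalerAl -scalerAr scalerDr hu hv !scalerA mulrC.
elim/ee_ind: b => [|c v v' hu hv|w' _ _].
- by rewrite linear0 mul0r mulr0 scaler0.
- by rewrite linearP mulrDl mulrDr -scalerAl -scalerAr scalerDr hu hv !scalerA mulrC.
rewrite !acomp_ee; case: eqP => [<-|_]; last by rewrite mul0r mulr0 scaler0.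
case: eqP => [<-|_]; last by rewrite mul0r mulr0 scaler0.
exact: wordC.
Qed.

Definition galg : gca :=
  Gca acompE acomp_sum acomp_one acomp_mul acomp_comm.
End AlgTheory.

(** * Homogeneous elements and derivations *)

Section GcaTheory.
Variable A : gca.
Implicit Types a b : A.

Lemma homog_comp i a : homog i (comp A i a).
Proof. by rewrite /homog compE eqxx. Qed.

Lemma homog0 i : homog i (0 : A).
Proof. exact: linear0. Qed.

Lemma homog_comb i c a b : homog i a -> homog i b -> homog i (c *: a + b).
Proof. by rewrite /homog linearP => -> ->. Qed.

Lemma homogZ i c a : homog i a -> homog i (c *: a).
Proof. by rewrite /homog linearZ /= => ->. Qed.

Lemma homogD i a b : homog i a -> homog i b -> homog i (a + b).
Proof. by rewrite /homog linearD => -> ->. Qed.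

Lemma homogN i a : homog i a -> homog i (- a).
Proof. by rewrite /homog linearN => ->. Qed.

Lemma homogB i a b : homog i a -> homog i b -> homog i (a - b).
Proof. by move=> ha hb; apply/homogD/homogN. Qed.

Lemma homogM i j a b : homog i a -> homog j b -> homog (i + j) (a * b).
Proof. exact: comp_mul. Qed.

Lemma homogM_eq k i j a b :
  homog i a -> homog j b -> k = (i + j)%N -> homog k (a * b).
Proof. by move=> ha hb ->; apply: homogM. Qed.

Lemma homog1 : homog 0 (1 : A).
Proof. exact: comp_one. Qed.

Lemma homog_neq i j a : homog i a -> i != j -> comp A j a = 0.
Proof. by move=> <- ij; rewrite compE eq_sym (negPf ij). Qed.

Lemma homog_uniq i j a : homog i a -> homog j a -> i != j -> a = 0.
Proof. by move=> hi hj ij; rewrite -hj (homog_neq hi ij). Qed.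

Lemma comp_ext a b : (forall i, comp A i a = comp A i b) -> a = b.
Proof.
move=> e; apply/eqP; rewrite -subr_eq0; apply/eqP.
have [n ->] := comp_sum (a - b); rewrite big1 // => i _.
by rewrite linearB /= e subrr.
Qed.

Lemma homog_oddC i j a b : homog i a -> homog j b -> odd i -> odd j ->
  a * b = - (b * a).
Proof.
move=> ha hb oi oj; rewrite (gca_comm ha hb) -signr_odd oddM oi oj.
by rewrite expr1 scaleN1r.
Qed.

Lemma homog_evenC i j a b : homog i a -> homog j b -> ~~ odd i ->
  a * b = b * a.
Proof.
move=> ha hb oi; rewrite (gca_comm ha hb) -signr_odd oddM (negPf oi).
by rewrite scale1r.
Qed.

Lemma eqN0 (V : lmodType rat) (v : V) : v = - v -> v = 0.
Proof.
move/eqP; rewrite -subr_eq0 opprK -mulr2n -scaler_nat scaler_eq0.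
by case/orP => /eqP // /eqP; rewrite pnatr_eq0.
Qed.

Lemma homog_sq0 i a : homog i a -> odd i -> a * a = 0.
Proof. by move=> ha oi; apply: eqN0; apply: (homog_oddC ha ha). Qed.

Section Derivation.
Variable d : {linear A -> A}.
Hypothesis hd : derivation d.

Lemma der_homog i a : homog i a -> homog i.+1 (d a).
Proof. by case: hd => h _; apply: h. Qed.

Lemma derM i a b : homog i a -> d (a * b) = d a * b + (-1) ^+ i *: (a * d b).
Proof. by case: hd => _; apply. Qed.

Lemma der_oddM i a b : homog i a -> odd i -> d (a * b) = d a * b - a * d b.
Proof. by move=> ha oi; rewrite (derM _ ha) -signr_odd oi expr1 scaleN1r. Qed.

Lemma der_evenM i a b : homog i a -> ~~ odd i -> d (a * b) = d a * b + a * d b.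
Proof. by move=> ha oi; rewrite (derM _ ha) -signr_odd (negPf oi) scale1r. Qed.

Lemma der1 : d 1 = 0.
Proof.
have := derM 1 homog1; rewrite !mulr1 mul1r scale1r => /eqP.
by rewrite -subr_eq0 opprD addrA subrr sub0r oppr_eq0 => /eqP.
Qed.

Lemma der_comp i a : d (comp A i a) = comp A i.+1 (d a).
Proof.
have [n ->] := comp_sum a; rewrite !linear_sum; apply: eq_bigr => j _ /=.
have hj := der_homog (homog_comp j a); rewrite compE.
have [->|ij] := eqVneq i j; first by rewrite hj. 
by rewrite linear0 (homog_neq hj) // eqSS eq_sym.
Qed.

Lemma der_comp0 a : comp A 0 (d a) = 0.
Proof.
have [n ->] := comp_sum a; rewrite !linear_sum big1 // => j _ /=.
by rewrite (homog_neq (der_homog (homog_comp j a))).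
Qed.
End Derivation.
End GcaTheory.

Lemma ghom_homog (A B : gca) (g : ghom A B) i a : homog i a -> homog i (g a).
Proof. by rewrite /homog -ghom_comp => ->. Qed.

Lemma pair_ext (T U : Type) (x y : T * U) : x.1 = y.1 -> x.2 = y.2 -> x = y.
Proof. by case: x y => [a b] [c d] /= -> ->. Qed.

(** * Derivations as algebra morphisms *)

Section Twist.
Variables (A : algType rat) (tau : {lrmorphism A -> A}).

(* The upper triangular matrices [[tau a, u], [0, a]]: a derivation d with
   d (a b) = d a b + tau a d b is an algebra morphism a |-> (a, d a). *)
Definition twist_of (t : {lrmorphism A -> A}) : Type := (A * A)%type.
Local Notation twist := (twist_of tau).
HB.instance Definition _ := GRing.Lmodule.copy twist (A * A)%type.

Definition tmul (x y : twist) : twist := (x.1 * y.1, x.2 * y.1 + tau x.1 * y.2).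
Definition tone : twist := (1, 0).

Lemma tmulA : associative tmul.
Proof.
move=> [a u] [b v] [c w]; rewrite /tmul /= mulrA; congr pair.
by rewrite rmorphM mulrDr mulrDl !mulrA addrA.
Qed.
Lemma tmul1 : left_id tone tmul.
Proof. by move=> [a u]; rewrite /tmul /= rmorph1 mul0r !mul1r add0r. Qed.
Lemma tmulr1 : right_id tone tmul.
Proof. by move=> [a u]; rewrite /tmul /= mulr0 !mulr1 addr0. Qed.
Lemma tmulDl : left_distributive tmul +%R.
Proof.
move=> [a u] [b v] [c w]; apply: pair_ext => /=.
  by rewrite mulrDl.
by rewrite raddfD !mulrDl addrACA.
Qed.
Lemma tmulDr : right_distributive tmul +%R.
Proof.
move=> [a u] [b v] [c w]; apply: pair_ext => /=.
  by rewrite mulrDr.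
by rewrite !mulrDr addrACA.
Qed.
Lemma tone_neq0 : tone != 0.
Proof. by apply/eqP => -[/eqP]; rewrite oner_eq0. Qed.
HB.instance Definition _ := GRing.Zmodule_isNzRing.Build twist
  tmulA tmul1 tmulr1 tmulDl tmulDr tone_neq0.
Lemma tscaleAl (c : rat) (x y : twist) : c *: (x * y) = (c *: x : twist) * y.
Proof.
case: x y => [a u] [b v]; apply: pair_ext => /=; first by rewrite scalerAl.
by rewrite linearZ /= scalerDr !scalerAl.
Qed.
HB.instance Definition _ := GRing.Lmodule_isLalgebra.Build rat twist tscaleAl.
Lemma tscaleAr (c : rat) (x y : twist) : c *: (x * y) = x * (c *: y : twist).
Proof.
case: x y => [a u] [b v]; apply: pair_ext => /=; first by rewrite scalerAr.
by rewrite scalerDr !scalerAr.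
Qed.
HB.instance Definition _ := GRing.Lalgebra_isAlgebra.Build rat twist tscaleAr.

Lemma tmulE (x y : twist) :
  x * y = (x.1 * y.1, x.2 * y.1 + tau x.1 * y.2) :> twist.
Proof. by []. Qed.
End Twist.

Section AlgDerivations.
Variable S : shape.
Local Notation A := (galg S).
Local Notation ee := (@ee S).

Lemma homog_ee w : homog (degw S w) (ee w : A).
Proof. by rewrite /homog /= acomp_ee eqxx. Qed.

Lemma homog_letter i : homog (deg S i) (ee [:: i] : A).
Proof. by have := homog_ee [:: i]; rewrite degw_cons degw_nil addn0. Qed.

(** The grading involution: it absorbs the sign of the Leibniz rule into an algebra morphism, as
    [twist_of] requires. *)
Definition tau : alg S -> alg S := @lina S _ (fun w => (-1) ^+ degw S w *: ee w).
HB.instance Definition _ := GRing.Linear.on tau.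

Lemma tau_ee w : tau (ee w) = (-1) ^+ degw S w *: ee w.
Proof.
apply: (@lina_word S _ (fun w => (-1) ^+ degw S w *: ee w)) => v.
  by rewrite degw_sort scalerA mulrC -scalerA -ee_sortE.
by move/ee_nadm ->; rewrite scaler0.
Qed.

Lemma tau_monoid : monoid_morphism tau.
Proof.
split; first by rewrite -ee_nil tau_ee degw_nil scale1r.
move=> u v; elim/ee_ind: u => [|c u u' hu hv|w _ _].
- by rewrite mul0r !linear0 mul0r.
- rewrite mulrDl -scalerAl !(linearP (@lina S _ _)) [@lina S _ _ (u * v)]hu.
  by rewrite [@lina S _ _ (u' * v)]hv mulrDl scalerAl.
elim/ee_ind: v => [|c v v' hu hv|w' _ _].
- by rewrite mulr0 !linear0 mulr0.
- rewrite mulrDr -scalerAr !(linearP (@lina S _ _)) [@lina S _ _ (_ * v)]hu.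
  by rewrite [@lina S _ _ (_ * v')]hv mulrDr scalerAr.
by rewrite -ee_cat !tau_ee degw_cat exprD ee_cat -scalerAl -scalerAr scalerA.
Qed.
HB.instance Definition _ :=
  GRing.isMonoidMorphism.Build (alg S) (alg S) tau tau_monoid.

Lemma tau_homog i (a : A) : homog i a -> tau a = (-1) ^+ i *: (a : alg S).
Proof.
move=> <-; elim/ee_ind: (a : alg S) => [|c u v hu hv|w _ _].
- by rewrite !linear0.
- by rewrite !linearP /= hu hv.
rewrite /= acomp_ee; case: eqP => [<-|_]; first exact: tau_ee.
by rewrite linear0 scaler0.
Qed.

Variable d0 : nat -> A.
Hypothesis hd0 : forall i, homog (deg S i).+1 (d0 i).

Definition tlet (i : nat) : twist_of tau := (ee [:: i], d0 i).

Lemma twist_letterC i j :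
  tlet i * tlet j = (-1) ^+ (par S i && par S j) *: (tlet j * tlet i).
Proof.
have t k : tau (ee [:: k]) = (-1) ^+ par S k *: ee [:: k].
  rewrite tau_ee degw_cons degw_nil addn0; apply: signr_scale.
  by rewrite parE oddb.
rewrite !tmulE /= !t; apply: pair_ext => /=; first exact: letterC.
rewrite scalerDr addrC -!scalerAl scalerA; congr (_ + _).
  rewrite (@gca_comm A _ _ _ _ (homog_letter i) (hd0 j)) scalerA -exprD.
  by apply: signr_scale; rewrite !oddD oddM /= -!parE !oddb; case: (par S i); case: (par S j).
rewrite (@gca_comm A _ _ _ _ (hd0 i) (homog_letter j)) -exprD.
by apply: signr_scale; rewrite !oddD oddM /= -!parE !oddb; case: (par S i); case: (par S j).
Qed.

(** A derivation with prescribed values on letters is a morphism into the twisted algebra, so only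
    the relations of the shape have to be checked there. For a free shape this is [free_vanish]. *)
Lemma der_exists :
  (forall w, ~~ adm S w ->
     evalw tlet w = 0) ->
  exists d : {linear A -> A},
    derivation d /\ forall i, d (ee [:: i]) = d0 i.
Proof.
move=> h0; have [g hg] := hom_exists twist_letterC h0.
pose d : A -> A := fun a => (g a).2.
have dl : linear d by move=> c u v; rewrite /d linearP.
pose D : {linear A -> A} := HB.pack d (GRing.isLinear.Build _ _ _ _ d dl).
have d00 : d 0 = 0 by exact: (linear0 D).
have g1 a : (g a).1 = a.
  elim/ee_ind: a => [|c u v hu hv|w _ _]; first by rewrite linear0.
    by rewrite linearP /= hu hv.
  rewrite hg ee_evalw; elim: w => [|i w IH]; rewrite ?/evalw ?big_nil //.
  by rewrite !big_cons tmulE /=; congr (_ * _).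
have gi i : d (ee [:: i]) = d0 i by rewrite /d hg /evalw big_cons big_nil mulr1.
have dM a b : d (a * b) = d a * b + tau a * d b.
  by rewrite /d rmorphM tmulE /= !g1.
exists D; split=> //; split=> /= [i a|i a b ha]; last first.
  by rewrite dM (tau_homog ha) scalerAl.
suff dw w : homog (degw S w).+1 (d (ee w) : A).
  move=> <-; elim/ee_ind: (a : alg S) => [|c u v hu hv|w _ _].
  - by rewrite linear0 d00; apply: (@homog0 A).
  - by rewrite linearP /= dl; apply: (@homog_comb A).
  by rewrite /= acomp_ee; case: eqP => [<-|_] //; rewrite d00; apply: (@homog0 A).
elim: w => [|k w IH].
  have -> : d (ee [::]) = 0; last exact: homog0.
  have := dM (ee [::]) (ee [::]); rewrite -ee_cat /= ee_nil rmorph1 mulr1 mul1r.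
  by move/eqP; rewrite -subr_eq0 opprD addrA subrr sub0r oppr_eq0 => /eqP.
rewrite ee_cons dM degw_cons gi; apply: homogD.
  exact: (homogM_eq (hd0 k) (homog_ee w)).
rewrite (tau_homog (homog_letter k)) -scalerAl; apply: (@homogZ A).
by apply: (homogM_eq (homog_letter k) IH); rewrite addnS.
Qed.
End AlgDerivations.

(** * Morphisms and derivations determined by letters *)

Section OnLetters.
Variable S : shape.
Local Notation A := (galg S).
Local Notation ee := (@ee S).

Lemma gee_ind (P : A -> Prop) : P 0 ->
    (forall c u v, P u -> P v -> P (c *: u + v)) ->
    (forall w, adm S w -> sorted leq w -> P (ee w)) -> forall a, P a.
Proof. exact: ee_ind. Qed.

Lemma der_words (B : gca) (g : ghom A B) (dA : {linear A -> A})
    (dB : {linear B -> B}) : derivation dA -> derivation dB ->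
  (forall i, adm S [:: i] -> g (dA (ee [:: i])) = dB (g (ee [:: i]))) ->
  forall a, g (dA a) = dB (g a).
Proof.
move=> hA hB hi; apply: gee_ind => [|c u v hu hv|w aw _].
- by rewrite !linear0.
- by rewrite !linearP /= hu hv.
elim: w aw => [_|i w IH aw].
  by rewrite ee_nil (der1 hA) rmorph1 (der1 hB) linear0.
have ai := @adm_catl S [:: i] w aw; have {}IH := IH (@adm_catr S [:: i] w aw).
rewrite ee_cons (derM hA _ (homog_letter S i)) rmorphM.
rewrite (derM hB _ (ghom_homog g (homog_letter S i))).
by rewrite linearD linearZ !rmorphM /= hi // IH.
Qed.

Lemma der_sq_words (d : {linear A -> A}) : derivation d ->
  (forall i, adm S [:: i] -> d (d (ee [:: i])) = 0) -> forall a, d (d a) = 0.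
Proof.
move=> hd hi; apply: gee_ind => [|c u v hu hv|w aw _].
- by rewrite !linear0.
- by rewrite !linearP /= hu hv scaler0 addr0.
elim: w aw => [_|i w IH aw].
  by rewrite ee_nil (der1 hd) linear0.
have ai := @adm_catl S [:: i] w aw; have {}IH := IH (@adm_catr S [:: i] w aw).
have hl := homog_letter S i.
rewrite ee_cons (derM hd _ hl) linearD linearZ /=.
rewrite (derM hd _ (der_homog hd hl)) (derM hd _ hl) IH hi //.
by rewrite mulr0 scaler0 mul0r add0r addr0 exprS mulN1r scaleNr addNr.
Qed.

Lemma ghom_letters (B : gca) (g g' : ghom A B) :
  (forall i, adm S [:: i] -> g (ee [:: i]) = g' (ee [:: i])) -> g =1 g'.
Proof.
move=> h; apply: gee_ind => [|c u v hu hv|w aw _].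
- by rewrite !linear0.
- by rewrite !linearP /= hu hv.
elim: w aw => [_|i w IH aw]; first by rewrite ee_nil !rmorph1.
have ai := @adm_catl S [:: i] w aw; have {}IH := IH (@adm_catr S [:: i] w aw).
by rewrite ee_cons !rmorphM /= h // IH.
Qed.

Lemma ghom_exists (B : gca) (b : nat -> B) :
  (forall i, homog (deg S i) (b i)) ->
  (forall w, ~~ adm S w -> evalw b w = 0) ->
  exists g : ghom A B, forall w, g (ee w) = evalw b w.
Proof.
move=> hb h0.
have bC i j : b i * b j = (-1) ^+ (par S i && par S j) *: (b j * b i).
  rewrite (gca_comm (hb i) (hb j)); apply: signr_scale.
  by rewrite oddM -!parE oddb.
have [g hg] := hom_exists bC h0.
have hw w : homog (degw S w) (evalw b w).
  elim: w => [|i w IH]; first by rewrite degw_nil /evalw big_nil; apply: homog1.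
  by rewrite degw_cons evalw_cons; apply: homogM.
have gc i (a : A) : g (comp A i a) = comp B i (g a).
  elim/gee_ind: a => [|c u v hu hv|w _ _].
  - by rewrite !linear0.
  - by rewrite !linearP /= hu hv.
  rewrite /= acomp_ee hg; case: eqP => [<-|/eqP ne]; first by rewrite hg hw.
  by rewrite linear0 (homog_neq (hw w)).
by exists (Ghom gc) => w; apply: hg.
Qed.
End OnLetters.

(** * Free graded commutative algebras *)

Section FreeShape.
Variables (deg0 : nat -> nat) (par0 : nat -> bool) (u : pred nat).
Hypothesis parE0 : forall i, par0 i = odd (deg0 i).

Definition oddfree (w : seq nat) : bool :=
  all (fun i => par0 i ==> (count_mem i w <= 1)%N) w.

Lemma oddfreeP w :
  reflect (forall i, par0 i -> (count_mem i w <= 1)%N) (oddfree w).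
Proof.
apply: (iffP allP) => [h i pi|h i iw]; last by apply/implyP/h.
case: (boolP (i \in w)) => [/h|iw]; first by rewrite pi.
by rewrite (count_memPn iw).
Qed.

Lemma free_perm w w' : perm_eq w w' ->
  oddfree w && all u w = oddfree w' && all u w'.
Proof.
move=> p; rewrite (perm_all _ p); congr (_ && _).
by apply/oddfreeP/oddfreeP => h i /h; rewrite (permP p).
Qed.

Lemma free_catl w w' :
  oddfree (w ++ w') && all u (w ++ w') -> oddfree w && all u w.
Proof.
rewrite all_cat => /and3P[/oddfreeP h -> _]; rewrite andbT.
by apply/oddfreeP => i /h; rewrite count_cat; lia.
Qed.

Lemma free_sq i : par0 i -> oddfree [:: i; i] && all u [:: i; i] = false.
Proof. by move=> pi; rewrite /oddfree /= pi eqxx. Qed.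

(** The alphabet is always [nat], and [u] selects the letters in use; the others are zero. Finite
    and infinite sets of generators are thus treated alike. *)
Definition freeS : shape :=
  @Shape deg0 par0 (fun w => oddfree w && all u w) parE0 free_perm free_catl
    isT free_sq.

(** A repeated odd letter can be moved next to its copy at the cost of a sign, and its square
    vanishes because 2 is invertible. *)
Lemma free_vanish (B : algType rat) (b : nat -> B) :
  (forall i j, b i * b j = (-1) ^+ (par0 i && par0 j) *: (b j * b i)) ->
  (forall i, ~~ u i -> b i = 0) ->
  forall w, ~~ adm freeS w -> evalw b w = 0.
Proof.
move=> bC bu w /=; rewrite negb_and => /orP[|/allPn[i iw ui]]; last first.
  have [w1 w2] := splitPr iw.
  by rewrite evalw_cat evalw_cons bu // mul0r mulr0.
case/allPn => i iw; rewrite negb_imply -ltnNge => /andP[pi ci].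
have p1 := perm_to_rem iw.
have iw' : i \in rem i w.
  by rewrite -has_pred1 has_count; move: ci; rewrite (permP p1) /= eqxx; lia.
have p : perm_eq w (i :: i :: rem i (rem i w)).
  by apply: (perm_trans p1); rewrite perm_cons perm_to_rem.
rewrite (evalw_sort bC) (perm_sort_eq p) -[evalw _ _]scale1r -(expr0 (-1)).
have := evalw_sort bC (i :: i :: rem i (rem i w)).
rewrite !evalw_cons mulrA.
have -> : b i * b i = 0.
  by apply: eqN0; rewrite {1}bC pi expr1 scaleN1r.
rewrite mul0r => /esym/eqP; rewrite scaler_eq0 => /orP[|/eqP ->].
  by rewrite expf_eq0 oppr_eq0 oner_eq0 andbF.
by rewrite !scaler0.
Qed.

Lemma free_ghom (B : gca) (b : nat -> B) :
  (forall i, homog (deg0 i) (b i)) -> (forall i, ~~ u i -> b i = 0) ->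
  exists g : ghom (galg freeS) B, forall i, g (ee freeS [:: i]) = b i.
Proof.
move=> hb bu; have [|g hg] := @ghom_exists freeS B b hb.
  apply: free_vanish => // i j; rewrite (gca_comm (hb i) (hb j)).
  by apply: signr_scale; rewrite oddM -!parE0 oddb.
by exists g => i; rewrite hg /evalw big_cons big_nil mulr1.
Qed.

Lemma free_der (d0 : nat -> galg freeS) :
  (forall i, homog (deg0 i).+1 (d0 i)) -> (forall i, ~~ u i -> d0 i = 0) ->
  exists d : {linear galg freeS -> galg freeS},
    derivation d /\ forall i, d (ee freeS [:: i]) = d0 i.
Proof.
move=> hd0 du; apply: der_exists => //; apply: free_vanish => [i j|i ui].
  exact: twist_letterC.
apply: pair_ext => /=; last exact: du.
by rewrite ee_nadm //= (negPf ui) /= andbF.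
Qed.
End FreeShape.

(** * Linear algebra and powers of the augmentation ideal *)

Section LinearAlgebra.
Variable V : lmodType rat.
Implicit Types (v x y : V) (s t : seq V) (X Y : V -> Prop).

Definition lsub X : Prop := X 0 /\ forall c u v, X u -> X v -> X (c *: u + v).

(** The recursion on the list exposes the coefficient of its head, which is the pivot of the
    elimination in [complement]. *)
Fixpoint lspan s v : Prop :=
  if s is x :: s' then exists c, lspan s' (v - c *: x) else v = 0.

Lemma lsubZ X c v : lsub X -> X v -> X (c *: v).
Proof. by case=> X0 Xl Xv; rewrite -[c *: v]addr0; apply: Xl. Qed.

Lemma lsubD X u v : lsub X -> X u -> X v -> X (u + v).
Proof. by case=> X0 Xl Xu Xv; rewrite -[u]scale1r; apply: Xl. Qed.

Lemma lsubB X u v : lsub X -> X u -> X v -> X (u - v).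
Proof. by move=> hX Xu Xv; rewrite -scaleN1r; apply: lsubD => //; apply: lsubZ. Qed.

Lemma lsub_sum X (I : Type) (r : seq I) (P : pred I) (F : I -> V) :
  lsub X -> (forall i, P i -> X (F i)) -> X (\sum_(i <- r | P i) F i).
Proof.
move=> hX hF; apply: big_rec => [|i v Pi Xv]; first by case: hX.
by apply: lsubD => //; apply: hF.
Qed.

Lemma lsub_lspan s : lsub (lspan s).
Proof.
elim: s => [|x s [s0 sl]]; first by split=> //= c u v -> ->; rewrite scaler0 addr0.
split=> [|c u v [a ua] [b vb]] /=; first by exists 0; rewrite scale0r subr0.
exists (c * a + b); have := sl c _ _ ua vb; rewrite scalerBr scalerA.
by rewrite scalerDl opprD addrACA.
Qed.

Lemma lspan_cons x s v : lspan s v -> lspan (x :: s) v.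
Proof. by exists 0; rewrite scale0r subr0. Qed.

Lemma lspan_mem s v : v \in s -> lspan s v.
Proof.
elim: s => // x s IH; rewrite inE => /predU1P[->|/IH]; last exact: lspan_cons.
by exists 1; rewrite scale1r subrr; case: (lsub_lspan s).
Qed.

Lemma lspan_sub s X : lsub X -> (forall x, x \in s -> X x) ->
  forall v, lspan s v -> X v.
Proof.
move=> hX; elim: s => [|x s IH] sX v /=; first by move=> ->; case: hX.
case=> c /IH h; rewrite -[v](subrK (c *: x)); apply: lsubD => //.
  by apply: h => y ys; apply: sX; rewrite inE ys orbT.
by apply: lsubZ => //; apply: sX; rewrite inE eqxx.
Qed.

Lemma lspanP s v :
  lspan s v <-> exists c : nat -> rat, v = \sum_(i < size s) c i *: nth 0 s i.
Proof.
split=> [|[c ->]]; last first.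
  apply: (lsub_sum _ (lsub_lspan s)) => i _; apply: (lsubZ _ (lsub_lspan s)).
  by apply/lspan_mem/mem_nth.
elim: s v => [|x s IH] v /=; first by move=> ->; exists (fun=> 0); rewrite big_ord0.
case=> c /IH [c' e]; exists (fun i => if i is j.+1 then c' j else c).
by rewrite big_ord_recl /= -e addrC subrK.
Qed.

(** A basis of X modulo Y by Gaussian elimination along the spanning list: the head [z] yields a new
    basis vector exactly when the vectors of X that avoid [z] do not suffice. It serves for a
    complement of cocycles and for choosing new generators. *)
Lemma complement s X Y : lsub X -> lsub Y -> (forall x, X x -> lspan s x) ->
  exists t : seq V, [/\ forall x, x \in t -> X x,
    forall x, X x -> exists y, Y y /\ lspan t (x - y)
    & forall c : nat -> rat, Y (\sum_(i < size t) c i *: nth 0 t i) ->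
        forall i, (i < size t)%N -> c i = 0].
Proof.
elim: s X => [|z s IH] X hX hY Xs.
  exists [::]; split=> // x /Xs /= ->.
  by exists 0; rewrite subr0; split=> //; case: hY.
pose X' x := X x /\ lspan s x.
have hX' : lsub X'.
  split=> [|c u v [Xu su] [Xv sv]]; first by split; [case: hX|case: (lsub_lspan s)].
  by split; [case: hX => _|case: (lsub_lspan s) => _]; apply.
have [t [tX tS tI]] := IH X' hX' hY (fun x => @proj2 _ _).
pose good x := exists y, Y y /\ lspan t (x - y).
have gsub : lsub good.
  split=> [|c u v [y [Yy ty]] [y' [Yy' ty']]].
    by exists 0; rewrite subr0; split; [case: hY|case: (lsub_lspan t)].
  exists (c *: y + y'); split; first by case: hY => _; apply.
  rewrite opprD addrACA -scalerBr.
  by case: (lsub_lspan t) => _; apply.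
have [[x0 [Xx0 nx0]]|none] := pselect (exists x, X x /\ ~ good x); last first.
  exists t; split=> // [x /tX[]|x Xx] //.
  by apply: contrapT => ng; apply: none; exists x.
have [c0 hc0] := Xs _ Xx0.
have c0n : c0 != 0.
  by apply/eqP => c00; apply/nx0/tS; split=> //; move: hc0; rewrite c00 scale0r subr0.
exists (x0 :: t); split=> [x|x Xx|c] /=.
- by rewrite inE => /predU1P[->|/tX[]].
- have [c hc] := Xs _ Xx.
  (* The multiple of [x0] is chosen to cancel the coefficient of [z]. *)
  have : X' (x - (c / c0) *: x0).
    split; first by apply: lsubB => //; apply: lsubZ.
    have -> : x - (c / c0) *: x0 = (x - c *: z) - (c / c0) *: (x0 - c0 *: z).
      by rewrite scalerBr scalerA divfK // opprB addrA subrK.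
    by apply: (lsubB (lsub_lspan s)) => //; apply: (lsubZ _ (lsub_lspan s)).
  move=> /tS [y [Yy ty]]; exists y; split=> //; exists (c / c0).
  by rewrite addrAC.
rewrite big_ord_recl /= => Yc.
have tt : lspan t (\sum_(i < size t) c i.+1 *: nth 0 t i).
  by apply/lspanP; exists (fun i => c i.+1).
have c00 : c 0%N = 0.
  apply/eqP/negPn/negP => cn; apply: nx0.
  exists ((c 0%N)^-1 *: (c 0%N *: x0 + \sum_(i < size t) c i.+1 *: nth 0 t i)).
  split; first exact: lsubZ.
  rewrite scalerDr scalerA mulVf // scale1r opprD addrA subrr sub0r -scalerN.
  apply: (lsubZ _ (lsub_lspan t)); rewrite -scaleN1r.
  exact: (lsubZ _ (lsub_lspan t)).
case=> // i; rewrite ltnS; apply: (tI (fun i => c i.+1)).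
by move: Yc; rewrite c00 scale0r add0r.
Qed.
End LinearAlgebra.

(** * Spans and powers of the augmentation ideal *)

Section Spans.
Variable A : gca.
Implicit Types (X Y : set A) (a b : A).

Lemma span_subspace X : subspace (span X).
Proof.
split=> [Y [[Y0 _] _] //|c u v hu hv Y hY].
by have [[_ Yl] XY] := hY; apply: Yl; [apply: hu|apply: hv].
Qed.

Lemma span_mem X a : X a -> span X a.
Proof. by move=> Xa Y [_]; apply. Qed.

Lemma span_min X Y : subspace Y -> (forall a, X a -> Y a) ->
  forall a, span X a -> Y a.
Proof. by move=> hY XY a; apply; split. Qed.

Lemma span_seqP (s : seq A) a : span [set x | x \in s] a -> lspan s a.
Proof.
apply: span_min => [|x]; last exact: lspan_mem.
exact: (lsub_lspan s).
Qed.

Lemma prods_subspace X k : subspace (prods X k).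
Proof. exact: span_subspace. Qed.

Lemma prods_prod X (s : seq A) :
  (forall x, x \in s -> X x) -> prods X (size s) (\prod_(x <- s) x).
Proof.
move=> sX; apply: span_mem; exists (fun i : 'I_(size s) => nth 0 s i).
by split=> [i|]; [apply/sX/mem_nth|rewrite (big_nth 0) big_mkord].
Qed.

Lemma prods_ind X k Y : subspace Y ->
  (forall s : seq A, size s = k -> (forall x, x \in s -> X x) ->
     Y (\prod_(x <- s) x)) ->
  forall a, prods X k a -> Y a.
Proof.
move=> hY hs; apply: span_min => // _ [f [Xf ->]].
have -> : \prod_(i < k) f i = \prod_(x <- [tuple f i | i < k]) x.
  by rewrite big_tuple; apply: eq_bigr => i _; rewrite tnth_mktuple.
by apply: hs => [|x /tnthP[i ->]]; rewrite ?size_tuple ?tnth_mktuple.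
Qed.

Lemma prods_cons X k a b : X a -> prods X k b -> prods X k.+1 (a * b).
Proof.
move=> Xa; move: b; apply: prods_ind => [|s ss sX].
  have [p0 pl] := prods_subspace X k.+1; split; first by rewrite /= mulr0.
  by move=> c u v hu hv /=; rewrite mulrDr -scalerAr; apply: pl.
have asX x : x \in a :: s -> X x by rewrite inE => /predU1P[->|/sX].
by have := prods_prod asX; rewrite big_cons /= ss.
Qed.

Lemma comp_mulE i a b :
  comp A i (a * b) = \sum_(j < i.+1) comp A j a * comp A (i - j) b.
Proof.
have [m ->] := comp_sum a; rewrite mulr_suml linear_sum.
under [RHS]eq_bigr => j _ do rewrite linear_sum mulr_suml.
rewrite exchange_big; apply: eq_bigr => k _ /=.
have [n ->] := comp_sum b; rewrite mulr_sumr linear_sum.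
under [RHS]eq_bigr => j _ do rewrite linear_sum mulr_sumr.
rewrite exchange_big; apply: eq_bigr => l _ /=.
have hk := homog_comp k a; have hl := homog_comp l b.
have hkl := homogM hk hl.
have [ki|ik] := leqP k i; last first.
  rewrite (homog_neq hkl) ?big1 // => [j _|]; last by apply/eqP; lia.
  by rewrite (homog_neq hk) ?mul0r //; apply/eqP; have := ltn_ord j; lia.
rewrite (bigD1 (Ordinal (ki : (k < i.+1)%N))) //= big1 ?addr0 => [|j nj].
  rewrite hk; have [<-|ne] := eqVneq (k + l)%N i.
    by rewrite hkl addKn hl.
  by rewrite (homog_neq hkl) // (homog_neq hl) ?mulr0 //; apply/eqP; lia.
rewrite (homog_neq hk) ?mul0r //; apply: contraNneq nj => e.
by apply/eqP/val_inj => /=.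
Qed.

Lemma comp0M a b : comp A 0 (a * b) = comp A 0 a * comp A 0 b.
Proof. by rewrite comp_mulE big_ord1 subn0. Qed.

Lemma posM a b : pos a -> pos (a * b).
Proof. by rewrite /pos /= comp0M => ->; rewrite mul0r. Qed.

Lemma homog_pos i a : homog i a -> (0 < i)%N -> pos a.
Proof. by move=> ha i0; rewrite /pos /= (homog_neq ha) //; lia. Qed.

Lemma pos_comp i a : pos a -> pos (comp A i a).
Proof. by rewrite /pos /= => pa; rewrite compE; case: eqP => // <-. Qed.

Lemma prods_pos_comp k i a : prods (@pos A) k a -> prods (@pos A) k (comp A i a).
Proof.
move: a; apply: prods_ind => [|s].
  have [p0 pl] := prods_subspace (@pos A) k.
  split=> [|c u v hu hv] /=; first by rewrite linear0.
  by rewrite linearP; apply: pl.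
elim: s k i => [|x s IH] k i <- sp.
  rewrite big_nil; case: i => [|i]; last first.
    by rewrite (homog_neq (homog1 A)) //; case: (prods_subspace (@pos A) 0).
  by have := @prods_prod (@pos A) [::] sp; rewrite big_nil comp_one.
rewrite big_cons comp_mulE; apply: (lsub_sum _ (prods_subspace _ _)) => j _.
apply: prods_cons; first by apply/pos_comp/sp; rewrite inE eqxx.
by apply: IH => // y ys; apply: sp; rewrite inE ys orbT.
Qed.

(** Two factors are multiplied into one. The exponents start at 1 because [prods X 0] is the line of
    scalars, which does not contain the positive elements. *)
Lemma prods_pos_anti k a : prods (@pos A) k.+2 a -> prods (@pos A) k.+1 a.
Proof.
move: a; apply: prods_ind => [|[|x [|y s]] //= [ss] sp]; first exact: prods_subspace.
have sp' z : z \in x * y :: s -> @pos A z.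
  rewrite inE => /predU1P[->|zs]; first by apply/posM/sp; rewrite inE eqxx.
  by apply: sp; rewrite !inE zs !orbT.
by have := prods_prod sp'; rewrite !big_cons mulrA /= ss.
Qed.

Lemma prods_pos_mono k l a : (k <= l)%N ->
  prods (@pos A) l.+1 a -> prods (@pos A) k.+1 a.
Proof.
move=> /subnK <-; elim: (l - k)%N a => // n IH a.
by rewrite addSn => /prods_pos_anti /IH.
Qed.
End Spans.

Lemma prods_ghom (A B : gca) (g : ghom A B) (X : set A) (Y : set B) k a :
  (forall x, X x -> Y (g x)) -> prods X k a -> prods Y k (g a).
Proof.
move=> XY; move: a; apply: prods_ind => [|s <- sX].
  have [p0 pl] := prods_subspace Y k; split=> [|c u v hu hv] /=; first by rewrite linear0.
  by rewrite linearP; apply: pl.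
have gsY y : y \in map g s -> Y y by move=> /mapP[x /sX/XY xY ->].
by have := prods_prod gsY; rewrite big_map size_map -rmorph_prod.
Qed.


Lemma einf_min (P : set nat) n : P n -> (forall m, P m -> (n <= m)%N) ->
  einf P = enat n.
Proof.
move=> Pn nP; rewrite /einf.
have le : lbound (enat @` P) (enat n).
  by move=> _ [m /nP h <-]; rewrite lee_fin lez_nat.
have he : (infimums (enat @` P)) (enat n).
  by split=> // y; apply; exists n.
rewrite /infimum.
case: ifPn => [/eqP e|ne]; first by have : set0 (enat n) by rewrite -e; exists n.
case: xgetP => [y _ hy|/(_ (enat n))]; last by [].
exact: is_subset1_infimums hy he.
Qed.

(** * A secondary operation *)

Section Cohomology.
Variable A : cdga.
Local Notation d := (diff A).
Implicit Types a b x y z : A.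

Definition exact z : Prop := exists w, d w = z.

Lemma exactE z : coboundary setT z <-> exact z.
Proof. by split=> [[w [_ h]]|[w h]]; exists w. Qed.

Lemma lsub_exact : lsub exact.
Proof.
split=> [|c _ _ [u <-] [v <-]]; first by exists 0; rewrite linear0.
by exists (c *: u + v); rewrite linearP.
Qed.

Lemma exact_sub a b : exact a -> exact (a - b) -> exact b.
Proof.
move=> ha hb; have := lsubB lsub_exact ha hb.
by rewrite opprB addrC subrK.
Qed.

Lemma d_homog i a : homog i a -> homog i.+1 (d a).
Proof. exact/der_homog/diff_der. Qed.

Lemma d_comp i a : d (comp A i a) = comp A i.+1 (d a).
Proof. exact/der_comp/diff_der. Qed.

Lemma d_oddM i a b : homog i a -> odd i -> d (a * b) = d a * b - a * d b.
Proof. exact/der_oddM/diff_der. Qed.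

Lemma d_evenM i a b : homog i a -> ~~ odd i -> d (a * b) = d a * b + a * d b.
Proof. exact/der_evenM/diff_der. Qed.

Lemma exact_homog i z : homog i.+1 z -> exact z ->
  exists2 w, homog i w & d w = z.
Proof.
move=> hz [w dw]; exists (comp A i w); first exact: homog_comp.
by rewrite d_comp dw.
Qed.
End Cohomology.

Section QuasiIso.
Variables (A B : cdga) (f : dghom A B).
Hypothesis hf : quasi_iso f.

Lemma dgexact z : exact z -> exact (f z).
Proof. by case=> w <-; exists (f w); rewrite dghom_diff. Qed.

Lemma quasi_inj z : diff A z = 0 -> exact (f z) -> exact z.
Proof. by move=> dz /exactE e; apply/exactE/(hf.1 z). Qed.

Lemma quasi_surj i z' : homog i.+1 z' -> diff B z' = 0 ->
  exists z w, [/\ homog i.+1 z, diff A z = 0, homog i w & f z = z' + diff B w].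
Proof.
move=> hz dz; have [z [[_ dz0] /exactE[w dw]]] := hf.2 z' (conj I dz).
exists (comp A i.+1 z), (- comp B i w); split.
- exact: homog_comp.
- by rewrite d_comp dz0 linear0.
- exact/homogN/homog_comp.
by rewrite linearN d_comp dw linearB ghom_comp opprB hz addrC subrK.
Qed.
End QuasiIso.

(** * The class of x y a and its invariance *)

Section Massey.
Variable p : nat.
Hypothesis p_even : ~~ odd p.

(* The class of the cocycle x y a = (d a) a depends only on the classes of x
   and y and on a up to a coboundary, hence its non-vanishing is inherited along
   zigzags; it vanishes as soon as threefold products do. *)
Definition massey (A : cdga) : Prop :=
  exists x y a : A,
    [/\ homog p.+1 x, homog p.+1 y, homog (p + p).+1 a &
        [/\ diff A x = 0, diff A y = 0, diff A a = x * y & ~ exact (x * y * a)]].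

Section Indeterminacy.
Variables (A : cdga) (x y a : A).
Hypothesis hx : homog p.+1 x.
Hypothesis hy : homog p.+1 y.
Hypothesis ha : homog (p + p).+1 a.
Hypothesis dx : diff A x = 0.
Hypothesis dy : diff A y = 0.
Hypothesis da : diff A a = x * y.
Let podd : odd p.+1. Proof. exact: p_even. Qed.

Lemma massey_cocycle : diff A (x * y * a) = 0.
Proof.
have hxy := homogM hx hy; rewrite (d_evenM _ hxy); last by rewrite oddD /= addbb.
rewrite (d_oddM _ hx podd) dx dy mul0r mulr0 subrr mul0r add0r da.
rewrite -mulrA [y * _]mulrA (homog_oddC hy hx podd podd) mulNr mulrN.
by rewrite -mulrA mulrA (homog_sq0 hx podd) mul0r oppr0.
Qed.

Lemma massey_l u : homog p u ->
  diff A (a + u * y) = (x + diff A u) * y /\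
  exact ((x + diff A u) * y * (a + u * y) - x * y * a).
Proof.
move=> hu; have yy : y * y = 0 by apply: homog_sq0 hy podd.
have uy z : u * z = z * u.
  have [n ->] := comp_sum z; rewrite mulr_sumr mulr_suml; apply: eq_bigr => i _.
  exact: (homog_evenC hu (homog_comp i z) p_even).
split; first by rewrite linearD /= da (d_evenM _ hu p_even) dy mulr0 addr0 mulrDl.
exists (u * (y * a)); rewrite (d_evenM _ hu p_even) (d_oddM _ hy podd).
have yxy : y * (x * y) = 0.
  by rewrite mulrA (homog_oddC hy hx podd podd) mulNr -mulrA yy mulr0 oppr0.
rewrite dy da mul0r yxy subrr mulr0 addr0.
have yuy : y * (u * y) = 0 by rewrite (uy y) mulrA yy mul0r.
rewrite [(_ + _) * y * _]mulrDr -(mulrA _ y (u * y)) yuy mulr0 addr0.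
by rewrite mulrDl mulrDl addrAC subrr add0r mulrA.
Qed.

Lemma massey_r u : homog p u ->
  diff A (a - x * u) = x * (y + diff A u) /\
  exact (x * (y + diff A u) * (a - x * u) - x * y * a).
Proof.
move=> hu; have xx : x * x = 0 by apply: homog_sq0 hx podd.
have hv := d_homog hu.
split.
  rewrite linearB /= da (d_oddM _ hx podd) dx mul0r sub0r opprK.
  by rewrite mulrDr.
exists (- (x * (u * a))).
have xyx z : homog p.+1 z -> x * z * (x * u) = 0.
  move=> hz; rewrite -mulrA [z * _]mulrA (homog_oddC hz hx podd podd).
  by rewrite mulNr mulrN -mulrA mulrA xx mul0r oppr0.
rewrite linearN /= (d_oddM _ hx podd) dx mul0r sub0r opprK.
rewrite (d_evenM _ hu p_even) da mulrDr.
have -> : x * (u * (x * y)) = 0.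
  by rewrite [u * _]mulrA (homog_evenC hu hx p_even) !mulrA xx !mul0r.
have -> : x * (y + diff A u) * (a - x * u) = x * y * a + x * diff A u * a.
  by rewrite mulrBr (xyx _ (homogD hy hv)) subr0 mulrDr mulrDl.
rewrite addr0.
by rewrite addrAC subrr add0r mulrA.
Qed.

Lemma massey_d u : homog (p + p) u ->
  exact (x * y * (a + diff A u) - x * y * a).
Proof.
move=> hu; exists (x * y * u).
have hxy := homogM hx hy; rewrite (d_evenM _ hxy); last first.
  by rewrite oddD /= addbb.
rewrite (d_oddM _ hx podd) dx dy mul0r mulr0 subrr mul0r add0r.
by rewrite mulrDr addrAC subrr add0r.
Qed.
End Indeterminacy.

Lemma massey_fwd (A B : cdga) (f : dghom A B) :
  quasi_iso f -> massey A -> massey B.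
Proof.
move=> hf [x [y [a [hx hy ha [dx dy da ne]]]]].
exists (f x), (f y), (f a); split; try exact: ghom_homog.
split; rewrite -?dghom_diff ?dx ?dy ?linear0 // ?da ?rmorphM //.
rewrite -!rmorphM => e; apply/ne/(quasi_inj hf) => //.
exact: (massey_cocycle hx hy dx dy da).
Qed.

(** The lifts [x'] and [y'] hit [x] and [y] only up to boundaries, so [x], [y] and [a] are first
    corrected in A. A primitive [b0] of [x' y'] then maps to the corrected [a2] up to a cocycle [z];
    lifting [z] and subtracting it leaves only a boundary. The three indeterminacy lemmas compare
    the resulting class with that of x y a. *)
Lemma massey_bwd (A B : cdga) (f : dghom B A) :
  quasi_iso f -> massey A -> massey B.
Proof.
move=> hf [x [y [a [hx hy ha [dx dy da ne]]]]].
have podd : odd p.+1 by exact: p_even.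
have [x' [u [hx' dx' hu fx]]] := quasi_surj hf hx dx.
have [y' [v [hy' dy' hv fy]]] := quasi_surj hf hy dy.
have [d1 e1] := massey_l hx hy dy da hu.
set x1 := x + _ in fx d1 e1; set a1 := a + _ in d1 e1.
have hx1 : homog p.+1 x1 by apply/homogD/d_homog.
have ha1 : homog (p + p).+1 a1.
  by apply: homogD => //; apply: (homogM_eq hu hy); rewrite addnS.
have dx1 : diff A x1 = 0 by rewrite linearD /= dx diff_diff addr0.
have [d2 e2] := massey_r hx1 hy dx1 d1 hv.
set y1 := y + _ in fy d2 e2; set a2 := a1 - _ in d2 e2.
have ha2 : homog (p + p).+1 a2.
  by apply: homogB => //; apply: (homogM_eq hx1 hv).
have [b0 hb0 db0] : exists2 b0, homog (p + p).+1 b0 & diff B b0 = x' * y'.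
  apply: exact_homog; first by apply: (homogM_eq hx' hy'); rewrite addnS.
  apply: (quasi_inj hf); first by rewrite (d_oddM _ hx' podd) dx' dy' mul0r mulr0 subrr.
  by rewrite rmorphM /= fx fy -d2; exists a2.
pose z := f b0 - a2.
have hz : homog (p + p).+1 z by apply: homogB => //; apply: ghom_homog.
have dz : diff A z = 0.
  by rewrite linearB /= -dghom_diff db0 rmorphM /= fx fy d2 subrr.
have [z' [w [hz' dz' hw fz]]] := quasi_surj hf hz dz.
exists x', y', (b0 - z'); split=> //; first exact: homogB.
split=> //; first by rewrite linearB /= db0 dz' subr0.
move=> /(dgexact f); rewrite !rmorphM /= linearB /= fx fy fz /z => e.
have hy1 : homog p.+1 y1 by apply/homogD/d_homog.
have dy1 : diff A y1 = 0 by rewrite linearD /= dy diff_diff addr0.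
have e3 := massey_d a2 hx1 hy1 dx1 dy1 (homogN hw).
apply: ne; move: e; rewrite opprD addrA opprB addrCA subrr addr0 -linearN /= => e.
exact: (exact_sub (exact_sub (exact_sub e e3) e2) e1).
Qed.

Lemma massey_zigzag (A B : cdga) : zigzag A B -> massey A -> massey B.
Proof.
move=> h; elim: B / h => // [B C f _ IH hf /IH|B C f _ IH hf /IH].
  exact: (massey_fwd hf).
exact: (massey_bwd hf).
Qed.

Lemma massey_nil (A : cdga) n : massey A ->
  prods (@pos A) n.+1 = [set 0] -> (3 <= n)%N.
Proof.
move=> [x [y [a [hx hy ha [_ _ _ ne]]]]] h; rewrite leqNgt; apply/negP => n3.
apply: ne; have : prods (@pos A) n.+1 (x * y * a).
  apply: (@prods_pos_mono A n 2) => //; rewrite -mulrA.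
  have pp i z : homog i.+1 z -> @pos A z by move/homog_pos; apply.
  apply: prods_cons (pp _ _ hx) _; apply: prods_cons (pp _ _ hy) _.
  rewrite -[a]mulr1; apply: prods_cons (pp _ _ ha) _.
  by have := @prods_prod A (@pos A) [::]; rewrite big_nil; apply.
by rewrite h => ->; exists 0; rewrite linear0.
Qed.
End Massey.

(** * The word-length filtration *)

Section WordLength.
Variable S : shape.
Local Notation A := (galg S).
Local Notation ee := (@ee S).

(** The span of the words with at least k letters. The words need be neither sorted nor admissible,
    so that concatenation shows at once that the filtration is multiplicative. *)
Definition sp (k : nat) (a : A) : Prop := forall Y : A -> Prop, lsub Y ->
  (forall w, (k <= size w)%N -> Y (ee w)) -> Y a.

Lemma lsub_sp k : lsub (sp k).
Proof.
split=> [Y [Y0 _] _ //|c u v hu hv Y hY hw].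
by case: (hY) => _; apply; [apply: hu|apply: hv].
Qed.

Lemma sp_ee k w : (k <= size w)%N -> sp k (ee w).
Proof. by move=> kw Y _; apply. Qed.

Lemma sp_mul i j (a b : A) : sp i a -> sp j b -> sp (i + j) (a * b).
Proof.
move=> ha hb; have [s0 sl] := lsub_sp (i + j).
apply: (ha (fun a => sp (i + j) (a * b))) => [|w iw].
  split=> [|c u v hu hv]; first by rewrite mul0r.
  by rewrite mulrDl -scalerAl; apply: sl.
apply: (hb (fun b => sp (i + j) (ee w * b))) => [|v jv].
  split=> [|c u x hu hv]; first by rewrite mulr0.
  by rewrite mulrDr -scalerAr; apply: sl.
by rewrite -ee_cat; apply: sp_ee; rewrite size_cat leq_add.
Qed.

Hypothesis deg_pos : forall i, adm S [:: i] -> (0 < deg S i)%N.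

Lemma degw_pos w : adm S w -> (0 < size w)%N -> (0 < degw S w)%N.
Proof.
case: w => // i w aw _; rewrite degw_cons ltn_addr //.
exact/deg_pos/(@adm_catl S [:: i] w).
Qed.

Lemma sp_pos a : @pos A a -> sp 1 a.
Proof.
move=> pa; suff : sp 1 (a - comp A 0 a) by rewrite pa subr0.
have [s0 sl] := lsub_sp 1; elim/gee_ind: {pa} a => [|c u v hu hv|w aw _].
- by rewrite linear0 subr0.
- by rewrite linearP opprD addrACA -scalerBr; apply: sl.
rewrite /= acomp_ee; case: (posnP (size w)) => [/size0nil ->|sw].
  by rewrite degw_nil subrr.
by rewrite gtn_eqF ?degw_pos // subr0; apply: sp_ee.
Qed.

Lemma sp_prods k a : prods (@pos A) k a -> sp k a.
Proof.
move: a; apply: prods_ind; first exact: lsub_sp.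
move=> s; elim: s k => [|x s IH] k <- sP.
  by rewrite big_nil -(ee_nil S); apply: sp_ee.
rewrite big_cons -[size _]/(1 + size s)%N; apply: sp_mul.
  by apply: sp_pos; apply: sP; apply: mem_head.
by apply: IH => // y ys; apply: sP; apply: mem_behead.
Qed.

Lemma sp_homog k j (a : A) (Y : A -> Prop) : lsub Y -> sp k a -> homog j a ->
  (forall w, adm S w -> sorted leq w -> (k <= size w)%N -> degw S w = j ->
     Y (ee w)) -> Y a.
Proof.
move=> hY ha <- hw.
apply: (ha (fun a => Y (comp A j a))) => [|w kw].
  split=> [|c u v hu hv]; first by rewrite linear0; case: hY.
  by rewrite linearP; case: hY => _; apply.
rewrite /= acomp_ee; case: eqP => [e|_]; last by case: hY.
case: (boolP (adm S w)) => aw; last by rewrite ee_nadm //; case: hY.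
rewrite ee_sortE; apply: lsubZ => //; apply: hw.
- by rewrite (@adm_perm S _ w) // perm_sort.
- exact: (sort_sorted leq_total).
- by rewrite size_sort.
- by rewrite degw_sort.
Qed.

Definition cf (w : seq nat) : {linear alg S -> rat^o} :=
  @lina S rat^o (fun v => (v == w)%:R).

Lemma cf_ee w v : adm S w -> sorted leq w ->
  cf w (ee v) = if sort leq v == w then (-1) ^+ inv (par S) v else 0.
Proof.
move=> aw sw; case: (boolP (adm S v)) => av; last first.
  rewrite ee_nadm // linear0; case: eqP => // e; case/negP: av.
  by rewrite -(@adm_perm S (sort leq v)) ?perm_sort // e.
rewrite ee_sortE linearZ /= lina_ee ?(sort_sorted leq_total) //; last first.
  by rewrite (@adm_perm S _ v) // perm_sort.
by case: eqP => _; [apply: mulr1|apply: mulr0].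
Qed.

(** Words of three or more letters have boundaries of length at least 4, which vanish in D.
    Questions about boundaries in D thus reduce to words of at most two letters. *)
Lemma sp_der (d : {linear A -> A}) : derivation d ->
  (forall i, sp 2 (d (ee [:: i]))) -> forall w, sp (size w).+1 (d (ee w)).
Proof.
move=> hd hi; elim=> [|i w IH].
  by rewrite ee_nil (der1 hd); case: (lsub_sp 1).
rewrite ee_cons (derM hd _ (homog_letter S i)).
apply: (lsubD (lsub_sp _)).
  by have := sp_mul (hi i) (sp_ee (leqnn (size w))).
apply: (lsubZ _ (lsub_sp _)).
by apply: (@sp_mul 1 (size w).+1) => //; exact: sp_ee.
Qed.
End WordLength.

(** * Words described by the multiplicities of their letters *)

Section Counting.
Implicit Types w : seq nat.

Lemma degw_count (S : shape) n w : all (fun i => i < n)%N w ->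
  degw S w = (\sum_(i < n) count_mem (i : nat) w * deg S i)%N.
Proof.
elim: w => [_|i w IH /= /andP[ni /IH e]].
  by rewrite degw_nil big1.
rewrite degw_cons e; under eq_bigr => j _ do rewrite mulnDl.
rewrite big_split /=; congr (_ + _)%N.
rewrite (bigD1 (Ordinal ni)) //= eqxx mul1n big1 ?addn0 // => j nj.
by rewrite (negPf (_ : i != j)) //; apply: contraNneq nj => ij; apply/eqP/val_inj.
Qed.

Lemma size_count n w : all (fun i => i < n)%N w ->
  size w = (\sum_(i < n) count_mem (i : nat) w)%N.
Proof.
elim: w => [_|i w IH /= /andP[ni /IH ->]]; first by rewrite big1.
rewrite big_split /= -add1n; congr (_ + _)%N.
rewrite (bigD1 (Ordinal ni)) //= eqxx big1 ?addn0 // => j nj.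
by rewrite (negPf (_ : i != j)) //; apply: contraNneq nj => ij; apply/eqP/val_inj.
Qed.

Lemma perm_count n w w' : all (fun i => i < n)%N w -> all (fun i => i < n)%N w' ->
  (forall i, (i < n)%N -> count_mem i w = count_mem i w') -> perm_eq w w'.
Proof.
move=> aw aw' h; apply/allP => i; rewrite mem_cat => iw.
by apply/eqP/h; case/orP: iw => [/(allP aw)|/(allP aw')].
Qed.
End Counting.

Section IdComp.
Lemma gid_comp (A : gca) i (a : A) : idfun (comp A i a) = comp A i (idfun a).
Proof. by []. Qed.
Definition gid (A : gca) : ghom A A := Ghom (ghom_fun := idfun) (@gid_comp A).

Lemma gcomp_comp (A B C : gca) (g : ghom B C) (f : ghom A B) i a :
  (g \o f) (comp A i a) = comp C i ((g \o f) a).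
Proof. by rewrite /= !ghom_comp. Qed.
Definition gcomp (A B C : gca) (g : ghom B C) (f : ghom A B) : ghom A C :=
  Ghom (ghom_fun := g \o f) (gcomp_comp g f).
End IdComp.

(** * Abstractly free algebras as word algebras *)

Section FreeGens.
Variables (ds : seq nat) (pars : seq bool).
Hypothesis parsE : forall i, nth false pars i = odd (nth 0%N ds i).
Let S := freeS (fun i => i < size ds)%N parsE.

(** Both algebras are universal for the same list of degrees, so the comparison maps are mutually
    inverse. This gives an algebra known only by its universal property a monomial basis. *)
Lemma free_gens_iso (A : gca) (gs : seq A) : free_gens ds gs ->
  exists (u : ghom A (galg S)) (v : ghom (galg S) A),
    [/\ forall a, v (u a) = a, forall b, u (v b) = b
      & forall i, (i < size ds)%N ->
          u (nth 0 gs i) = ee S [:: i] /\ v (ee S [:: i]) = nth 0 gs i].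
Proof.
case=> [[sg hg] hu].
pose bs : seq (galg S) := [seq ee S [:: i] | i <- iota 0 (size ds)].
have nb i : (i < size ds)%N -> nth 0 bs i = ee S [:: i].
  by move=> hi; rewrite (nth_map 0%N) ?size_iota // nth_iota.
have [|u [ug _]] := hu (galg S) bs.
  split=> [|i hi]; first by rewrite size_map size_iota.
  by rewrite nb //; apply: homog_letter.
(* Beyond the end of the list the default value of [nth] is 0, in accordance with the letters that
   vanish in [S]. *)
have [|i|v hv] := @free_ghom _ _ (fun i => i < size ds)%N parsE A (nth 0 gs).
- move=> i; case: (ltnP i (size ds)) => [/hg //|hi].
  have -> : nth 0 gs i = 0 by apply: nth_default; rewrite sg.
  exact: homog0.
- by rewrite -leqNgt -sg => hi; apply: nth_default.
have ui i : (i < size ds)%N -> u (nth 0 gs i) = ee S [:: i].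
  by move=> hi; rewrite -nb // -ug (nth_map 0) // sg.
exists u, v; split=> [a|b|i hi]; last by rewrite ui ?hv.
- have [w [_ wu]] := hu A gs (conj sg hg).
  have -> : v (u a) = gcomp v u a by [].
  rewrite (wu (gcomp v u)); last first.
    apply: (@eq_from_nth _ 0) => [|i]; rewrite size_map // => hi.
    by rewrite (nth_map 0) //= ui -?sg // hv.
  by rewrite -(wu (gid A)) // map_id.
have -> : u (v b) = gcomp u v b by [].
rewrite (@ghom_letters S _ (gcomp u v) (gid _)) // => i /andP[_ /=].
by rewrite andbT hv => hi; rewrite ui.
Qed.

Lemma free_gens_letters :
  free_gens ds ([seq ee S [:: i] | i <- iota 0 (size ds)] : seq (galg S)).
Proof.
have nb i : (i < size ds)%N ->
    nth 0 ([seq ee S [:: i] | i <- iota 0 (size ds)] : seq (galg S)) i = ee S [:: i].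
  by move=> hi; rewrite (nth_map 0%N) ?size_iota // nth_iota.
split=> [|B bs [sb hb]].
  split=> [|i hi]; first by rewrite size_map size_iota.
  by rewrite nb //; apply: homog_letter.
have [i|i|g hg] := @free_ghom _ _ (fun i => i < size ds)%N parsE B (nth 0 bs).
- case: (ltnP i (size ds)) => [/hb //|hi].
  have -> : nth 0 bs i = 0 by apply: nth_default; rewrite sb.
  exact: homog0.
- by rewrite -leqNgt -sb => hi; apply: nth_default.
exists g; split=> [|g' e].
  apply: (@eq_from_nth _ 0) => [|i]; rewrite !size_map size_iota // => hi.
  by rewrite (nth_map 0) ?size_map ?size_iota // nb ?hg.
apply: ghom_letters => i /andP[_ /=]; rewrite andbT => hi.
by rewrite hg -e (nth_map 0) ?size_map ?size_iota // nb.
Qed.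
End FreeGens.

(** * The algebras F_q, D_q and P_q *)

Section Generators.
Variable q : nat.
Hypothesis q_odd : odd q.
Hypothesis q_ge3 : (3 <= q)%N.

Definition degsF := [:: q; q; q; 2 * q - 1; 4 * q - 2; 5 * q - 3]%N.
Definition degsP := [:: q; q; q; 2 * q - 1; 4 * q - 2]%N.
Definition parsF := [:: true; true; true; true; false; false].
Definition parsP := [:: true; true; true; true; false].

Lemma parsFE i : nth false parsF i = odd (nth 0%N degsF i).
Proof.
case: i => [|[|[|[|[|[|i]]]]]] //=; rewrite ?nth_nil // oddB ?oddM ?q_odd //; lia.
Qed.

Lemma parsPE i : nth false parsP i = odd (nth 0%N degsP i).
Proof.
case: i => [|[|[|[|[|i]]]]] //=; rewrite ?nth_nil // oddB ?oddM ?q_odd //; lia.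
Qed.

Definition SF := freeS (fun i => i < 6)%N parsFE.
Definition SP := freeS (fun i => i < 5)%N parsPE.
Local Notation AF := (galg SF).
Local Notation AP := (galg SP).
Local Notation eF := (@ee SF).
Local Notation eP := (@ee SP).

(* The letters 0, ..., 5 stand for s, x, y, a, t, r. *)
Definition dletter (i : nat) : option (seq nat) :=
  nth None [:: None; None; None; Some [:: 1; 2]; Some [:: 3; 2; 0];
               Some [:: 1; 4]]%N i.

Lemma dletter_homog i w : dletter i = Some w -> degw SF w = (deg SF i).+1.
Proof.
case: i => [|[|[|[|[|[|i]]]]]] //=; rewrite /dletter /= ?nth_nil //.
all: by case=> <-; rewrite !degw_cons degw_nil /=; lia.
Qed.

Lemma dF_exists : exists d : {linear AF -> AF}, derivation d /\
  forall i, d (eF [:: i]) = oapp eF 0 (dletter i).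
Proof.
apply: free_der => i.
  case e : (dletter i) => [w|]; last exact: homog0.
  by rewrite -(dletter_homog e); apply: homog_ee.
by case: i => [|[|[|[|[|[|i]]]]]] //= _; rewrite /dletter /= nth_nil.
Qed.

Lemma dP_exists : exists d : {linear AP -> AP}, derivation d /\
  forall i, d (eP [:: i]) = if (i < 5)%N then oapp eP 0 (dletter i) else 0.
Proof.
apply: free_der => i; last by case: ltnP.
case: i => [|[|[|[|[|i]]]]] //=; try exact: homog0.
- have -> : (2 * q - 1).+1 = degw SP [:: 1; 2]%N.
    by rewrite !degw_cons degw_nil /=; lia.
  exact: homog_ee.
have -> : (4 * q - 2).+1 = degw SP [:: 3; 2; 0]%N.
  by rewrite !degw_cons degw_nil /=; lia.
exact: homog_ee.
Qed.

(** * Functionals that detect cohomology classes of D_q *)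

Section Functionals.
Variable dF : {linear AF -> AF}.
Hypothesis hdF : derivation dF.
Hypothesis dFl : forall i, dF (eF [:: i]) = oapp eF 0 (dletter i).

Lemma degSF_pos i : adm SF [:: i] -> (0 < deg SF i)%N.
Proof.
rewrite /= => /andP[_]; rewrite andbT.
by case: i => [|[|[|[|[|[|i]]]]]] //= _; lia.
Qed.

Lemma eF_prods4 w : (4 <= size w)%N -> prods (@pos AF) 4 (eF w).
Proof.
move=> lw; rewrite ee_evalw /evalw -(big_map (fun i => eF [:: i]) xpredT id).
apply: (@prods_pos_mono AF 3 (size w).-1); first by case: w lw.
have -> : (size w).-1.+1 = size [seq eF [:: i] | i <- w].
  by rewrite size_map; case: w lw.
apply: prods_prod => _ /mapP[i _ ->].
case: (boolP (adm SF [:: i])) => ai.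
  by apply: homog_pos (homog_letter SF i) _; apply: degSF_pos.
by rewrite ee_nadm //; apply: linear0.
Qed.

(* A functional on F which descends to D and vanishes on coboundaries. *)
Definition detects (L : {linear AF -> rat^o}) : Prop :=
  [/\ forall w, (4 <= size w)%N -> L (eF w) = 0,
      forall w, (7 * q - 3 < degw SF w)%N -> L (eF w) = 0
    & forall a, L (dF a) = 0].

Lemma detects0 L a : detects L ->
  sumset (prods (@pos AF) 4) (@deg_gt AF (7 * q - 3)) a -> L a = 0.
Proof.
move=> [L4 Lq _] [b [c [hb hc ->]]]; rewrite linearD /=.
have -> : L b = 0.
  apply: (sp_prods degSF_pos hb (Y := fun b => L b = 0)) => //.
  by split=> [|k u v hu hv]; rewrite ?linear0 // linearP /= hu hv addr0 scaler0.
(* Subtracting [T c] removes the components of degree at most 7q - 3, of which the present [c] has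
   none. That [L] kills [c - T c] is then checked on words, for arbitrary [c]. *)
rewrite add0r; pose T (c : AF) := \sum_(i < (7 * q - 3).+1) comp AF i c.
have -> : c = c - T c.
  by rewrite /T big1 ?subr0 // => i _; apply: hc; rewrite -ltnS.
elim/gee_ind: {hc} c => [|k u v hu hv|w _ _].
- by rewrite /T big1 ?subr0 ?linear0 // => i _; rewrite linear0.
- have -> : T (k *: u + v) = k *: T u + T v.
    by rewrite /T scaler_sumr -big_split; apply: eq_bigr => i _; apply: linearP.
  by rewrite opprD addrACA -scalerBr linearP /= hu hv addr0 scaler0.
rewrite linearB /=; have [le|gt] := leqP (degw SF w) (7 * q - 3).
  rewrite /T (bigD1 (Ordinal (le : (_ < (7 * q - 3).+1)%N))) //=.
  rewrite acomp_ee eqxx big1 ?addr0 ?subrr // => i ni.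
  rewrite acomp_ee; case: eqP => // e; case/eqP: ni.
  by apply: val_inj; rewrite /= e.
rewrite Lq // /T big1 ?linear0 ?subr0 // => i _.
by rewrite /= acomp_ee gtn_eqF // (leq_ltn_trans _ gt) // -ltnS.
Qed.

Definition cfc (w v : seq nat) : rat :=
  if sort leq v == w then (-1) ^+ inv (nth false parsF) v else 0.

(** The Leibniz rule on words of one and two letters, as a closed boolean. Since q is odd, the
    parities [parsF] do not depend on q, so one computation settles all q at once. *)
Definition checkL (f : seq nat -> rat) : bool :=
  all (fun i => oapp f 0 (dletter i) == 0) (iota 0 6) &&
  all (fun i => all (fun j =>
    oapp (fun w => f (w ++ [:: j])) 0 (dletter i) +
    (-1) ^+ nth false parsF i * oapp (fun w => f (i :: w)) 0 (dletter j) == 0)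
    (iota 0 6)) (iota 0 6).

Lemma checkL_xya : checkL (cfc [:: 1; 2; 3]%N). Proof. by vm_compute. Qed.
Lemma checkL_syt : checkL (cfc [:: 0; 2; 4]%N). Proof. by vm_compute. Qed.
Lemma checkL_yat : checkL (cfc [:: 2; 3; 4]%N). Proof. by vm_compute. Qed.
Lemma checkL_xat :
  checkL (fun w => cfc [:: 1; 3; 4]%N w - cfc [:: 1; 2; 5]%N w).
Proof. by vm_compute. Qed.
Lemma detects_check (L : {linear AF -> rat^o}) (f : seq nat -> rat) :
  (forall w, L (eF w) = f w) -> (forall w, (4 <= size w)%N -> f w = 0) ->
  (forall w, (7 * q - 3 < degw SF w)%N -> f w = 0) -> checkL f -> detects L.
Proof.
move=> Lf f4 fq /andP[/allP c1 /allP c2]; split=> [w|w|a].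
- by rewrite Lf => /f4.
- by rewrite Lf => /fq.
elim/gee_ind: a => [|c u v hu hv|w aw _].
- by rewrite !linear0.
- by rewrite !linearP /= hu hv addr0 scaler0.
have lt6 i : i \in w -> i \in iota 0 6.
  by case/andP: aw => _ /allP h /h; rewrite mem_iota.
have Lo i o : oapp (fun w => f (w ++ i)) 0 o = L (oapp eF 0 o * eF i).
  by case: o => [v|] /=; rewrite ?mul0r ?linear0 // -ee_cat Lf.
have [s3|] := leqP 3 (size w).
  have h : sp (size w).+1 (dF (eF w)).
    apply: sp_der => // i; rewrite dFl.
    by case: i => [|[|[|[|[|[|i]]]]]]; rewrite /dletter /= ?nth_nil;
      (exact: sp_ee || case: (lsub_sp SF 2)).
  apply: (h (fun a => L a = 0)) => [|v lv].
    by split=> [|k u v hu hv]; rewrite ?linear0 // linearP /= hu hv addr0 scaler0.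
  by rewrite Lf f4 // (leq_trans _ lv).
case: w lt6 {aw} => [|i [|j [|]]] // lt6 _.
- by rewrite ee_nil (der1 hdF) linear0.
- have /c1/eqP := lt6 i (mem_head _ _); rewrite dFl => <-.
  by case: (dletter i) => [v|]; rewrite /= ?linear0 // Lf.
have /c2/allP/(_ j (lt6 j _))/eqP := lt6 i (mem_head _ _).
rewrite !inE eqxx orbT => /(_ isT) <-.
rewrite ee_cons (derM hdF _ (homog_letter SF i)) linearD linearZ /=.
rewrite !dFl Lo; congr (_ + _ * _).
  by rewrite -signr_odd -parsFE.
by case: (dletter j) => [v|] /=; rewrite ?mulr0 ?linear0 // -ee_cat Lf.
Qed.

Lemma cfcE w0 w : adm SF w0 -> sorted leq w0 -> cf SF w0 (eF w) = cfc w0 w.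
Proof. by move=> aw sw; rewrite cf_ee. Qed.

Lemma cfc_size w0 w : size w0 = 3 -> (4 <= size w)%N -> cfc w0 w = 0.
Proof.
rewrite /cfc => s3 s4; case: eqP => // e.
by have := congr1 size e; rewrite size_sort s3 => e3; move: s4; rewrite e3.
Qed.

Lemma cfc_deg w0 w n : (degw SF w0 <= n)%N -> (n < degw SF w)%N -> cfc w0 w = 0.
Proof.
rewrite /cfc => h1 h2; case: eqP => // e.
by move: h2; rewrite -(degw_sort SF) e ltnNge h1.
Qed.

Lemma detects_cf w0 : adm SF w0 -> sorted leq w0 -> size w0 = 3 ->
  (degw SF w0 <= 7 * q - 3)%N -> checkL (cfc w0) -> detects (cf SF w0).
Proof.
move=> aw sw s3 dw; apply: detects_check => w; first exact: cfcE.
  exact: cfc_size.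
exact: cfc_deg.
Qed.

(* d (a r) = x y r + x a t, on which the two coefficients cancel. *)
Definition Lxta : {linear AF -> rat^o} :=
  cf SF [:: 1; 3; 4]%N \- cf SF [:: 1; 2; 5]%N.

Lemma LxtaE w : Lxta (eF w) = cfc [:: 1; 3; 4]%N w - cfc [:: 1; 2; 5]%N w.
Proof. by rewrite /= !cfcE. Qed.

Lemma detects_xya : detects (cf SF [:: 1; 2; 3]%N).
Proof.
by apply: detects_cf checkL_xya; rewrite // !degw_cons degw_nil /=; lia.
Qed.

Lemma detects_syt : detects (cf SF [:: 0; 2; 4]%N).
Proof.
by apply: detects_cf checkL_syt; rewrite // !degw_cons degw_nil /=; lia.
Qed.

Lemma detects_yat : detects (cf SF [:: 2; 3; 4]%N).
Proof.
by apply: detects_cf checkL_yat; rewrite // !degw_cons degw_nil /=; lia.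
Qed.

Lemma detects_xat : detects Lxta.
Proof.
apply: detects_check checkL_xat => w; first exact: LxtaE.
  by move=> h; rewrite !cfc_size ?subr0.
by move=> h; rewrite !(cfc_deg _ h) ?subr0 // !degw_cons degw_nil /=; lia.
Qed.
End Functionals.
End Generators.

(** * D_q and P_q in terms of words *)

Section Models.
Variable q : nat.
Hypothesis q_odd : odd q.
Hypothesis q_ge3 : (3 <= q)%N.
Local Notation SF := (SF q_odd q_ge3).
Local Notation SP := (SP q_odd q_ge3).
Local Notation AF := (galg SF).
Local Notation AP := (galg SP).
Local Notation eF := (@ee SF).
Local Notation eP := (@ee SP).

Lemma sumset_ghom (A B : gca) (g : ghom A B) k n a :
  sumset (prods (@pos A) k) (@deg_gt A n) a ->
  sumset (prods (@pos B) k) (@deg_gt B n) (g a).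
Proof.
move=> [b [c [hb hc ->]]]; exists (g b), (g c); split; last by rewrite linearD.
  by apply: prods_ghom hb => x px; rewrite /pos /= -ghom_comp px linear0.
by move=> i hi; rewrite -ghom_comp hc // linear0.
Qed.

Lemma Dq_model (D : cdga) (gs : seq D) : is_Dq q gs ->
  exists (dF : {linear AF -> AF}) (theta : ghom AF D),
    [/\ derivation dF, forall i, dF (eF [:: i]) = oapp eF 0 (dletter i),
        forall i, (i < 5)%N -> theta (eF [:: i]) = nth 0 gs i
      & [/\ forall b, exists a, theta a = b,
            forall a, theta (dF a) = diff D (theta a)
          & forall a, theta a = 0 <->
              sumset (prods (@pos AF) 4) (@deg_gt AF (7 * q - 3)) a]].
Proof.
move=> [F [delta [s [x [y [a [t [r [p]]]]]]]]].
move=> [hF hdelta [[ds dx dy] [da dt dr]] [psurj pker pd ->]].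
have [u [v [vu uv huv]]] := free_gens_iso (parsFE q_odd q_ge3) hF.
have [dF [hdF dFl]] := dF_exists q_odd q_ge3.
(* Knowing [v] on the six letters also transports the differential, as a derivation is determined by
   its values there. *)
have v_i i (hi : (i < 6)%N) : v (eF [:: i]) = nth 0 [:: s; x; y; a; t; r] i.
  by case: (huv i hi).
have vd b : v (dF b) = delta (v b).
  apply: der_words => // i /andP[_]; rewrite /= andbT => hi; rewrite dFl v_i //.
  case: i hi => [|[|[|[|[|[|i]]]]]] //= _; rewrite ?linear0 ?ds ?dx ?dy //.
  - by rewrite ee_cons rmorphM /= !v_i.
  - by rewrite ee_cons (ee_cons SF 2) !rmorphM /= !v_i // dt mulrA.
  - by rewrite ee_cons rmorphM /= !v_i.
exists dF, (gcomp p v); split=> // [i hi|].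
  rewrite /= v_i ?(leq_trans hi) //.
  by case: i hi => [|[|[|[|[|i]]]]].
split=> [b|b|b] /=.
- by have [f <-] := psurj b; exists (u f); rewrite vu.
- by rewrite vd pd.
split=> [/pker|] h; first by rewrite -[b]uv; apply: sumset_ghom.
by apply/pker; apply: sumset_ghom.
Qed.

Lemma Pq_model (P : cdga) (gs : seq P) : is_Pq q gs ->
  exists (dP : {linear AP -> AP}) (kappa : ghom AP P) (kinv : ghom P AP),
    [/\ derivation dP,
        forall i, dP (eP [:: i]) = if (i < 5)%N then oapp eP 0 (dletter i) else 0,
        forall i, (i < 5)%N -> kappa (eP [:: i]) = nth 0 gs i
      & [/\ forall a, kappa (kinv a) = a, forall a, kinv (kappa a) = a
          & forall a, kappa (dP a) = diff P (kappa a)]].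
Proof.
move=> [s [x [y [a [t [-> hP [ds dx dy] da dt]]]]]].
have [u [v [vu uv huv]]] := free_gens_iso (parsPE q_odd q_ge3) hP.
have [dP [hdP dPl]] := dP_exists q_odd q_ge3.
have v_i i (hi : (i < 5)%N) : v (eP [:: i]) = nth 0 [:: s; x; y; a; t] i.
  by case: (huv i hi).
exists dP, v, u; split=> //; split=> //.
move=> b; apply: der_words => // [|i /andP[_]]; first exact: diff_der.
rewrite /= andbT => hi; rewrite dPl hi v_i //.
case: i hi => [|[|[|[|[|i]]]]] //= _; rewrite ?linear0 ?ds ?dx ?dy //.
- by rewrite ee_cons rmorphM /= !v_i.
- by rewrite ee_cons (ee_cons SP 2) !rmorphM /= !v_i // dt mulrA.
Qed.
End Models.

(** * The invariants of M_q *)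

Section SubGca.
Variables (A : gca) (S : set A).
Hypothesis hS : subalgebra S.
Hypothesis gS : forall i a, S a -> S (comp A i a).

Definition subP : {pred A} := fun a => `[< S a >].

Lemma subPE a : (a \in subP) = `[< S a >]. Proof. by []. Qed.

Lemma subP_closed : subalg_closed subP.
Proof.
have [[S0 Sl] S1 SM] := hS; split.
- by rewrite subPE; apply/asboolP.
- move=> c u v; rewrite !subPE => /asboolP Su /asboolP Sv; apply/asboolP.
  exact: Sl.
- by move=> u v; rewrite !subPE => /asboolP Su /asboolP Sv; apply/asboolP/SM.
Qed.

Definition subA_of of subalgebra S : Type := {a : A | a \in subP}.
Local Notation subA := (subA_of hS).
HB.instance Definition _ := [isSub of subA for @sval A (fun a => a \in subP)].
HB.instance Definition _ := [Choice of subA by <:].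
HB.instance Definition _ :=
  GRing.SubChoice_isSubAlgebra.Build rat A subP subA
    (GRing.subalg_closed_semi subP_closed).

Lemma subA_S (a : subA) : S (val a).
Proof. by have := valP a; rewrite subPE => /asboolP. Qed.

Definition subcomp i (a : subA) : subA := insubd 0 (comp A i (val a)).

Lemma val_subcomp i a : val (subcomp i a) = comp A i (val a).
Proof.
by rewrite val_insubd subPE (introT (asboolP _) (gS i (subA_S a))).
Qed.

Lemma subcomp_linear i : linear (subcomp i).
Proof.
move=> c u v; apply: val_inj.
by rewrite val_subcomp !linearP /= !val_subcomp.
Qed.
HB.instance Definition _ i :=
  GRing.isLinear.Build rat subA subA *:%R (subcomp i) (subcomp_linear i).

Lemma subcompE i j a :
  subcomp i (subcomp j a) = if i == j then subcomp j a else 0.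
Proof.
apply: val_inj; rewrite (fun_if val) !val_subcomp compE.
by rewrite linear0.
Qed.

Lemma subcomp_sum a : exists n, a = \sum_(i < n) subcomp i a.
Proof.
have [n e] := comp_sum (val a); exists n; apply: val_inj.
rewrite linear_sum; apply: etrans e _; apply: eq_bigr => i _ /=.
by rewrite val_subcomp.
Qed.

Lemma subcomp_one : subcomp 0 1 = 1.
Proof. by apply: val_inj; rewrite val_subcomp rmorph1 comp_one. Qed.

Lemma sub_homog i a : subcomp i a = a -> comp A i (val a) = val a.
Proof. by move=> h; rewrite -val_subcomp h. Qed.

Lemma subcomp_mul i j a b : subcomp i a = a -> subcomp j b = b ->
  subcomp (i + j) (a * b) = a * b.
Proof.
move=> /sub_homog ha /sub_homog hb; apply: val_inj.
by rewrite val_subcomp rmorphM comp_mul.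
Qed.

Lemma subcomp_comm i j a b : subcomp i a = a -> subcomp j b = b ->
  a * b = (-1) ^+ (i * j) *: (b * a).
Proof.
move=> /sub_homog ha /sub_homog hb; apply: val_inj.
by rewrite linearZ !rmorphM /= (gca_comm ha hb).
Qed.

Definition subgca : gca := Gca (comp := fun i => subcomp i : {linear subA -> subA})
  subcompE subcomp_sum subcomp_one subcomp_mul subcomp_comm.

Definition sv (a : subA) : A := val a.
Lemma sv_linear : linear sv. Proof. by move=> c u v; rewrite /sv linearP. Qed.
Lemma sv_monoid : monoid_morphism sv.
Proof. by split=> [|u v]; rewrite /sv ?rmorph1 ?rmorphM. Qed.
HB.instance Definition _ := GRing.isLinear.Build rat subA A *:%R sv sv_linear.
HB.instance Definition _ := GRing.isMonoidMorphism.Build subA A sv sv_monoid.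

Definition subval : ghom subgca A :=
  @Ghom subgca A (sv : {lrmorphism subA -> A}) val_subcomp.
End SubGca.

(** * Words in a generating subspace V *)

Section Generation.
Variables (A : gca) (V : set A).
Hypothesis gV : gsubspace V.

Lemma subalg_subalgebra : subalgebra (subalg V).
Proof.
split=> [||u v hu hv X [hX VX]].
- split=> [X [[[X0 _] _ _] _] //|c u v hu hv X hX].
  by have [[[_ Xl] _ _] _] := hX; apply: Xl; [exact: (hu _ hX)|exact: (hv _ hX)].
- by move=> X [[_ X1 _] _].
by have [_ _ XM] := hX; apply: XM; [exact: (hu _ (conj hX VX))|exact: (hv _ (conj hX VX))].
Qed.

Lemma subalg_mem v : V v -> subalg V v.
Proof. by move=> Vv X [_ VX]; apply: VX. Qed.

Lemma subalg_comp i a : subalg V a -> subalg V (comp A i a).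
Proof.
have [hs s1 sM] := subalg_subalgebra; have [s0 sl] := hs.
move=> ha; move: i; apply: (ha [set a | forall i, subalg V (comp A i a)]).
split=> [|v Vv i]; last exact: (subalg_mem (gV.2 i v Vv)).
split=> [||u v hu hv i].
- split=> [i|c u v hu hv i]; first by rewrite linear0.
  by rewrite linearP; apply: sl.
- case=> [|i]; first by rewrite comp_one.
  by rewrite (homog_neq (homog1 A)).
by rewrite comp_mulE; apply: (lsub_sum _ hs) => j _; apply: sM.
Qed.

(** Universality maps A to the subalgebra generated by V, fixing V. Followed by the inclusion this
    is the identity, by uniqueness, so the inclusion is onto. *)
Lemma free_generated : free_on V -> forall a, subalg V a.
Proof.
move=> hV; pose B := subgca subalg_subalgebra subalg_comp.
pose f (a : A) : B := insubd (0 : subA_of subalg_subalgebra) a.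
have vf a : V a -> sv (f a) = a.
  by move=> Va; rewrite /sv val_insubd subPE (introT (asboolP _) (subalg_mem Va)).
have vinj : injective (@sv A (subalg V) subalg_subalgebra) by apply: val_inj.
have [[V0 Vl] Vc] := gV.
have [||g [gf _]] := hV B f.
- move=> c u v Vu Vv; apply: vinj; rewrite vf; last exact: Vl.
  by rewrite linearP /= !vf.
- move=> i v Vv hv; apply: vinj; rewrite [LHS](val_subcomp subalg_comp).
  by rewrite -/(sv _) vf.
move=> a; have [h [_ huniq]] := hV A idfun (fun _ _ _ _ _ => erefl) (fun _ _ _ => id).
have e : gcomp (subval subalg_subalgebra subalg_comp) g a = a.
  rewrite (huniq (gcomp _ g)) => [|v Vv /=]; last by rewrite gf // -/(sv _) vf.
  by rewrite -(huniq (gid A)).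
by rewrite -e /=; apply: subA_S.
Qed.

Hypothesis Vpos : forall v, V v -> pos v.
Hypothesis hfree : free_on V.

Definition letter (x : A) : Prop := V x /\ exists i, homog i x.

(** The counterpart of [sp] when no basis of V is chosen: products of arbitrary homogeneous elements
    of V play the role of words. *)
Definition wspan (k : nat) (a : A) : Prop := forall Y : A -> Prop, lsub Y ->
  (forall s : seq A, (k <= size s)%N -> (forall x, x \in s -> letter x) ->
     Y (\prod_(x <- s) x)) -> Y a.

Lemma lsub_wspan k : lsub (wspan k).
Proof.
split=> [Y [Y0 _] _ //|c u v hu hv Y hY hw].
by case: (hY) => _; apply; [apply: hu|apply: hv].
Qed.

Lemma wspan_prod k (s : seq A) : (k <= size s)%N ->
  (forall x, x \in s -> letter x) -> wspan k (\prod_(x <- s) x).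
Proof. by move=> ks sl Y _; apply. Qed.

Lemma wspan_mul i j a b : wspan i a -> wspan j b -> wspan (i + j) (a * b).
Proof.
move=> ha hb; have [s0 sl] := lsub_wspan (i + j).
apply: (ha (fun a => wspan (i + j) (a * b))) => [|s is_ ls].
  split=> [|c u v hu hv]; first by rewrite mul0r.
  by rewrite mulrDl -scalerAl; apply: sl.
apply: (hb (fun b => wspan (i + j) (_ * b))) => [|t jt lt].
  split=> [|c u x hu hv]; first by rewrite mulr0.
  by rewrite mulrDr -scalerAr; apply: sl.
rewrite -big_cat; apply: wspan_prod => [|x]; first by rewrite size_cat leq_add.
by rewrite mem_cat => /orP[/ls|/lt].
Qed.

Lemma wspanT a : wspan 0 a.
Proof.
have [s0 sl] := lsub_wspan 0; apply: (free_generated hfree).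
split=> [|v Vv].
  split=> [|| u v hu hv]; [by split|..].
    by have := @wspan_prod 0 [::] isT; rewrite big_nil; apply.
  exact: (@wspan_mul 0 0).
have [n ->] := comp_sum v; apply: (lsub_sum _ (lsub_wspan 0)) => i _.
have := @wspan_prod 0 [:: comp A i v] isT; rewrite big_seq1; apply=> x.
rewrite inE => /eqP ->; split; first exact: (gV.2 i v Vv).
by exists i; apply: homog_comp.
Qed.

Lemma wspan_pos a : pos a -> wspan 1 a.
Proof.
move=> pa; suff : wspan 1 (a - comp A 0 a) by rewrite pa subr0.
have [s0 sl] := lsub_wspan 1.
apply: (wspanT a (Y := fun a => wspan 1 (a - comp A 0 a))) => [|[|x s] _ ls].
- split=> [|c u v hu hv]; first by rewrite linear0 subr0.
  by rewrite linearP opprD addrACA -scalerBr; apply: sl.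
- by rewrite big_nil comp_one subrr.
have px : pos x by case: (ls x (mem_head _ _)) => /Vpos.
have -> : comp A 0 (\prod_(y <- x :: s) y) = 0.
  by rewrite big_cons comp0M px mul0r.
by rewrite subr0; apply: wspan_prod.
Qed.

Lemma wspan_prods k a : prods (@pos A) k a -> wspan k a.
Proof.
move: a; apply: prods_ind; first exact: lsub_wspan.
move=> s; elim: s k => [|x s IH] k <- sP; first by apply: wspan_prod.
rewrite big_cons -[size _]/(1 + size s)%N; apply: wspan_mul.
  by apply: wspan_pos; apply: sP; apply: mem_head.
by apply: IH => // y ys; apply: sP; apply: mem_behead.
Qed.
End Generation.

(** * An acyclic ideal from the vanishing of cohomology above degree N *)

Section HnilUpper.
Variables (M : cdga) (N k : nat).
Hypothesis ftM : finite_type M.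
Hypothesis HM : forall j, (N < j)%N -> ~ @Hnz M setT j.
Hypothesis MN : forall (z : M) j, prods (@pos M) k z -> homog j z ->
  (j <= N)%N -> z = 0.

Lemma exact_above (z : M) j : (N < j)%N -> homog j z -> diff M z = 0 -> exact z.
Proof.
move=> Nj hz dz; apply: contrapT => ne; apply: (HM Nj).
by exists z; split=> // /exactE.
Qed.

(* Everything above degree N, together with a complement of the cocycles in
   degree N, is an acyclic ideal. *)
Lemma acyclic_ideal :
  exists J : set M, [/\ dgideal J, acyclic J & prods (@pos M) k `<=` J].
Proof.
have [s hs] := ftM N.
pose X (a : M) := homog N a.
pose Y (a : M) := homog N a /\ diff M a = 0.
have hX : lsub X by split=> [|c u v]; [exact: homog0|exact: homog_comb].
have hY : lsub Y.
  split=> [|c u v [hu du] [hv dv]]; first by split; [exact: homog0|exact: linear0].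
  by split; [exact: homog_comb|rewrite linearP /= du dv scaler0 addr0].
have [t [tX tS tI]] := complement hX hY (fun x hx => span_seqP (hs x hx)).
have [C0 Cl] := lsub_lspan t.
pose J : set M := [set a | (forall i, (i < N)%N -> comp M i a = 0) /\
                           lspan t (comp M N a)].
have hJ : subspace J.
  split=> [|c u v [u0 uC] [v0 vC]].
    by split=> [i _|]; rewrite linear0.
  split=> [i hi|]; rewrite linearP; last exact: Cl.
  by rewrite /= u0 // v0 // scaler0 addr0.
(* As M^0 consists of scalars, a product with an element of J has in degree N only a scalar multiple
   of its lowest component. Hence any subspace of M^N is compatible with J being an ideal. *)
have scal (b : M) : exists c : rat, comp M 0 b = c%:A.
  exact/cdga_conn/homog_comp.
exists J; split.
- split; last first.
    move=> x [x0 xC]; split=> [[|i] hi|].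
    + exact/der_comp0/diff_der.
    + by rewrite -d_comp x0 ?linear0 // (leq_trans _ hi).
    suff -> : comp M N (diff M x) = 0 by [].
    case: (posnP N) => [e|h]; first by rewrite e (der_comp0 (diff_der M)).
    by rewrite -(prednK h) -d_comp x0 ?linear0 // prednK.
  split.
    split=> // i x [x0 xC]; split=> [j hj|]; rewrite compE.
      by case: eqP => // <-; apply: x0.
    by case: eqP => // <-.
  move=> b x [x0 xC]; have [c hc] := scal b; split.
  + split=> [i hi|]; rewrite comp_mulE.
      rewrite big1 // => j _; rewrite (x0 (i - j)%N) ?mulr0 //.
      by rewrite (leq_ltn_trans _ hi) // leq_subr.
    rewrite big_ord_recl subn0 big1 /= => [|j _]; last first.
      by rewrite x0 ?mulr0 // /bump /=; have := ltn_ord j; lia.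
    by rewrite addr0 hc -scalerAl mul1r; apply: (lsubZ _ (lsub_lspan t)).
  split=> [i hi|]; rewrite comp_mulE.
    rewrite big1 // => j _; rewrite (x0 j) ?mul0r //.
    by rewrite (leq_ltn_trans _ hi) // -ltnS.
  rewrite big_ord_recr subnn big1 /= => [|j _]; last by rewrite x0 ?mul0r.
  by rewrite add0r hc -scalerAr mulr1; apply: (lsubZ _ (lsub_lspan t)).
- move=> z [[z0 zC] dz].
  have zN : comp M N z = 0.
    have [c e] := (lspanP t _).1 zC.
    have hYz : Y (comp M N z).
      by split; [exact: homog_comp|rewrite d_comp dz linear0].
    rewrite e big1 // => i _.
    by rewrite (tI c) ?scale0r // -e.
  have [n ez] := comp_sum z.
  suff h i : exists w, J w /\ diff M w = comp M i z.
    rewrite ez; apply: (lsub_sum (X := fun z => coboundary J z)) => [|i _]; last exact: h.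
    case: (hJ) => J0 Jl; split=> [|c _ _ [u [Ju <-]] [v [Jv <-]]].
      by exists 0; rewrite linear0.
    by exists (c *: u + v); rewrite linearP; split=> //; apply: Jl.
  have [iN|Ni] := leqP i N.
    exists 0; rewrite linear0; split; first by case: hJ.
    by move: iN; rewrite leq_eqVlt => /predU1P[->|/z0 ->].
  have hzi := homog_comp i z.
  have dzi : diff M (comp M i z) = 0 by rewrite d_comp dz linear0.
  case: i Ni hzi dzi => // i Ni hzi dzi.
  have [w hw <-] := exact_homog hzi (exact_above Ni hzi dzi).
  (* A primitive in degree N itself need not lie in the chosen complement; its cocycle part [y] is
     subtracted. A primitive of higher degree is in J anyway. *)
  move: Ni; rewrite ltnS leq_eqVlt => /predU1P[eN|Ni].
    have Xw : X w by rewrite /X eN.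
    have [y [[hy dy] tw]] := tS w Xw.
    exists (w - y); split; last by rewrite linearB /= dy subr0.
    have hwy : homog N (w - y) by apply: homogB; rewrite // eN.
    split=> [j hj|]; first by rewrite (homog_neq hwy) // gtn_eqF.
    by rewrite hwy.
  exists w; split=> //; split=> [j hj|].
    by rewrite (homog_neq hw) // gtn_eqF // (ltn_trans hj).
  by rewrite (homog_neq hw) // gtn_eqF.
move=> a ha.
have a0 i : (i <= N)%N -> comp M i a = 0.
  by move=> hi; apply: (MN (prods_pos_comp i ha) (homog_comp i a) hi).
split=> [i /ltnW /a0 //|].
by rewrite a0.
Qed.
End HnilUpper.

Lemma esup_max (P : set nat) n : P n -> (forall m, P m -> (m <= n)%N) ->
  esup P = enat n.
Proof.
move=> Pn nP; rewrite /esup.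
have he : (supremums (enat @` P)) (enat n).
  split=> [_ [m /nP h <-]|y]; first by rewrite lee_fin lez_nat.
  by apply; exists n.
rewrite /supremum.
case: ifPn => [/eqP e|ne]; first by have : set0 (enat n) by rewrite -e; exists n.
case: xgetP => [y _ hy|/(_ (enat n))]; last by [].
exact: is_subset1_supremums hy he.
Qed.

(** * M_q in low degrees and its invariants *)

Section MStructure.
Variable q : nat.
Hypothesis q_odd : odd q.
Hypothesis q_ge3 : (3 <= q)%N.
Local Notation SF := (SF q_odd q_ge3).
Local Notation SP := (SP q_odd q_ge3).
Local Notation AF := (galg SF).
Local Notation AP := (galg SP).
Local Notation eF := (@ee SF).
Local Notation eP := (@ee SP).

Variables (D M : cdga) (dF : {linear AF -> AF}) (theta : ghom AF D).
Hypothesis hdF : derivation dF.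
Hypothesis dFl : forall i, dF (eF [:: i]) = oapp eF 0 (dletter i).
Hypothesis theta_surj : forall b, exists a, theta a = b.
Hypothesis theta_d : forall a, theta (dF a) = diff D (theta a).
Hypothesis theta_ker : forall a, theta a = 0 <->
  sumset (prods (@pos AF) 4) (@deg_gt AF (7 * q - 3)) a.

Variables (dP : {linear AP -> AP}) (j : ghom AP M) (phi : dghom M D).
Hypothesis hdP : derivation dP.
Hypothesis dPl : forall i,
  dP (eP [:: i]) = if (i < 5)%N then oapp eP 0 (dletter i) else 0.
Hypothesis j_inj : injective j.
Hypothesis j_d : forall a, j (dP a) = diff M (j a).
Hypothesis phi_j : forall i, (i < 5)%N -> phi (j (eP [:: i])) = theta (eF [:: i]).
Hypothesis phi_q : quasi_iso phi.

Variables (V W G : set M).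
Hypothesis V_sum : V = sumset (span G) W.
Hypothesis G_letters : forall g, G g -> exists2 i, (i < 5)%N & g = j (eP [:: i]).
Hypothesis V_gsub : gsubspace V.
Hypothesis V_pos : forall v, V v -> @pos M v.
Hypothesis V_free : free_on V.
Hypothesis W_gsub : gsubspace W.
Hypothesis W_deg : forall i, (i <= 5 * q - 1)%N -> zero_in_deg W i.
Hypothesis ftM : finite_type M.

Lemma degSP_pos i : adm SP [:: i] -> (0 < deg SP i)%N.
Proof.
rewrite /= => /andP[_]; rewrite andbT.
by case: i => [|[|[|[|[|i]]]]] //= _; lia.
Qed.

Lemma phi_word w : all (fun i => i < 5)%N w -> phi (j (eP w)) = theta (eF w).
Proof.
elim: w => [|i w IH /= /andP[hi /IH e]]; first by rewrite !ee_nil !rmorph1.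
by rewrite (ee_cons SP i w) (ee_cons SF i w) !rmorphM /= phi_j // e.
Qed.

Lemma sp_prods4 a : sp 4 a -> prods (@pos AF) 4 a.
Proof. by apply; [exact: span_subspace|exact: eF_prods4]. Qed.

Lemma theta_sp4 a : sp 4 a -> theta a = 0.
Proof.
move=> ha; apply/theta_ker; exists a, 0; split; first exact: sp_prods4.
  by move=> i _; rewrite linear0.
by rewrite addr0.
Qed.

Lemma D_prods4 b : prods (@pos D) 4 b -> b = 0.
Proof.
move: b; apply: prods_ind => [|s s4 sp].
  by split=> //= c u v -> ->; rewrite scaler0 addr0.
have [t et tp] : exists2 t : seq AF, map theta t = s & forall a, a \in t -> @pos AF a.
  elim: s {s4} sp => [|x s IH] sp; first by exists [::].
  have [|t <- tp] := IH; first by move=> y ys; apply: sp; apply: mem_behead.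
  have [a ea] := theta_surj x; have px := sp x (mem_head _ _).
  have px' : theta (comp AF 0 a) = 0 by rewrite ghom_comp ea px.
  (* A lift of a positive element becomes positive once its degree 0 component, which maps to 0, is
     removed. *)
  exists (a - comp AF 0 a :: t); first by rewrite /= linearB /= px' subr0 ea.
  move=> y; rewrite inE => /predU1P[->|/tp //].
  by rewrite /pos /= linearB /= (homog_comp 0 a) subrr.
have <- : theta (\prod_(a <- t) a) = \prod_(x <- s) x.
  by rewrite rmorph_prod -et big_map.
apply/theta_ker; exists (\prod_(a <- t) a), 0; split; last by rewrite addr0.
  by rewrite -s4 -et size_map; apply: prods_prod.
by move=> i _; rewrite linear0.
Qed.

Lemma D_deg i (b : D) : (7 * q - 3 < i)%N -> homog i b -> b = 0.
Proof.
move=> hi; have [a <-] := theta_surj b; rewrite /homog -ghom_comp => <-.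
apply/theta_ker; exists 0, (comp AF i a); split; last by rewrite add0r.
  by case: (prods_subspace (@pos AF) 4).
by move=> k hk; rewrite compE ltn_eqF // (leq_ltn_trans hk).
Qed.

Lemma detectsP (L : {linear AF -> rat^o}) a :
  detects dF L -> exact (theta a) -> L a = 0.
Proof.
move=> hL [b]; have [c <-] := theta_surj b; rewrite -theta_d => e.
have /theta_ker/(detects0 hL) : theta (dF c - a) = 0 by rewrite linearB /= e subrr.
case: hL => _ _ Ld; rewrite linearB /= Ld sub0r => /eqP.
by rewrite oppr_eq0 => /eqP.
Qed.

Lemma sp_comp (S : shape) k i (a : galg S) : sp k a -> sp k (comp _ i a).
Proof.
have [s0 sl] := lsub_sp S k.
move=> ha; apply: (ha (fun a => sp k (comp _ i a))) => [|w kw].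
  split=> [|c u v hu hv]; first by rewrite linear0.
  by rewrite linearP; apply: sl.
by rewrite /= acomp_ee; case: eqP => // _; apply: sp_ee.
Qed.

(** Below degree 5q the summand in W has no component, so a generator comes from P; from 5q on, only
    its degree matters. *)
Lemma letter_dichotomy x : letter V x -> x = 0 \/ exists i, [/\ homog i x, (q <= i)%N
  & (5 * q <= i)%N \/ exists a, [/\ sp 1 a, homog i a & j a = x]].
Proof.
case; rewrite V_sum => -[g [w [hg hw ->]]] [i hi].
have [a [ha aq ja]] : exists a, [/\ sp 1 a, forall n, (n < q)%N -> comp AP n a = 0
                                & j a = g].
  have [s0 sl] := lsub_sp SP 1.
  apply: (hg [set g | exists a, [/\ sp 1 a, forall n, (n < q)%N -> comp AP n a = 0
                                & j a = g]]).
  split=> [|_ /G_letters[k k5 ->]].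
    split=> [|c _ _ [a [ha aq <-]] [b [hb bq <-]]].
      by exists 0; split=> // [n _|]; rewrite linear0.
    exists (c *: a + b); split; [exact: sl|move=> n hn|by rewrite linearP].
    by rewrite linearP /= aq // bq // scaler0 addr0.
  exists (eP [:: k]); split=> // [|n hn]; first exact: sp_ee.
  rewrite (homog_neq (homog_letter SP k)) //.
  by case: k k5 => [|[|[|[|[|k]]]]] //= _; apply/eqP; lia.
have e : g + w = j (comp AP i a) + comp M i w.
  by rewrite -hi linearD /= -ja ghom_comp.
have [iq|qi] := leqP (5 * q) i.
  by right; exists i; split=> //; [lia|left].
have w0 : comp M i w = 0.
  apply: (W_deg (i := i)); [by lia| |exact: homog_comp].
  exact: W_gsub.2.
rewrite e w0 addr0; have [iq|q_i] := ltnP i q.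
  by left; rewrite aq // linear0.
right; exists i; split=> //; first exact/ghom_homog/homog_comp.
by right; exists (comp AP i a); split=> //; [apply: sp_comp|apply: homog_comp].
Qed.

(** Each letter contributes at least q to the degree, and one of degree at least 5q exceeds this
    minimum by 4q. A nonzero word of smaller degree therefore comes from P. *)
Lemma word_dichotomy (s : seq M) : (forall x, x \in s -> letter V x) ->
  let z := \prod_(x <- s) x in z = 0 \/ exists n,
    [/\ homog n z, (q * size s <= n)%N & (q * size s + 4 * q <= n)%N \/
      exists a, [/\ sp (size s) a, homog n a & j a = z]].
Proof.
elim: s => [|x s IH] hs /=.
  rewrite big_nil; right; exists 0%N; split; [exact: homog1|by rewrite muln0|].
  right; exists 1; split; [|exact: homog1|exact: rmorph1].
  by rewrite -(ee_nil SP); apply: sp_ee.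
rewrite big_cons; have [|->|[n [hn ln hz]]] := IH.
- by move=> y ys; apply: hs; apply: mem_behead.
- by left; rewrite mulr0.
have [->|[i [hi li hx]]] := letter_dichotomy (hs x (mem_head _ _)).
  by left; rewrite mul0r.
right; exists (i + n)%N; split; [exact: homogM|by rewrite mulnS leq_add|].
case: hx => [h|[a [sa ha <-]]]; first by left; rewrite mulnS; lia.
case: hz => [h|[b [sb hb <-]]]; first by left; rewrite mulnS; lia.
right; exists (a * b); split; [exact: (@sp_mul SP 1)|exact: homogM|exact: rmorphM].
Qed.

(** The bound is 5q, 8q and 9q for k = 1, 4 and 5, which covers the degrees 5q - 2, those below 5q -
    1, and those up to 7q - 3 that are needed for these powers. *)
Lemma low_degree k n z : (0 < k)%N -> (n < q * k + 4 * q)%N -> wspan V k z ->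
  homog n z -> exists a, [/\ sp k a, homog n a & j a = z].
Proof.
move=> k0 nk hz hn; have [s0 sl] := lsub_sp SP k.
suff [a [sa ja]] : exists a, sp k a /\ j a = comp M n z.
  exists (comp AP n a); split; [exact: sp_comp|exact: homog_comp|].
  by rewrite ghom_comp ja compE eqxx.
apply: (hz (fun z => exists a, sp k a /\ j a = comp M n z)).
  split=> [|c u v [a [sa ea]] [b [sb eb]]].
    by exists 0; rewrite !linear0.
  by exists (c *: a + b); rewrite !linearP /= ea eb; split=> //; apply: sl.
move=> s ks ls; have [->|[m [hm lm h]]] := word_dichotomy ls.
  by exists 0; rewrite !linear0.
have [e|ne] := eqVneq m n; last first.
  by exists 0; rewrite linear0 (homog_neq hm).
case: h => [h|[a [sa ha ja]]].
  have h' : (q * k <= q * size s)%N by rewrite leq_mul2l ks orbT.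
  lia.
exists a; split; last by rewrite ja -e hm.
by move=> Y hY hw; apply: sa => // w lw; apply: hw; apply: leq_trans lw.
Qed.

(** Turns questions about words of P into arithmetic of exponents, all but that of the even letter t
    being at most 1. *)
Lemma SP_counts w : adm SP w -> exists c0 c1 c2 c3 c4,
  [/\ [/\ count_mem 0%N w = c0, count_mem 1%N w = c1, count_mem 2%N w = c2,
          count_mem 3%N w = c3 & count_mem 4%N w = c4],
      (c0 <= 1 /\ c1 <= 1 /\ c2 <= 1 /\ c3 <= 1)%N,
      degw SP w = (c0 * q + c1 * q + c2 * q + c3 * (2 * q - 1) + c4 * (4 * q - 2))%N
    & size w = (c0 + c1 + c2 + c3 + c4)%N].
Proof.
move=> /andP[/oddfreeP odd_w all_w].
exists (count_mem 0%N w), (count_mem 1%N w), (count_mem 2%N w), (count_mem 3%N w),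
  (count_mem 4%N w); split=> //.
- by split; [|split; [|split]]; apply: odd_w.
- by rewrite (degw_count SP all_w) !big_ord_recl big_ord0 /= addn0 -!addnA.
by rewrite (size_count all_w) !big_ord_recl big_ord0 /= addn0 -!addnA.
Qed.

(** The exponent of t is the only unbounded one and enters the degree nonlinearly. Two copies of t
    already have degree 8q - 4 > 7q - 3, above every degree considered, and the case split leaves
    linear arithmetic. *)
Lemma t_count c : c = 0%N \/ c = 1%N \/ (8 * q - 4 <= c * (4 * q - 2))%N.
Proof.
case: c => [|[|c]]; [by left|by right; left|right; right].
by rewrite !mulSn; lia.
Qed.

(** Without t the only word of four letters is s x y a, of degree exactly 5q - 1. One t and three
    further letters have degree at least 7q - 2. *)
Lemma AP_prods4 n (a : AP) : sp 4 a -> homog n a -> (n < 5 * q - 1)%N -> a = 0.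
Proof.
move=> sa ha hn; apply: (@sp_homog SP 4 n a (fun a => a = 0)) => //.
  by split=> // c u v -> ->; rewrite scaler0 addr0.
move=> w aw _ sw dw; exfalso.
have [c0 [c1 [c2 [c3 [c4 [_ hc e1 e2]]]]]] := SP_counts aw.
rewrite dw in e1; rewrite {}e2 in sw; have := t_count c4.
case=> [h|[h|h]]; try subst c4.
- by case: hc => h0 [h1 [h2 h3]]; move: h0 h1 h2 h3 e1 sw;
    case: c0 => [|[|?]] //; case: c1 => [|[|?]] //; case: c2 => [|[|?]] //;
    case: c3 => [|[|?]] //; rewrite !(mul0n, mul1n); lia.
- by case: hc => h0 [h1 [h2 h3]]; move: h0 h1 h2 h3 e1 sw;
    case: c0 => [|[|?]] //; case: c1 => [|[|?]] //; case: c2 => [|[|?]] //;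
    case: c3 => [|[|?]] //; rewrite !(mul0n, mul1n); lia.
lia.
Qed.

(** The odd letters give words of length at most 4, so t occurs. If it occurs once, all four odd
    letters are present and the degree is 9q - 3; two copies of t have degree at least 8q - 4. *)
Lemma AP_prods5 n (a : AP) : sp 5 a -> homog n a -> (n <= 7 * q - 3)%N -> a = 0.
Proof.
move=> sa ha hn; apply: (@sp_homog SP 5 n a (fun a => a = 0)) => //.
  by split=> // c u v -> ->; rewrite scaler0 addr0.
move=> w aw _ sw dw; exfalso.
have [c0 [c1 [c2 [c3 [c4 [_ hc e1 e2]]]]]] := SP_counts aw.
rewrite dw in e1; rewrite {}e2 in sw; have := t_count c4.
case=> [h|[h|h]]; try subst c4; last by lia.
all: by case: hc => h0 [h1 [h2 h3]]; move: h0 h1 h2 h3 e1 sw;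
    case: c0 => [|[|?]] //; case: c1 => [|[|?]] //; case: c2 => [|[|?]] //;
    case: c3 => [|[|?]] //; rewrite !(mul0n, mul1n); lia.
Qed.

(** No product of odd letters has degree 5q - 2, and two copies of t exceed it. So there is one t,
    and the remaining degree q leaves one of s, x, y. *)
Lemma AP_5q2 (a : AP) : sp 1 a -> homog (5 * q - 2) a ->
  exists c0 c1 c2 : rat,
    a = c0 *: eP [:: 0; 4]%N + c1 *: eP [:: 1; 4]%N + c2 *: eP [:: 2; 4]%N.
Proof.
move=> sa ha; pose Y (a : AP) := exists c0 c1 c2 : rat,
    a = c0 *: eP [:: 0; 4]%N + c1 *: eP [:: 1; 4]%N + c2 *: eP [:: 2; 4]%N.
apply: (@sp_homog SP 1 (5 * q - 2) a Y) => //.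
  split=> [|c _ _ [u0 [u1 [u2 ->]]] [v0 [v1 [v2 ->]]]].
    by exists 0, 0, 0; rewrite !scale0r !addr0.
  exists (c * u0 + v0), (c * u1 + v1), (c * u2 + v2).
  by rewrite !scalerDr !scalerA !scalerDl addrACA [X in X + _ = _]addrACA.
move=> w aw _ sw dw.
have [c0 [c1 [c2 [c3 [c4 [[w0 w1 w2 w3 w4] hc e1 e2]]]]]] := SP_counts aw.
have all_w : all (fun i => i < 5)%N w by case/andP: aw.
have pw (v : seq nat) : all (fun i => i < 5)%N v ->
    [/\ count_mem 0%N v = c0, count_mem 1%N v = c1, count_mem 2%N v = c2,
        count_mem 3%N v = c3 & count_mem 4%N v = c4] ->
    exists c : rat, eP w = c *: eP v.
  move=> av [v0 v1 v2 v3 v4]; exists ((-1) ^+ (inv (par SP) w + inv (par SP) v)).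
  apply: ee_permE; apply: (perm_count all_w av).
  by case=> [|[|[|[|[|i]]]]] // _; rewrite ?(w0, w1, w2, w3, w4) ?(v0, v1, v2, v3, v4).
rewrite dw in e1.
have [v ev hv] : exists2 v, v \in [:: [:: 0; 4]; [:: 1; 4]; [:: 2; 4]]%N &
    [/\ count_mem 0%N v = c0, count_mem 1%N v = c1, count_mem 2%N v = c2,
        count_mem 3%N v = c3 & count_mem 4%N v = c4].
  have := t_count c4; clear pw w0 w1 w2 w3 w4.
  case=> [h|[h|h]]; try subst c4; last by exfalso; lia.
  - exfalso; case: hc => h0 [h1 [h2 h3]]; move: h0 h1 h2 h3 e1 e2;
    case: c0 => [|[|?]] //; case: c1 => [|[|?]] //; case: c2 => [|[|?]] //;
    case: c3 => [|[|?]] //; rewrite !(mul0n, mul1n); lia.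
  - case: hc => h0 [h1 [h2 h3]]; move: h0 h1 h2 h3 e1 e2;
    case: c0 => [|[|?]] //; case: c1 => [|[|?]] //; case: c2 => [|[|?]] //;
    case: c3 => [|[|?]] // _ _ _ _ e1 _;
    try (by exfalso; move: e1; rewrite !(mul0n, mul1n); lia).
    + by exists [:: 2; 4]%N.
    + by exists [:: 1; 4]%N.
    + by exists [:: 0; 4]%N.
have [c ->] : exists c : rat, eP w = c *: eP v.
  by apply: pw => //; move: ev; rewrite !inE => /or3P[] /eqP ->.
move: ev; rewrite !inE => /or3P[] /eqP ->.
- by exists c, 0, 0; rewrite !scale0r !addr0.
- by exists 0, c, 0; rewrite !scale0r !addr0 add0r.
- by exists 0, 0, c; rewrite !scale0r !add0r.
Qed.

Lemma dP_st i : (i < 3)%N -> dP (eP [:: i; 4]%N) = - eP [:: i; 3; 2; 0]%N.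
Proof.
move=> hi; have oi : odd (deg SP i) by rewrite -parE; case: i hi => [|[|[|]]].
rewrite ee_cons (der_oddM hdP _ (homog_letter SP i) oi) !dPl /=.
rewrite (leq_trans hi) //.
by case: i hi {oi} => [|[|[|]]] //= _; rewrite mul0r sub0r -ee_cat.
Qed.

Lemma M_low k n z : (0 < k)%N -> (n < q * k + 4 * q)%N -> prods (@pos M) k z ->
  homog n z -> exists a, [/\ sp k a, homog n a & j a = z].
Proof. by move=> k0 nk hz; apply: low_degree => //; apply: wspan_prods. Qed.

Lemma M_prods4 n z : prods (@pos M) 4 z -> homog n z -> (n < 5 * q - 1)%N -> z = 0.
Proof.
move=> hz hn ln; have [||a [sa ha <-]] := M_low _ _ hz hn; [by []|lia|].
by rewrite (AP_prods4 sa ha ln) linear0.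
Qed.

Lemma M_prods5 n z : prods (@pos M) 5 z -> homog n z -> (n <= 7 * q - 3)%N -> z = 0.
Proof.
move=> hz hn ln; have [||a [sa ha <-]] := M_low _ _ hz hn; [by []|lia|].
by rewrite (AP_prods5 sa ha ln) linear0.
Qed.

Lemma j_pos_prods w : all (fun i => i < 5)%N w -> prods (@pos M) (size w) (j (eP w)).
Proof.
elim: w => [_|i w IH /= /andP[hi /IH h]].
  by have := @prods_prod M (@pos M) [::]; rewrite big_nil ee_nil rmorph1; apply.
rewrite (ee_cons SP i w) rmorphM; apply: prods_cons => //.
apply: homog_pos (ghom_homog j (homog_letter SP i)) _.
by apply: degSP_pos => /=; case: i hi => [|[|[|[|[|]]]]].
Qed.

Let xayd : homog (5 * q - 1) (eP [:: 1; 3; 2; 0]%N : AP).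
Proof.
have <- : degw SP [:: 1; 3; 2; 0]%N = (5 * q - 1)%N.
  by rewrite !degw_cons degw_nil /=; lia.
exact: homog_ee.
Qed.

Lemma xays_neq0 : eP [:: 1; 3; 2; 0]%N <> 0.
Proof.
by move/(congr1 (cf SP [:: 0; 1; 2; 3]%N)); rewrite linear0 cf_ee.
Qed.

Lemma xays_cocycle : diff M (j (eP [:: 1; 3; 2; 0]%N)) = 0.
Proof.
have /(congr1 -%R) := dP_st (isT : (1 < 3)%N); rewrite opprK => <-.
by rewrite linearN /= j_d linearN /= diff_diff oppr0.
Qed.

Lemma xays_prods : prods (@pos M) 4 (j (eP [:: 1; 3; 2; 0]%N)).
Proof. exact: (@j_pos_prods [:: 1; 3; 2; 0]%N). Qed.

Lemma a_3M : a_ 3 M = enat (5 * q - 1).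
Proof.
apply: einf_min => [|n [z [hz [pz dz] nz]]].
  exists (j (eP [:: 1; 3; 2; 0]%N)); split.
  - exact: ghom_homog.
  - by split; [exact: xays_prods|exact: xays_cocycle].
  case=> w [pw dw]; apply: xays_neq0; apply: j_inj; rewrite linear0.
  have hj := ghom_homog j xayd; rewrite -hj -dw.
  have -> : (5 * q - 1 = (5 * q - 2).+1)%N by lia.
  rewrite -d_comp (M_prods4 (prods_pos_comp _ pw) (homog_comp _ w)) ?linear0 //.
  by lia.
rewrite leqNgt; apply/negP => hn; apply: nz.
exists 0; rewrite linear0 (M_prods4 pz hz hn); split=> //.
by case: (prods_subspace (@pos M) 4).
Qed.

Lemma M_xya : massey q.-1 M.
Proof.
have eq1 : q.-1.+1 = q by rewrite prednK //; lia.
have hl i d : (i < 5)%N -> nth 0%N (degsP q) i = d -> homog d (j (eP [:: i])).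
  by move=> _ <-; apply: ghom_homog; apply: homog_letter.
exists (j (eP [:: 1]%N)), (j (eP [:: 2]%N)), (j (eP [:: 3]%N)); rewrite eq1.
split; [exact: hl|exact: hl|apply: hl => //=; lia|].
rewrite -!j_d !dPl /= !linear0; split=> //.
  by rewrite -rmorphM -ee_cat.
rewrite -!rmorphM -!ee_cat /= => /(dgexact phi).
rewrite phi_word // => /(detectsP (detects_xya hdF dFl)).
by rewrite cfcE.
Qed.

Lemma zigzagD : zigzag M D.
Proof. exact: (zigzag_fwd (zigzag_refl M) phi_q). Qed.

Lemma qm1_even : ~~ odd q.-1.
Proof. by move: q_odd; case: (q) => //= n; rewrite negbK. Qed.

Lemma nilhM : nilh M = enat 3.
Proof.
apply: einf_min => [|n [B [hz hB]]].
  exists D; split; first exact: zigzagD.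
  apply/seteqP; split=> [b /D_prods4 //|_ ->].
  by case: (prods_subspace (@pos D) 4).
apply: (massey_nil _ hB); apply: (massey_zigzag qm1_even hz); exact: M_xya.
Qed.

Lemma e0M : e0 M = enat 3.
Proof.
apply: einf_min => [z [_ dz] [w pz]|n hn].
  apply/exactE/(quasi_inj phi_q) => //; exists (phi w).
  rewrite -dghom_diff; apply/eqP; rewrite -subr_eq0 -linearB /=.
  rewrite -opprB linearN /= (D_prods4 (b := phi _)) ?oppr0 //.
  by apply: prods_ghom pz => x px; rewrite /pos /= -ghom_comp px linear0.
rewrite leqNgt; apply/negP => n3.
have [x [y [a [hx hy ha [dx dy da ne]]]]] := M_xya.
apply/ne/exactE; apply: hn.
  split=> //; exact: (massey_cocycle qm1_even hx hy dx dy da).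
exists 0; rewrite linear0 subr0; apply: (@prods_pos_mono M n 2) => //.
have pp i z : homog i.+1 z -> @pos M z by move/homog_pos; apply.
rewrite -mulrA; apply: prods_cons (pp _ _ hx) _; apply: prods_cons (pp _ _ hy) _.
rewrite -[a]mulr1; apply: prods_cons (pp _ _ ha) _.
by have := @prods_prod M (@pos M) [::]; rewrite big_nil; apply.
Qed.

Lemma M_above n : (7 * q - 3 < n)%N -> ~ @Hnz M setT n.
Proof.
move=> hn [z [hz [_ dz] nz]]; apply/nz/exactE/(quasi_inj phi_q) => //.
by rewrite (D_deg hn (ghom_homog phi hz)); exists 0; rewrite linear0.
Qed.

(** The top class is that of y a t: its boundary consists of words of length at least 4, which
    vanish in D, and its coefficient is a detecting functional. *)
Lemma cdM : cd M = enat (7 * q - 3).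
Proof.
apply: esup_max => [|n hn]; last first.
  by rewrite leqNgt; apply/negP => /M_above; apply.
have [m em] : exists m, (7 * q - 3 = m.+1)%N by exists (7 * q - 4)%N; lia.
pose b : AF := eF [:: 2; 3; 4]%N.
have hb : homog (7 * q - 3) (theta b).
  apply: ghom_homog; have <- : degw SF [:: 2; 3; 4]%N = (7 * q - 3)%N.
    by rewrite !degw_cons degw_nil /=; lia.
  exact: homog_ee.
have db : diff D (theta b) = 0.
  rewrite -theta_d; apply: theta_sp4.
  apply: (@sp_der SF dF hdF _ [:: 2; 3; 4]%N) => i; rewrite dFl.
  by case: i => [|[|[|[|[|[|i]]]]]]; rewrite /dletter /= ?nth_nil;
    (exact: sp_ee || case: (lsub_sp SF 2)).
rewrite em in hb *; have [z [w [hz dz hw ez]]] := quasi_surj phi_q hb db.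
exists z; split=> // /exactE/(dgexact phi) h.
have : exact (theta b).
  apply: (@exact_sub D (phi z)) => //; exists w.
  by rewrite ez addrAC subrr add0r.
by move/(detectsP (detects_yat hdF dFl)); rewrite cfcE.
Qed.

Lemma Hnil_le4 : exists J : set M,
  [/\ dgideal J, acyclic J & prods (@pos M) 5 `<=` J].
Proof.
apply: (@acyclic_ideal M (7 * q - 3) 5) => // [n|z n]; first exact: M_above.
by move=> pz hz; apply: M_prods5 pz hz.
Qed.

Lemma Hnil_ge4 n (J : set M) : dgideal J -> acyclic J ->
  prods (@pos M) n.+1 `<=` J -> (4 <= n)%N.
Proof.
move=> [[[[J0 Jl] Jc] JM] Jd] Ja Jn; rewrite leqNgt; apply/negP => n4.
have jexact z : J z -> diff M z = 0 -> exact z.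
  by move=> Jz dz; have [w [_ dw]] := Ja z (conj Jz dz); exists w.
pose X : AP := eP [:: 1; 3; 2; 0]%N.
have JX : J (j X).
  by apply: Jn; apply: (@prods_pos_mono M n 3) => //; apply: xays_prods.
have [w0 [Jw0 dw0]] := Ja _ (conj JX xays_cocycle).
pose w := comp M (5 * q - 2) w0; have Jw : J w by apply: Jc.
have dw : diff M w = j X.
  rewrite d_comp dw0; have -> : ((5 * q - 2).+1 = 5 * q - 1)%N by lia.
  exact: (ghom_homog j xayd).
have hw : homog (5 * q - 2) w by apply: homog_comp.
have pw : prods (@pos M) 1 w.
  rewrite -[w]mulr1; apply: prods_cons; first by apply: (homog_pos hw); lia.
  by have := @prods_prod M (@pos M) [::]; rewrite big_nil; apply.
have [||a [sa ha ja]] := M_low _ _ pw hw; [by []|lia|].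
have [c0 [c1 [c2 ea]]] := AP_5q2 sa ha.
have da : dP a = X by apply: j_inj; rewrite j_d ja.
(* Among s t, x t and y t only x t has a nonzero boundary: the other two repeat s or y. *)
have c1n : c1 <> 0.
  move=> c10; apply: xays_neq0; rewrite -[LHS]da ea c10 scale0r addr0.
  rewrite linearD !linearZ /= !dP_st // !ee_nadm ?oppr0 ?scaler0 ?addr0 //.
have aodd : odd (5 * q - 2) by rewrite oddB ?oddM ?q_odd //; lia.
have dright k : dP (a * eP [:: k]) = X * eP [:: k] - a * dP (eP [:: k]).
  by rewrite (der_oddM hdP _ ha aodd) da.
(* The product of [w] with a letter stays in the ideal J. If it is a cocycle, it is exact because J
   is acyclic, and so is its image in D. *)
have ex k : dP (a * eP [:: k]) = 0 -> (k < 5)%N ->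
    exact (theta (c0 *: eF [:: 0; 4; k]%N + c1 *: eF [:: 1; 4; k]%N
                  + c2 *: eF [:: 2; 4; k]%N)).
  move=> dk k5; have -> : theta (c0 *: eF [:: 0; 4; k]%N + c1 *: eF [:: 1; 4; k]%N
                  + c2 *: eF [:: 2; 4; k]%N) = phi (j (a * eP [:: k])).
    rewrite ea !mulrDl -!scalerAl -!ee_cat !linearD !linearZ /=.
    by rewrite !phi_word //= k5.
  apply: dgexact; apply: jexact; last by rewrite -j_d dk linear0.
  by rewrite rmorphM /= ja; apply: (JM _ _ Jw).2.
have c00 : c0 = 0.
  have := ex 2%N; rewrite dright dPl /= mulr0 subr0 -ee_cat ee_nadm // => /(_ erefl isT).
  move/(detectsP (detects_syt hdF dFl)); rewrite !linearD !linearZ /= !cfcE //=.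
  by rewrite /cfc /= !scaler0 !addr0 => <-; apply/esym/mulr1.
(* The product of [w] and the generator a is a cocycle only if w x y = 0. The term s t x y is the
   obstruction, which is why c0 = 0 had to come first; the remaining terms repeat x or y. *)
have a12 : a * eP [:: 1; 2]%N = 0.
  rewrite ea c00 scale0r add0r mulrDl -!scalerAl -!ee_cat /=.
  by rewrite !ee_nadm // !scaler0 addr0.
have := ex 3%N; rewrite dright dPl /= a12 -ee_cat ee_nadm // subr0.
move=> /(_ erefl isT).
move/(detectsP (detects_xat hdF dFl)); rewrite !linearD !linearZ /=.
rewrite !cfcE // /cfc /= c00 scale0r add0r !subr0 scaler0 addr0 => c10.
by apply: c1n; rewrite -c10; apply/esym/mulr1.
Qed.

Lemma HnilM : Hnil M = enat 4.
Proof.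
apply: einf_min; first exact: Hnil_le4.
by move=> n [J [dJ aJ JM]]; apply: Hnil_ge4 JM.
Qed.
End MStructure.

(** * The invariants of an arbitrary M_q *)

Section Invariants.
Variables (q : nat) (M : cdga).
Hypothesis q_odd : odd q.
Hypothesis q_ge3 : (3 <= q)%N.

Lemma Mq_invariants : is_Mq q M ->
  [/\ cd M = enat (7 * q - 3), e0 M = enat 3, nilh M = enat 3,
      Hnil M = enat 4 & a_ 3 M = enat (5 * q - 1)] /\
  exists V : set M,
    [/\ minimal_sullivan V, finite_type M,
        forall i, (i < q)%N -> zero_in_deg V i
      & forall j, (7 * q - 3 < j)%N -> ~ @Hnz M setT j].
Proof.
move=> [D [P [gD [gP [phi0 [iota [W [phi]]]]]]]].
move=> [[hD hP eD] [[iota_inj gW W0 hV ftM] [phi_q phi_iota]]].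
have [dF [theta [hdF dFl thl [th_surj th_d th_ker]]]] := Dq_model q_odd q_ge3 hD.
have [dP [kappa [kinv [hdP dPl kl [k1 k2 kd]]]]] := Pq_model q_odd q_ge3 hP.
have sP : size gP = 5 by case: hP => s [x [y [a [t [-> _]]]]].
set V := sumset _ W in hV; have [gV Vpos Vfree _ _] := hV.
pose j := gcomp iota kappa.
have j_inj : injective j by move=> a b /iota_inj e; rewrite -(k2 a) e k2.
have j_d a : j (dP a) = diff M (j a) by rewrite /= kd dghom_diff.
have phi_j i : (i < 5)%N -> phi (j (ee _ [:: i])) = theta (ee _ [:: i]).
  by move=> hi; rewrite /= phi_iota kl // thl // -eD (nth_map 0) ?sP.
have Gl g : g \in map iota gP -> exists2 i, (i < 5)%N & g = j (ee _ [:: i]).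
  move=> /mapP[v /(nthP 0)[i hi <-] ->]; rewrite sP in hi.
  by exists i => //=; rewrite kl.
have Veq : V = sumset (span [set v | v \in map iota gP]) W by [].
split; first split.
- exact: (cdM hdF dFl th_surj th_d th_ker phi_q).
- exact: (e0M hdF dFl th_surj th_d th_ker dPl j_d phi_j phi_q).
- exact: (nilhM hdF dFl th_surj th_d th_ker dPl j_d phi_j phi_q).
- exact: (HnilM hdF dFl th_surj th_d th_ker hdP dPl j_inj j_d phi_j phi_q Veq
    Gl gV Vpos Vfree gW W0 ftM).
- exact: (a_3M hdP dPl j_inj j_d Veq Gl gV Vpos Vfree gW W0).
exists V; split=> // [i hi v Vv hv|n]; last first.
  exact: (M_above th_surj th_ker phi_q).
have lv : letter V v by split=> //; exists i.
have [//|[k [hk qk _]]] := letter_dichotomy Veq Gl gW W0 lv.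
by apply: (homog_uniq hv hk); rewrite ltn_eqF // (leq_trans hi).
Qed.
End Invariants.

Lemma Mq_not_implication (M : cdga) : is_Mq 3 M -> ~ Hnil_implication (- 2)%R.
Proof.
move=> hM; have [[_ _ hn hH ha] [V [hV ft V0 HN]]] := @Mq_invariants 3 M isT isT hM.
(* For q = 3 one has N = 7q - 3 = 18 and a_3 = 14, so N = a_3 + 2q - 2, and n = 3 = nil_h. *)
move=> /(_ M V 3%N 18%N 3%N hV ft isT isT V0 HN).
rewrite hn hH ha => h; have := h isT isT.
by rewrite lee_fin.
Qed.

(** * Existence of M_q *)

Section Concrete.
Variable q : nat.
Hypothesis q_odd : odd q.
Hypothesis q_ge3 : (3 <= q)%N.
Local Notation SF := (SF q_odd q_ge3).
Local Notation SP := (SP q_odd q_ge3).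
Local Notation AF := (galg SF).
Local Notation AP := (galg SP).
Local Notation eF := (@ee SF).
Local Notation eP := (@ee SP).

Lemma galg_conn (S : shape) : (forall i, adm S [:: i] -> (0 < deg S i)%N) ->
  forall a : galg S, homog 0 a -> exists c : rat, a = c%:A.
Proof.
move=> hdeg a <-; elim/gee_ind: a => [|c u v [a ha] [b hb]|w aw _].
- by exists 0; rewrite linear0 scale0r.
- by exists (c * a + b); rewrite linearP ha hb scalerA scalerDl.
rewrite /= acomp_ee; case: eqP => [d0|_]; last by exists 0; rewrite scale0r.
case: (posnP (size w)) => [/size0nil ->|sw].
  by exists 1; rewrite ee_nil scale1r.
by have := degw_pos hdeg aw sw; rewrite d0.
Qed.

Definition admD (w : seq nat) : bool :=
  [&& adm SF w, (size w <= 3)%N & (degw SF w <= 7 * q - 3)%N].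

Lemma admD_perm w w' : perm_eq w w' -> admD w = admD w'.
Proof.
move=> p; rewrite /admD (adm_perm _ p) (perm_size p).
by rewrite /degw (perm_big _ p).
Qed.

Lemma admD_catl w w' : admD (w ++ w') -> admD w.
Proof.
case/and3P => /adm_catl aw; rewrite size_cat degw_cat => sw dw.
by rewrite /admD aw; apply/andP; split; lia.
Qed.

Lemma admD_nil : admD [::].
Proof. by rewrite /admD (adm_nil SF) degw_nil. Qed.

Lemma admD_sq i : nth false parsF i -> admD [:: i; i] = false.
Proof. by move=> pi; rewrite /admD (@adm_sq SF i pi). Qed.

Definition SD : shape :=
  Shape (parsFE q_odd q_ge3) admD_perm admD_catl admD_nil admD_sq.
Local Notation AD := (galg SD).
Local Notation eD := (@ee SD).

Lemma proj_exists : exists p : ghom AF AD, forall w, p (eF w) = eD w.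
Proof.
have [i|w nw|p hp] := @ghom_exists SF AD (fun i => eD [:: i]).
- exact: homog_letter.
- by rewrite -ee_evalw ee_nadm //= /admD (negPf nw).
by exists p => w; rewrite hp -ee_evalw.
Qed.

Section Proj.
Variable p : ghom AF AD.
Hypothesis pE : forall w, p (eF w) = eD w.

(** The linear section of [p] that sends a basis word of D to the same word of F. It is not
    multiplicative. *)
Definition lift : {linear AD -> AF} := @lina SD AF eF.

Local Notation Ker := (sumset (prods (@pos AF) 4) (@deg_gt AF (7 * q - 3))).

Lemma lsub_Ker : lsub Ker.
Proof.
have [p0 pl] := prods_subspace (@pos AF) 4.
split=> [|c _ _ [a [b [ha hb ->]]] [a' [b' [ha' hb' ->]]]].
  by exists 0, 0; split; rewrite ?addr0 // => i _; rewrite linear0.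
exists (c *: a + a'), (c *: b + b'); split; first exact: pl.
  by move=> i hi; rewrite linearP /= hb // hb' // scaler0 addr0.
by rewrite scalerDr addrACA.
Qed.

Lemma lift_p a : Ker (a - lift (p a)).
Proof.
elim/gee_ind: a => [|c u v hu hv|w aw sw].
- by rewrite !linear0 addr0; case: lsub_Ker.
- rewrite (linearP p) (linearP lift) opprD addrACA -scalerBr.
  by case: lsub_Ker => _; apply.
rewrite pE; have [aD|nD] := boolP (adm SD w).
  by rewrite /lift lina_ee // subrr; case: lsub_Ker.
rewrite (ee_nadm nD) linear0 subr0.
move: nD; rewrite /= /admD aw /= negb_and -!ltnNge => /orP[s4|dn].
  exists (eF w), 0; split; [exact: eF_prods4|by move=> i _; rewrite linear0|].
  by rewrite addr0.
exists 0, (eF w); split; last by rewrite add0r.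
  by case: (prods_subspace (@pos AF) 4).
by move=> i hi; rewrite /= acomp_ee gtn_eqF // (leq_ltn_trans hi).
Qed.

Lemma p_sp4 a : sp 4 a -> p a = 0.
Proof.
move=> ha; apply: (ha (fun a => p a = 0)) => [|w w4].
  by split=> [|c u v hu hv]; rewrite ?linear0 // linearP /= hu hv scaler0 addr0.
by rewrite pE ee_nadm //= /admD (leqNgt (size w)) w4 andbF.
Qed.

Lemma AD_deg (b : AD) i : (7 * q - 3 < i)%N -> comp AD i b = 0.
Proof.
move=> hi; elim/gee_ind: b => [|c u v hu hv|w aw _].
- by rewrite linear0.
- by rewrite linearP /= hu hv scaler0 addr0.
rewrite /= acomp_ee ltn_eqF // (leq_ltn_trans _ hi) //.
by case/and3P: aw.
Qed.

Lemma p_Ker a : p a = 0 <-> Ker a.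
Proof.
split=> [pa|[b [c [hb hc ->]]]]; first by have := lift_p a; rewrite pa linear0 subr0.
rewrite linearD /= (p_sp4 (sp_prods (@degSF_pos _ q_odd q_ge3) hb)) add0r.
apply: (@comp_ext AD) => i; rewrite linear0; have [hi|hi] := leqP i (7 * q - 3).
  by rewrite -ghom_comp hc // linear0.
exact: AD_deg.
Qed.

Lemma p_surj b : p (lift b) = b.
Proof.
elim/gee_ind: b => [|c u v hu hv|w aw sw].
- by rewrite !linear0.
- by rewrite !linearP /= hu hv.
by rewrite /lift lina_ee // pE.
Qed.

Variable dF : {linear AF -> AF}.
Hypothesis hdF : derivation dF.
Hypothesis dFl : forall i, dF (eF [:: i]) = oapp eF 0 (dletter i).

Lemma dF_sp k a : sp k a -> sp k (dF a).
Proof.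
have [s0 sl] := lsub_sp SF k.
move=> ha; apply: (ha (fun a => sp k (dF a))) => [|w kw].
  by split=> [|c u v hu hv]; rewrite ?linear0 // linearP; apply: sl.
have h : sp (size w).+1 (dF (eF w)).
  apply: sp_der => // i; rewrite dFl.
  by case: i => [|[|[|[|[|[|i]]]]]]; rewrite /dletter /= ?nth_nil;
    (exact: sp_ee || case: (lsub_sp SF 2)).
by move=> Y hY hw; apply: h => // v lv; apply: hw; apply: leq_trans lv; apply: leqW.
Qed.

Lemma p_dF a : Ker a -> p (dF a) = 0.
Proof.
move=> [b [c [hb hc ->]]]; rewrite !linearD /=.
rewrite (p_sp4 (dF_sp (sp_prods (@degSF_pos _ q_odd q_ge3) hb))) add0r.
apply: (@comp_ext AD) => i; rewrite linear0; have [hi|hi] := leqP i (7 * q - 3).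
  apply: etrans (esym (ghom_comp p i (dF c))) _.
  case: i hi => [|i] hi; first by rewrite der_comp0 ?linear0.
  by rewrite -der_comp // hc ?linear0 // ltnW.
exact: AD_deg.
Qed.

(** Since [dF] preserves the kernel of [p], the choice of section does not matter ([dD_p]), and the
    Leibniz rule descends from F. *)
Definition dD (b : AD) : AD := p (dF (lift b)).
Lemma dD_linear : linear dD.
Proof. by move=> c u v; rewrite /dD !linearP. Qed.
HB.instance Definition _ := GRing.isLinear.Build rat AD AD *:%R dD dD_linear.

Lemma dD_p a : dD (p a) = p (dF a).
Proof.
apply/eqP; rewrite -subr_eq0 -opprB oppr_eq0 -!linearB /=.
by rewrite p_dF //; apply: lift_p.
Qed.

Lemma dD_der : derivation dD.
Proof.
split=> [i a ha|i a b ha].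
  have e : p (comp AF i (lift a)) = a by rewrite ghom_comp p_surj.
  by rewrite -e dD_p; apply/ghom_homog/(der_homog hdF)/homog_comp.
have e : p (comp AF i (lift a)) = a by rewrite ghom_comp p_surj.
rewrite -e -(p_surj b) -rmorphM !dD_p (derM hdF _ (homog_comp _ _)).
by rewrite linearD linearZ !rmorphM.
Qed.

Lemma dD_letter i : dD (eD [:: i]) = oapp eD 0 (dletter i).
Proof.
rewrite -pE dD_p dFl; case: (dletter i) => [w|] /=; first by rewrite pE.
by rewrite linear0.
Qed.

Lemma dF_12 : dF (eF [:: 1; 2]%N) = 0.
Proof.
rewrite ee_cons (derM hdF _ (homog_letter SF 1)) !dFl /=.
by rewrite mul0r mulr0 scaler0 addr0.
Qed.

Lemma dF_320 : dF (eF [:: 3; 2; 0]%N) = 0.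
Proof.
rewrite (ee_cons SF 3) (derM hdF _ (homog_letter SF 3)) dFl /= -ee_cat.
rewrite (@ee_nadm SF [:: 1; 2; 2; 0]%N) // add0r.
rewrite (ee_cons SF 2 [:: 0%N]) (derM hdF _ (homog_letter SF 2)) !dFl /=.
by rewrite mul0r mulr0 scaler0 addr0 mulr0 scaler0.
Qed.

Lemma dD_sq b : dD (dD b) = 0.
Proof.
apply: (der_sq_words (d := dD)) => [|i _]; first exact: dD_der.
rewrite /= dD_letter; case: i => [|[|[|[|[|[|i]]]]]]; rewrite /dletter /= ?nth_nil;
  try exact: linear0.
- by rewrite -pE dD_p dF_12 linear0.
- by rewrite -pE dD_p dF_320 linear0.
(* The letter r, where d^2 = 0 depends on the truncation: the remaining word x a y s has four
   letters. *)
rewrite -pE dD_p ee_cons (derM hdF _ (homog_letter SF 1)) !dFl /=.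
rewrite mul0r add0r linearZ /= -ee_cat pE ee_nadm ?scaler0 //.
Qed.

Lemma degSD_pos i : adm SD [:: i] -> (0 < deg SD i)%N.
Proof. by case/and3P => /degSF_pos. Qed.

Definition Dq : cdga :=
  @Cdga AD (dD : {linear AD -> AD}) dD_der dD_sq (galg_conn degSD_pos).

Lemma Dq_is_Dq : is_Dq q ([seq eD [:: i] | i <- iota 0 5] : seq Dq).
Proof.
exists AF, dF, (eF [:: 0%N]), (eF [:: 1%N]), (eF [:: 2%N]), (eF [:: 3%N]),
  (eF [:: 4%N]), (eF [:: 5%N]), p; split=> //.
- exact: (free_gens_letters (parsFE q_odd q_ge3)).
- by rewrite !dFl /= -!ee_cat.
split=> [b|a|a|]; [by exists (lift b); apply: p_surj|exact: p_Ker| |].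
  by rewrite /= dD_p.
by rewrite /= !pE.
Qed.
End Proj.

Section ModelP.
Variable dP : {linear AP -> AP}.
Hypothesis hdP : derivation dP.
Hypothesis dPl : forall i,
  dP (eP [:: i]) = if (i < 5)%N then oapp eP 0 (dletter i) else 0.

Lemma dP_sq a : dP (dP a) = 0.
Proof.
apply: (der_sq_words hdP) => i _; rewrite dPl.
case: i => [|[|[|[|[|i]]]]] //=; rewrite ?linear0 //.
- rewrite ee_cons (derM hdP _ (homog_letter SP 1)) !dPl /=.
  by rewrite mul0r mulr0 scaler0 addr0.
rewrite (ee_cons SP 3) (derM hdP _ (homog_letter SP 3)) dPl /= -ee_cat.
rewrite (@ee_nadm SP [:: 1; 2; 2; 0]%N) // add0r.
rewrite (ee_cons SP 2 [:: 0%N]) (derM hdP _ (homog_letter SP 2)) !dPl /=.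
by rewrite mul0r mulr0 scaler0 addr0 mulr0 scaler0.
Qed.

Definition Pq : cdga := Cdga hdP dP_sq (galg_conn (@degSP_pos q q_odd q_ge3)).

Lemma Pq_is_Pq : is_Pq q ([seq eP [:: i] | i <- iota 0 5] : seq Pq).
Proof.
exists (eP [:: 0%N]), (eP [:: 1%N]), (eP [:: 2%N]), (eP [:: 3%N]), (eP [:: 4%N]).
split=> //=; try by rewrite !dPl /= -?ee_cat.
exact: (free_gens_letters (parsPE q_odd q_ge3)).
Qed.
End ModelP.
End Concrete.

(** * A universal supply of generators *)

Section Pool.
Variable q : nat.
Hypothesis q_odd : odd q.
Hypothesis q_ge3 : (3 <= q)%N.

(* A pool of generators in which [0, ..., 4] stand for s, x, y, a, t and
   [code k i], for i = 0, 1, ..., have degree k; the model uses some of them. *)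
Definition code (k i : nat) : nat := (5 + choice.pickle (k, i))%N.
Definition decode (j : nat) : nat * nat := odflt (0, 0)%N (choice.unpickle (j - 5)).
Definition degU (j : nat) : nat :=
  if (j < 5)%N then nth 0%N (degsP q) j else (decode j).1.

Lemma codeK k i : decode (code k i) = (k, i).
Proof. by rewrite /decode /code addKn choice.pickleK. Qed.

Lemma degU_code k i : degU (code k i) = k.
Proof. by rewrite /degU codeK. Qed.

Lemma parUE j : odd (degU j) = odd (degU j). Proof. by []. Qed.
(** With letters of degree at least 2, a word of degree n has at most n / 2 letters. This gives
    finite type, and it leaves no room for a second letter beside a new one in the inductive
    step. *)
Definition SU := freeS (fun j => 2 <= degU j)%N parUE.
Local Notation U := (galg SU).
Local Notation eU := (@ee SU).
Implicit Types u : pred nat.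

Lemma degU_small j : (j < 5)%N -> (q <= degU j < 5 * q - 1)%N.
Proof.
rewrite /degU => h; rewrite h; case: j h => [|[|[|[|[|j]]]]] //= _; lia.
Qed.

(** The subalgebra on the letters of [u], kept as a predicate: all stages share the type [U], so
    enlarging [u] is an inclusion and the limit is a union. *)
Definition lam (u : pred nat) (a : U) : Prop := forall Y : U -> Prop, lsub Y ->
  (forall w, all u w -> Y (eU w)) -> Y a.

Lemma lsub_lam u : lsub (lam u).
Proof.
split=> [Y [Y0 _] _ //|c a b ha hb Y hY hw].
by case: (hY) => _; apply; [apply: ha|apply: hb].
Qed.

Lemma lam_ee u w : all u w -> lam u (eU w).
Proof. by move=> uw Y _; apply. Qed.

Lemma lam_sub (u v : pred nat) a : (forall i, u i -> v i) -> lam u a -> lam v a.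
Proof.
by move=> uv; apply; [exact: lsub_lam|move=> w /(sub_all uv); apply: lam_ee].
Qed.

Lemma lam_homog u n (a : U) (Y : U -> Prop) : lsub Y -> lam u a -> homog n a ->
  (forall w, adm SU w -> sorted leq w -> all u w -> degw SU w = n -> Y (eU w)) ->
  Y a.
Proof.
move=> hY ha <- hw.
apply: (ha (fun a => Y (comp U n a))) => [|w uw].
  split=> [|c v v' hv hv']; first by rewrite linear0; case: hY.
  by rewrite linearP; case: hY => _; apply.
rewrite /= acomp_ee; case: eqP => [e|_]; last by case: hY.
case: (boolP (adm SU w)) => aw; last by rewrite ee_nadm //; case: hY.
rewrite ee_sortE; apply: lsubZ => //; apply: hw.
- by rewrite (@adm_perm SU _ w) // perm_sort.
- exact: (sort_sorted leq_total).
- by rewrite all_sort.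
- by rewrite degw_sort.
Qed.

Lemma lam_mul u a b : lam u a -> lam u b -> lam u (a * b).
Proof.
have [s0 sl] := lsub_lam u; move=> ha hb.
apply: (ha (fun a => lam u (a * b))) => [|w uw].
  split=> [|c v v' hv hv']; first by rewrite mul0r.
  by rewrite mulrDl -scalerAl; apply: sl.
apply: (hb (fun b => lam u (eU w * b))) => [|v uv].
  split=> [|c v v' hv hv']; first by rewrite mulr0.
  by rewrite mulrDr -scalerAr; apply: sl.
by rewrite -ee_cat; apply: lam_ee; rewrite all_cat uw.
Qed.

Lemma ghom_lam u (B : gca) (f g : ghom U B) :
  (forall i, u i -> f (eU [:: i]) = g (eU [:: i])) ->
  forall a, lam u a -> f a = g a.
Proof.
move=> fg a ha; apply: (ha (fun a => f a = g a)) => [|w].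
  by split=> [|c v v' hv hv']; rewrite ?linear0 // !linearP /= hv hv'.
elim: w => [|i w IH] /=; first by rewrite ee_nil !rmorph1.
by case/andP=> ui /IH e; rewrite ee_cons !rmorphM /= fg // e.
Qed.

Lemma der_lam u (d d' : {linear U -> U}) : derivation d -> derivation d' ->
  (forall i, u i -> d (eU [:: i]) = d' (eU [:: i])) ->
  forall a, lam u a -> d a = d' a.
Proof.
move=> hd hd' dd a ha; apply: (ha (fun a => d a = d' a)) => [|w].
  by split=> [|c v v' hv hv']; rewrite ?linear0 // !linearP /= hv hv'.
elim: w => [|i w IH] /=; first by rewrite ee_nil (der1 hd) (der1 hd').
case/andP=> ui /IH e; rewrite ee_cons (derM hd _ (homog_letter SU i)).
by rewrite (derM hd' _ (homog_letter SU i)) dd // e.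
Qed.

Lemma der_lam_closed u (d : {linear U -> U}) : derivation d ->
  (forall i, u i -> lam u (d (eU [:: i]))) -> forall a, lam u a -> lam u (d a).
Proof.
have [s0 sl] := lsub_lam u.
move=> hd hi a ha; apply: (ha (fun a => lam u (d a))) => [|w].
  by split=> [|c v v' hv hv']; rewrite ?linear0 // linearP; apply: sl.
elim: w => [|i w IH] /=; first by rewrite ee_nil (der1 hd).
case/andP=> ui uw; rewrite ee_cons (derM hd _ (homog_letter SU i)).
apply: (lsubD (lsub_lam u)); first by apply: lam_mul (hi i ui) (lam_ee uw).
apply: (lsubZ _ (lsub_lam u)); apply: lam_mul (IH uw).
by apply: lam_ee; rewrite /= ui.
Qed.

Lemma der_lam_sq u (d : {linear U -> U}) : derivation d ->
  (forall i, u i -> d (d (eU [:: i])) = 0) -> forall a, lam u a -> d (d a) = 0.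
Proof.
move=> hd hi a ha; apply: (ha (fun a => d (d a) = 0)) => [|w].
  by split=> [|c v v' hv hv']; rewrite ?linear0 // !linearP /= hv hv' scaler0 addr0.
elim: w => [|i w IH] /=; first by rewrite ee_nil (der1 hd) linear0.
case/andP=> ui uw; have hl := homog_letter SU i.
rewrite ee_cons (derM hd _ hl) linearD linearZ /=.
rewrite (derM hd _ (der_homog hd hl)) (derM hd _ hl) IH // hi //.
by rewrite mulr0 scaler0 mul0r add0r addr0 exprS mulN1r scaleNr addNr.
Qed.

Lemma der_lam_ghom u (B : gca) (f : ghom U B) (d : {linear U -> U})
    (dB : {linear B -> B}) : derivation d -> derivation dB ->
  (forall i, u i -> f (d (eU [:: i])) = dB (f (eU [:: i]))) ->
  forall a, lam u a -> f (d a) = dB (f a).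
Proof.
move=> hd hB hi a ha; apply: (ha (fun a => f (d a) = dB (f a))) => [|w].
  by split=> [|c v v' hv hv']; rewrite ?linear0 // !linearP /= hv hv'.
elim: w => [|i w IH] /=.
  by rewrite ee_nil (der1 hd) rmorph1 (der1 hB) linear0.
case/andP=> ui uw; rewrite ee_cons (derM hd _ (homog_letter SU i)) rmorphM.
rewrite (derM hB _ (ghom_homog f (homog_letter SU i))).
by rewrite linearD linearZ !rmorphM /= hi // IH.
Qed.

Fixpoint allwords (l : seq nat) (n : nat) : seq (seq nat) :=
  if n is m.+1 then [::] :: [seq i :: w | i <- l, w <- allwords l m] else [:: [::]].

Lemma allwordsP l n w : {subset w <= l} -> (size w <= n)%N -> w \in allwords l n.
Proof.
elim: n w => [|n IH] [|i w] //= wl sw; rewrite inE; apply/orP; right.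
apply/allpairsP; exists (i, w); split=> //=; first exact: (wl i (mem_head _ _)).
by apply: IH => // j jw; apply/wl/mem_behead.
Qed.

Lemma degw_size (u : pred nat) w : (forall i, u i -> (2 <= degU i)%N) -> all u w ->
  (2 * size w <= degw SU w)%N.
Proof.
move=> hu; elim: w => [|i w IH] //= /andP[/hu ui /IH h].
by rewrite degw_cons mulnS leq_add.
Qed.

Lemma degw_mem w i : i \in w -> (degU i <= degw SU w)%N.
Proof.
elim: w => // j w IH; rewrite inE degw_cons => /predU1P[->|/IH h].
  exact: leq_addr.
exact: leq_trans h (leq_addl _ _).
Qed.

Lemma lam_finite u l n : (forall i, u i -> (2 <= degU i)%N) ->
  (forall i, u i -> (degU i <= n)%N -> i \in l) ->
  forall a, lam u a -> homog n a -> lspan [seq eU w | w <- allwords l n] a.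
Proof.
move=> u2 ul a ha hn; apply: lam_homog (lsub_lspan _) ha hn _ => w _ _ uw dw.
apply/lspan_mem/map_f/allwordsP.
  move=> i iw; apply: ul; first exact: (allP uw).
  by rewrite -dw; apply: degw_mem.
by rewrite -dw; apply: leq_trans (degw_size u2 uw); rewrite leq_pmull.
Qed.
End Pool.

Lemma fst_sum (V W : lmodType rat) n (F : nat -> V * W) (c : nat -> rat) :
  (\sum_(i < n) c i *: F i).1 = \sum_(i < n) c i *: (F i).1.
Proof. by rewrite (big_morph fst (id1 := 0) (op1 := +%R)). Qed.

Lemma snd_sum (V W : lmodType rat) n (F : nat -> V * W) (c : nat -> rat) :
  (\sum_(i < n) c i *: F i).2 = \sum_(i < n) c i *: (F i).2.
Proof. by rewrite (big_morph snd (id1 := 0) (op1 := +%R)). Qed.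

(** * Killing the cohomology of the cone, one degree at a time *)

Section Tower.
Variable q : nat.
Hypothesis q_odd : odd q.
Hypothesis q_ge3 : (3 <= q)%N.
Local Notation SU := (SU q).
Local Notation degU := (degU q).
Local Notation U := (galg SU).
Local Notation eU := (@ee SU).
Local Notation lam := (@lam q).
Implicit Types u : pred nat.

Definition decomp u n (a : U) : Prop := forall Y : U -> Prop, lsub Y ->
  (forall w, all u w -> (2 <= size w)%N -> degw SU w = n -> Y (eU w)) -> Y a.

Lemma decomp_lam u n a : decomp u n a -> lam u a.
Proof. by apply; [exact: lsub_lam|move=> w uw _ _; apply: lam_ee]. Qed.

Lemma decomp_sub u (v : pred nat) n a : (forall i, u i -> v i) -> decomp u n a -> decomp v n a.
Proof.
move=> uv ha Y hY hw; apply: ha => // w uw; apply: hw.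
exact: sub_all uw.
Qed.

Variable D : cdga.

(* In degrees at most k + 1, the cone of f : Lambda(u) -> D has no cohomology. *)
Definition relacyclic k u (d : {linear U -> U}) (f : ghom U D) : Prop :=
  forall m z b, (m <= k)%N -> lam u z -> homog m.+1 z -> homog m b ->
    d z = 0 -> f z = diff D b ->
    exists w b', [/\ lam u w, d w = z & b = f w + diff D b'].

(** [d] and [f] are defined on all of U, but the conditions concern only [lam u]. The degree clause
    will put W in degrees at least 5q, [decomp] makes the model minimal, and the finite list keeps
    each degree finite-dimensional. *)
Definition stage k u (d : {linear U -> U}) (f : ghom U D) : Prop :=
  [/\ derivation d,
      forall i, u i -> [/\ (2 <= degU i)%N, (degU i <= k)%N
                         & (i < 5)%N || (5 * q <= degU i)%N],
      forall i, u i -> [/\ decomp u (degU i).+1 (d (eU [:: i])),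
        d (d (eU [:: i])) = 0 & f (d (eU [:: i])) = diff D (f (eU [:: i]))],
      exists l : seq nat, forall i, u i -> i \in l
    & relacyclic k u d f].

Lemma U_ghom (b : nat -> D) :
  (forall i, homog (degU i) (b i)) -> (forall i, ~~ (2 <= degU i)%N -> b i = 0) ->
  exists f : ghom U D, forall i, f (eU [:: i]) = b i.
Proof. exact: free_ghom. Qed.

Lemma U_der (b : nat -> U) :
  (forall i, homog (degU i).+1 (b i)) -> (forall i, ~~ (2 <= degU i)%N -> b i = 0) ->
  exists d : {linear U -> U}, derivation d /\ forall i, d (eU [:: i]) = b i.
Proof. exact: free_der. Qed.

Variable sD : seq D.
Hypothesis D_fin : forall b, lspan sD b.

Section Step.
Variables (k : nat) (u : pred nat) (d : {linear U -> U}) (f : ghom U D).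
Hypothesis kq : (5 * q - 1 <= k)%N.
Hypothesis hs : stage k u d f.

Let hd : derivation d. Proof. by case: hs. Qed.
Let u2 i : u i -> (2 <= degU i)%N. Proof. by case: hs => _ h _ _ _ /h[]. Qed.
Let uk i : u i -> (degU i <= k)%N. Proof. by case: hs => _ h _ _ _ /h[]. Qed.
Let dlam i : u i -> lam u (d (eU [:: i])).
Proof. by case: hs => _ _ h _ _ /h[/decomp_lam]. Qed.

Let T (x : U * D) : Prop :=
  [/\ lam u x.1, homog k.+2 x.1, homog k.+1 x.2, d x.1 = 0 & f x.1 = diff D x.2].
Let Y (x : U * D) : Prop :=
  exists w b', [/\ lam u w, x.1 = d w & x.2 = f w + diff D b'].

(* A basis of the degree k + 2 cohomology of the cone; its elements (z, b) become
   the new generators v of degree k + 1, with d v = z and f v = b. *)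
Lemma stage_basis : exists t : seq (U * D), [/\ forall x, x \in t -> T x,
    forall x, T x -> exists y, Y y /\ lspan t (x - y)
    & forall c : nat -> rat, Y (\sum_(i < size t) c i *: nth 0 t i) ->
        forall i, (i < size t)%N -> c i = 0].
Proof.
have [l hl] : exists l : seq nat, forall i, u i -> i \in l by case: hs.
have [s0 sl] := @lsub_lam q u.
pose s : seq (U * D) := [seq (x, 0) | x <- [seq eU w | w <- allwords l k.+2]] ++
  [seq (0, y) | y <- sD].
apply: (@complement _ s).
- split=> [|c [x1 x2] [y1 y2]]; first by split; rewrite ?linear0 //; apply: homog0.
  move=> [/= l1 h1 b1 d1 e1] [/= l2 h2 b2 d2 e2]; split=> /=.
  + exact: sl.
  + exact: homog_comb.
  + exact: homog_comb.
  + by rewrite linearP /= d1 d2 scaler0 addr0.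
  by rewrite !linearP /= e1 e2.
- split=> [|c [x1 x2] [y1 y2] [w [b [/= lw -> ->]]] [w' [b' [/= lw' -> ->]]]].
    by exists 0, 0; rewrite !linear0 addr0.
  exists (c *: w + w'), (c *: b + b'); split; first exact: sl.
    by rewrite /= linearP.
  by rewrite /= !linearP /= scalerDr addrACA.
move=> [z b] [/= lz hz hb _ _].
have -> : (z, b) = (z, 0) + (0, b) :> U * D by apply: pair_ext => /=; rewrite ?addr0 ?add0r.
have [l0 ll] := lsub_lspan s.
apply: (lsubD (lsub_lspan s)).
  have := @lam_finite q u l k.+2 u2 (fun i ui _ => hl i ui) z lz hz.
  apply: (lspan_sub (X := fun z => lspan s (z, 0))).
    split=> // c x y hx hy; have -> : (c *: x + y, 0) = c *: (x, 0) + (y, 0) :> U * D.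
      by apply: pair_ext => //=; rewrite scaler0 addr0.
    exact: ll.
  by move=> x xs; apply: lspan_mem; rewrite mem_cat map_f.
apply: (lspan_sub (X := fun z => lspan s (0, z))) (D_fin b).
  split=> // c x y hx hy; have -> : (0, c *: x + y) = c *: (0, x) + (0, y) :> U * D.
    by apply: pair_ext => //=; rewrite scaler0 addr0.
  exact: ll.
by move=> x xs; apply: lspan_mem; rewrite mem_cat map_f ?orbT.
Qed.

(** Since the basis [t] spans the classes of degree k + 2, the new letters kill them all; since it
    is independent modulo boundaries, no combination of the new letters creates a class in degree k
    + 1. *)
Lemma stage_step : exists u' d' f', [/\ stage k.+1 u' d' f',
  forall i, u i -> [/\ u' i, d' (eU [:: i]) = d (eU [:: i])
                     & f' (eU [:: i]) = f (eU [:: i])]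
  & forall i, u' i -> (degU i <= k)%N -> u i].
Proof.
have [t [tT tS tI]] := stage_basis.
pose new := [seq code k.+1 i | i <- iota 0 (size t)].
have newP i : (i < size t)%N -> code k.+1 i \in new.
  by move=> hi; apply: map_f; rewrite mem_iota.
have newE j : j \in new -> exists2 i, (i < size t)%N & j = code k.+1 i.
  by move=> /mapP[i]; rewrite mem_iota => hi ->; exists i.
pose u' : pred nat := fun j => u j || (j \in new).
have new_deg j : j \in new -> degU j = k.+1.
  by move=> /newE[i _ ->]; apply: degU_code.
have newNu j : j \in new -> u j = false.
  by move=> /new_deg e; apply/negP => /uk; rewrite e ltnn.
have tTi i : T (nth 0 t i).
  have [hi|hi] := ltnP i (size t); first by apply/tT/mem_nth.
  rewrite nth_default //; split; rewrite /= ?linear0 //; try exact: homog0.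
  by case: (@lsub_lam q u).
pose b0 j := if u j then d (eU [:: j]) else
  if j \in new then (nth 0 t (decode j).2).1 else 0.
pose f0 j := if u j then f (eU [:: j]) else
  if j \in new then (nth 0 t (decode j).2).2 else 0.
have low_new j : ~~ (2 <= degU j)%N -> u j = false /\ (j \in new) = false.
  move=> h; split; apply/negP; first by move/u2; rewrite (negPf h).
  by move/new_deg => e; move: h; rewrite e; case: k kq q_ge3 => //; lia.
have [|j h|d' [hd' d'l]] := @U_der b0.
- move=> j; rewrite /b0; case: ifP => uj; first exact/(der_homog hd)/(homog_letter SU).
  case: ifP => jn; last exact: homog0.
  by rewrite new_deg //; case: (tTi (decode j).2).
- by rewrite /b0; have [-> ->] := low_new j h.
have [|j h|f' f'l] := @U_ghom f0.
- move=> j; rewrite /f0; case: ifP => uj; first exact/ghom_homog/(homog_letter SU).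
  case: ifP => jn; last exact: homog0.
  by rewrite new_deg //; case: (tTi (decode j).2).
- by rewrite /f0; have [-> ->] := low_new j h.
have uu' i : u i -> u' i by rewrite /u' => ->.
have d'u i : u i -> d' (eU [:: i]) = d (eU [:: i]) by move=> ui; rewrite d'l /b0 ui.
have f'u i : u i -> f' (eU [:: i]) = f (eU [:: i]) by move=> ui; rewrite f'l /f0 ui.
have d'lam := der_lam hd' hd d'u.
have f'lam := ghom_lam f'u.
have d'n i : (i < size t)%N -> d' (eU [:: code k.+1 i]) = (nth 0 t i).1.
  by move=> hi; rewrite d'l /b0 newNu ?newP // codeK.
have f'n i : (i < size t)%N -> f' (eU [:: code k.+1 i]) = (nth 0 t i).2.
  by move=> hi; rewrite f'l /f0 newNu ?newP // codeK.
have u'2 i : u' i -> (2 <= degU i)%N.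
  by case/orP => [/u2 //|/new_deg ->]; case: k kq q_ge3 => //; lia.
have hu1 i : u i -> decomp u (degU i).+1 (d (eU [:: i])) /\
    d (d (eU [:: i])) = 0 /\ f (d (eU [:: i])) = diff D (f (eU [:: i])).
  by case: hs => _ _ h _ _ /h[].
(* A new letter has degree k + 1 and every other letter at least 2, so up to degree k + 2 a new
   letter can only stand alone. *)
have words n w : (n <= k.+2)%N -> all u' w -> degw SU w = n ->
    all u w \/ exists i, [/\ (i < size t)%N, w = [:: code k.+1 i] & n = k.+1].
  move=> nk uw dw; case: (boolP (all u w)) => [|/allPn[j jw uj]]; first by left.
  right; have jn : j \in new by have := allP uw j jw; rewrite /u' (negPf uj).
  have [i hi ji] := newE j jn; exists i.
  have pw := perm_to_rem jw.
  have e1 : degw SU w = (k.+1 + degw SU (rem j w))%N.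
    by rewrite -(new_deg j jn) /degw (perm_big _ pw) big_cons.
  have e2 : all u' (rem j w) by have := uw; rewrite (perm_all _ pw) /= => /andP[].
  have h2 := degw_size u'2 e2.
  have s0 : size (rem j w) = 0%N.
    by apply/eqP; rewrite -leqn0; move: h2 nk; rewrite -dw e1;
      move: (size _) (degw _ _) => *; lia.
  have w1 : w = [:: j].
    move: pw; rewrite (size0nil s0) => /perm_small_eq; exact.
  split=> //; first by rewrite w1 ji.
  by rewrite -dw e1 (size0nil s0) degw_nil addn0.
have lam_down n z : (n <= k.+2)%N -> n != k.+1 -> lam u' z -> homog n z -> lam u z.
  move=> nk nk1 lz hz; apply: lam_homog (@lsub_lam q u) lz hz _ => w _ _ uw dw.
  have [h|[i [_ _ e]]] := words n w nk uw dw; first exact: lam_ee.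
  by rewrite e eqxx in nk1.
have [_ _ _ [l hl] hrel] := hs.
exists u', d', f'; split.
2: by move=> i ui; split; [exact: uu'|exact: d'u|exact: f'u].
2: by move=> i /orP[//|/new_deg ->]; rewrite ltnn.
split=> //.
- move=> i ui'; split; first exact: u'2.
    by case/orP: ui' => [/uk/leqW //|/new_deg ->].
  case/orP: ui' => [ui|/new_deg ->]; last by apply/orP; right; lia.
  by case: hs => _ /(_ i ui)[].
- move=> i /orP[ui|].
    have [h1 [h2 h3]] := hu1 i ui; rewrite d'u // f'u //.
    have ld := decomp_lam h1; split.
    + exact: (decomp_sub uu' h1).
    + by rewrite d'lam.
    by rewrite f'lam.
  move=> /[dup] inew /newE[i' hi' ei]; rewrite {}ei in inew *.
  rewrite d'n // f'n //; have [lz hz hb dz fz] := tTi i'; split.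
  + move=> Y0 hY0 hw; rewrite degU_code in hw.
    apply: lam_homog hY0 lz hz _ => w _ _ uw dw; apply: hw => //.
      exact: (sub_all uu' uw).
    (* A single letter here would have degree k + 2, but the letters of [u] have degree at most k;
       so the new differentials are decomposable. *)
    case: w uw dw => [|j [|]] //=; first by rewrite degw_nil.
    rewrite andbT degw_cons degw_nil addn0 => /uk h e.
    by move: h; rewrite -[degU j]/(deg SU j) e; lia.
  + by rewrite d'lam.
  by rewrite f'lam.
- exists (l ++ new) => i; rewrite mem_cat => /orP[/hl ->//|->].
  by rewrite orbT.
move=> m z b mk lz hz hb dz fz.
have old z0 w b' : lam u w -> d w = z0 -> b = f w + diff D b' ->
    exists w b', [/\ lam u' w, d' w = z0 & b = f' w + diff D b'].
  move=> lw dw eb; exists w, b'; rewrite d'lam // f'lam //; split=> //.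
  exact: (lam_sub uu' lw).
(* Here z has degree k + 1 and may contain new letters linearly. Being closed, it yields a
   combination of [t] that is a boundary of the old cone, so the coefficients vanish. *)
have [mk1|mk1] := eqVneq m.+1 k.+1.
  have mk' : m = k by case: mk1.
  subst m.
  have [z0 [c [lz0 hz0 ez]]] : exists z0 (c : nat -> rat), [/\ lam u z0, homog k.+1 z0
      & z = z0 + \sum_(i < size t) c i *: eU [:: code k.+1 i]].
    pose Z (z : U) := exists z0 (c : nat -> rat), [/\ lam u z0, homog k.+1 z0
      & z = z0 + \sum_(i < size t) c i *: eU [:: code k.+1 i]].
    have [s0 sl] := @lsub_lam q u.
    apply: (@lam_homog q u' k.+1 z Z) => //.
      split=> [|a _ _ [z1 [c1 [l1 h1 ->]]] [z2 [c2 [l2 h2 ->]]]].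
        exists 0, (fun=> 0); split=> //; first exact: homog0.
        by rewrite big1 ?addr0 // => i _; rewrite scale0r.
      exists (a *: z1 + z2), (fun i => a * c1 i + c2 i); split.
      - exact: sl.
      - exact: homog_comb.
      rewrite scalerDr addrACA scaler_sumr -big_split; congr (_ + _).
      by apply: eq_bigr => i _; rewrite /= scalerDl scalerA.
    move=> w _ _ uw dw; have [h|[i [hi -> _]]] := words k.+1 w (leqnSn _) uw dw.
      exists (eU w), (fun=> 0); split; [exact: lam_ee|by rewrite -dw; apply: homog_ee|].
      by rewrite big1 ?addr0 // => i _; rewrite scale0r.
    exists 0, (fun i' => (i' == i)%:R); split; [by []|exact: homog0|].
    rewrite add0r (bigD1 (Ordinal hi)) //= eqxx scale1r big1 ?addr0 // => i' ni.
    case: eqP => [e|]; last by rewrite scale0r.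
    by case/eqP: ni; apply: val_inj.
  have dz0 : d' z = d z0 + \sum_(i < size t) c i *: (nth 0 t i).1.
    rewrite ez linearD /= d'lam // linear_sum; congr (_ + _).
    by apply: eq_bigr => i _; rewrite linearZ /= d'n.
  have fz0 : f' z = f z0 + \sum_(i < size t) c i *: (nth 0 t i).2.
    rewrite ez linearD /= f'lam // linear_sum; congr (_ + _).
    by apply: eq_bigr => i _; rewrite linearZ /= f'n.
  have sum1 : (\sum_(i < size t) c i *: nth 0 t i).1 = \sum_(i < size t) c i *: (nth 0 t i).1.
    exact: fst_sum.
  have sum2 : (\sum_(i < size t) c i *: nth 0 t i).2 = \sum_(i < size t) c i *: (nth 0 t i).2.
    exact: snd_sum.
  have c0 i : (i < size t)%N -> c i = 0.
    apply: tI; exists (- z0), b; split.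
    - by rewrite -scaleN1r; apply: (lsubZ _ (@lsub_lam q u)).
    - by rewrite sum1 linearN /=; apply/eqP; rewrite -addr_eq0 addrC -dz0 dz.
    by rewrite sum2 linearN /= -fz fz0 addKr.
  have ez0 : z = z0.
    by rewrite ez big1 ?addr0 // => i _; rewrite c0 ?scale0r.
  rewrite ez0 in lz hz dz fz *.
  rewrite d'lam // in dz; rewrite f'lam // in fz.
  have [w [b' [lw dw eb]]] := hrel k z0 b (leqnn k) lz0 hz0 hb dz fz.
  exact: (old _ _ _ lw dw eb).
have lz0 : lam u z by apply: lam_down lz hz => //; rewrite ltnS.
have [mk2|mk2] := leqP m k.
  rewrite d'lam // in dz; rewrite f'lam // in fz.
  have [w [b' [lw dw eb]]] := hrel m z b mk2 lz0 hz hb dz fz.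
  exact: (old _ _ _ lw dw eb).
(* Here z has degree k + 2 and contains no new letter, so (z, b) is a class of the old cone, killed
   by a combination of the new letters. *)
have em : m = k.+1 by apply/eqP; rewrite eqn_leq mk.
subst m.
have [|y [[w [b' [lw y1 y2]]] /lspanP[c ec]]] := tS (z, b).
  by split=> //=; [rewrite -d'lam|rewrite -f'lam].
have e1 := congr1 fst ec; rewrite fst_sum /= in e1.
have e2 := congr1 snd ec; rewrite snd_sum /= in e2.
exists (w + \sum_(i < size t) c i *: eU [:: code k.+1 i]), b'; split.
- apply: (lsubD (@lsub_lam q u')); first exact: (lam_sub uu' lw).
  apply: (lsub_sum _ (@lsub_lam q u')) => i _; apply: (lsubZ _ (@lsub_lam q u')).
  by apply: lam_ee; rewrite /= /u' newP ?orbT.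
- rewrite linearD linear_sum /= d'lam // -y1.
  under eq_bigr => i _ do rewrite linearZ /= d'n //.
  by rewrite -e1 addrC subrK.
rewrite linearD linear_sum /= f'lam //.
under eq_bigr => i _ do rewrite linearZ /= f'n //.
by rewrite -e2 addrAC -y2 addrC subrK.
Qed.
End Step.
End Tower.

Lemma dependent_choice (T : Type) (P : nat -> T -> Prop) (R : nat -> T -> T -> Prop)
    (t0 : T) : P 0%N t0 ->
  (forall n t, P n t -> exists t', P n.+1 t' /\ R n t t') ->
  exists s : nat -> T,
    [/\ s 0%N = t0, forall n, P n (s n) & forall n, R n (s n) (s n.+1)].
Proof.
move=> P0 step.
pose next n (x : {t | P n t}) : {t | P n.+1 t} :=
  let y := cid (step n (sval x) (svalP x)) in exist _ (sval y) (svalP y).1.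
pose s := fix s n : {t | P n t} := if n is m.+1 then next m (s m) else exist _ t0 P0.
exists (fun n => sval (s n)); split=> // n; first exact: (svalP (s n)).
exact: (svalP (cid (step n (sval (s n)) (svalP (s n))))).2.
Qed.

(** * The starting stage, with the generators of P_q *)

Section Base.
Variable q : nat.
Hypothesis q_odd : odd q.
Hypothesis q_ge3 : (3 <= q)%N.
Local Notation SF := (SF q_odd q_ge3).
Local Notation SP := (SP q_odd q_ge3).
Local Notation SD := (SD q_odd q_ge3).
Local Notation SU := (SU q).
Local Notation degU := (degU q).
Local Notation AF := (galg SF).
Local Notation AD := (galg SD).
Local Notation U := (galg SU).
Local Notation eF := (@ee SF).
Local Notation eD := (@ee SD).
Local Notation eU := (@ee SU).
Local Notation lam := (@lam q).
Variables (p : ghom AF AD) (dF : {linear AF -> AF}).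
Hypothesis pE : forall w, p (eF w) = eD w.
Hypothesis hdF : derivation dF.
Hypothesis dFl : forall i, dF (eF [:: i]) = oapp eF 0 (dletter i).
Local Notation D := (Dq pE hdF dFl).

Lemma D_finite b : lspan [seq eD w | w <- allwords (iota 0 6) 3] (b : AD).
Proof.
have [s0 sl] := lsub_lspan [seq eD w | w <- allwords (iota 0 6) 3].
elim/gee_ind: b => // w /and3P[/andP[_ w6] sw _] _.
apply/lspan_mem/map_f/allwordsP => // i iw.
by rewrite mem_iota; apply: (allP w6).
Qed.

Lemma eU_dup i w : odd (degU i) -> (1 < count_mem i w)%N -> eU w = 0.
Proof.
move=> oi ci; apply: ee_nadm => /=; apply/negP => /andP[/oddfreeP/(_ i oi)].
by rewrite leqNgt ci.
Qed.

Lemma odd_degU i : (i < 4)%N -> odd (degU i).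
Proof.
rewrite /degU => hi; rewrite (leq_trans hi) //.
by case: i hi => [|[|[|[|i]]]] //= _; rewrite oddB ?oddM //; lia.
Qed.

Lemma low_words w : adm SU w -> all (fun i => i < 5)%N w ->
  adm SP w /\ degw SU w = degw SP w.
Proof.
move=> /andP[ow _] w5; have dE i : i \in w -> degU i = nth 0%N (degsP q) i.
  by move=> /(allP w5) hi; rewrite /degU hi.
split; last by rewrite /degw; apply: eq_big_seq.
apply/andP; split=> //; apply: etrans ow; apply: eq_in_all => i iw.
by rewrite dE // (parsPE q_odd q_ge3).
Qed.

Lemma SP_SF w : adm SP w -> adm SF w /\ degw SP w = degw SF w.
Proof.
move=> /andP[/oddfreeP ow w5].
have l5 i : i \in w -> (i < 5)%N by move/(allP w5).
have dE i : i \in w -> nth 0%N (degsF q) i = nth 0%N (degsP q) i.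
  by move/l5; case: i => [|[|[|[|[|i]]]]].
split; last by rewrite /degw; apply: eq_big_seq => i /dE.
apply/andP; split.
  apply/allP => i iw; apply/implyP => pi; apply: ow; move: pi.
  by move/l5: iw; case: i => [|[|[|[|[|i]]]]].
by apply: sub_all w5 => i /= h; apply: leq_trans h _.
Qed.

Definition u0 : pred nat := fun i => (i < 5)%N.

Lemma degwU_12 : degw SU [:: 1; 2]%N = (degU 3).+1.
Proof. by rewrite !degw_cons degw_nil /= /degU /=; lia. Qed.

Lemma degwU_320 : degw SU [:: 3; 2; 0]%N = (degU 4).+1.
Proof. by rewrite !degw_cons degw_nil /= /degU /=; lia. Qed.

Lemma degwU_14 : degw SU [:: 1; 4]%N = (5 * q - 2)%N.
Proof. by rewrite !degw_cons degw_nil /= /degU /=; lia. Qed.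

Lemma base_exists : exists (d : {linear U -> U}) (f : ghom U D),
  [/\ derivation d,
      forall i, (i < 5)%N -> d (eU [:: i]) = oapp eU 0 (dletter i)
    & forall i, (i < 5)%N -> f (eU [:: i]) = eD [:: i]].
Proof.
have low i : ~~ (2 <= degU i)%N -> (i < 5)%N = false.
  by move=> h; apply/negP => /(degU_small q_odd q_ge3); lia.
have [i|i h|d [hd dl]] := @U_der q (fun i => if (i < 5)%N then oapp eU 0 (dletter i) else 0).
- case: i => [|[|[|[|[|i]]]]] //=; try exact: homog0.
    by rewrite -degwU_12; apply: homog_ee.
  by rewrite -degwU_320; apply: homog_ee.
- by rewrite low.
have [i|i h|f fl] := @U_ghom q D (fun i => if (i < 5)%N then eD [:: i] else 0).
- case: ifP => hi; last exact: homog0.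
  have -> : degU i = deg SD i.
    by rewrite /degU hi; case: i hi => [|[|[|[|[|i]]]]].
  exact: homog_letter.
- by rewrite low.
exists d, f; split=> // i hi; first by rewrite dl hi.
by rewrite fl hi.
Qed.

Section BaseStage.
Variables (d : {linear U -> U}) (f : ghom U D).
Hypothesis hd : derivation d.
Hypothesis dl : forall i, (i < 5)%N -> d (eU [:: i]) = oapp eU 0 (dletter i).
Hypothesis fl : forall i, (i < 5)%N -> f (eU [:: i]) = eD [:: i].
Local Notation X := (eU [:: 1; 3; 2; 0]%N).

Lemma f_word w : all u0 w -> f (eU w) = eD w.
Proof.
elim: w => [|i w IH /= /andP[hi /IH e]]; first by rewrite !ee_nil rmorph1.
by rewrite (ee_cons SU i w) (ee_cons SD i w) rmorphM /= fl // e.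
Qed.

Lemma d_12 : d (eU [:: 1; 2]%N) = 0.
Proof.
rewrite ee_cons (derM hd _ (homog_letter SU 1)) !dl //=.
by rewrite mul0r mulr0 scaler0 addr0.
Qed.

Lemma d_320 : d (eU [:: 3; 2; 0]%N) = 0.
Proof.
rewrite (ee_cons SU 3) (derM hd _ (homog_letter SU 3)) dl //= -ee_cat.
rewrite (@eU_dup 2 [:: 1; 2; 2; 0]%N) ?odd_degU // add0r.
rewrite (ee_cons SU 2 [:: 0%N]) (derM hd _ (homog_letter SU 2)) !dl //=.
by rewrite mul0r mulr0 scaler0 addr0 mulr0 scaler0.
Qed.

Lemma d_14 : d (eU [:: 1; 4]%N) = - X.
Proof.
rewrite ee_cons (der_oddM hd _ (homog_letter SU 1)) ?odd_degU // !dl //=.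
by rewrite mul0r sub0r -ee_cat.
Qed.

Lemma d_X : d X = 0.
Proof.
rewrite (ee_cons SU 1) (derM hd _ (homog_letter SU 1)) dl //= d_320.
by rewrite mul0r mulr0 scaler0 addr0.
Qed.

Lemma X_neq0 : X != 0.
Proof.
apply/eqP => /(congr1 (cf SU [:: 0; 1; 2; 3]%N)); rewrite linear0 cf_ee //=; last first.
  apply/andP; split; last by rewrite /= /degU /= ; lia.
  by apply/oddfreeP => i _ /=; case: i => [|[|[|[|i]]]].
by move/eqP; rewrite expf_eq0 oppr_eq0 oner_eq0 andbF.
Qed.

(** In this range r can occur only alone, because r times another letter has degree at least 6q - 3
    > 5q - 1. *)
Lemma base_target m b : (m <= 5 * q - 1)%N -> homog m (b : AD) ->
  exists (w : U) (c : rat), [/\ lam u0 w, homog m w, b = f w + c *: eD [:: 5%N]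
    & m = (5 * q - 3)%N \/ c = 0].
Proof.
move=> hm hb; pose Y (b : AD) :=
  exists (w : U) (c : rat), [/\ lam u0 w, homog m w, b = f w + c *: eD [:: 5%N]
    & m = (5 * q - 3)%N \/ c = 0].
have [s0 sl] := @lsub_lam q u0.
apply: (@sp_homog SD 0 m b Y) => //.
- split=> [|k _ _ [w [c [lw hw -> hc]]] [w' [c' [lw' hw' -> hc']]]].
    exists 0, 0; split=> //; [exact: homog0| |by right].
    by rewrite linear0 scale0r addr0.
  exists (k *: w + w'), (k * c + c'); split; [exact: sl|exact: homog_comb| |].
    by rewrite linearP scalerDr addrACA scalerDl scalerA.
  case: hc => [|->]; first by left.
  by case: hc' => [|->]; [left|right; rewrite mulr0 addr0].
- have [t0 tl] := lsub_sp SD 0.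
  by elim/gee_ind: {hb} b => // v _ _; apply: sp_ee.
move=> w /and3P[aw s3 _] sw _ dw.
case: (boolP (5%N \in w)) => [w5|nw5].
  have pw := perm_to_rem w5.
  have e1 : degw SD w = (5 * q - 3 + degw SD (rem 5%N w))%N.
    by rewrite /degw (perm_big _ pw) big_cons.
  have s0' : size (rem 5%N w) = 0%N.
    apply/eqP; rewrite -leqn0 leqNgt; apply/negP => spos.
    have a' : adm SF (rem 5%N w).
      apply: (@adm_catr SF [:: 5%N]); rewrite -(@adm_perm SF w) //.
    case: (rem 5%N w) spos e1 a' => // i v _ e1 /andP[_ /= /andP[i6 _]].
    move: e1; rewrite degw_cons; move: i i6 => [|[|[|[|[|[|i]]]]]] //= _; lia.
  have w1 : w = [:: 5%N].
    by move: pw; rewrite (size0nil s0') => /perm_small_eq; apply.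
  exists 0, 1; split=> //; [exact: homog0|by rewrite linear0 add0r scale1r w1|].
  by left; rewrite -dw e1 (size0nil s0') degw_nil addn0.
have w5 : all u0 w.
  apply/allP => i iw; have /andP[_ /allP/(_ i iw)] := aw.
  by rewrite ltnS leq_eqVlt => /predU1P[e|//]; rewrite -e iw in nw5.
exists (eU w), 0; split; [exact: lam_ee| |by rewrite f_word // scale0r addr0|by right].
have <- : degw SU w = m; last exact: homog_ee.
rewrite -dw /degw; apply: eq_big_seq => i /(allP w5) hi.
rewrite /= /degU; rewrite /u0 in hi; rewrite hi.
by case: i hi => [|[|[|[|[|i]]]]].
Qed.

(** The degree truncation of D is not reached, so only words of length at least 4 die. Of these, up
    to order, only x a y s has degree at most 5q. *)
Lemma base_source n z : (n <= 5 * q)%N -> lam u0 z -> homog n z -> f z = 0 ->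
  exists c : rat, z = c *: X.
Proof.
move=> hn lz hz fz; pose g : {linear AD -> U} := @lina SD U eU.
suff [c e] : exists c : rat, z = g (f z) + c *: X.
  by exists c; rewrite {1}e fz linear0 add0r.
pose Y z := exists c : rat, z = g (f z) + c *: X.
apply: (@lam_homog q u0 n z Y) => //.
  split=> [|k a b [c ec] [c' ec']]; first by exists 0; rewrite !linear0 scale0r addr0.
  exists (k * c + c'); rewrite {1}ec {1}ec' !linearP /= scalerDl -scalerA.
  by rewrite scalerDr addrACA.
move=> w aw sw w5 dw; have [aP dP] := low_words aw w5.
have [s3|s4] := leqP (size w) 3.
  have [aF dF'] := SP_SF aP.
  exists 0; rewrite scale0r addr0 f_word // /g lina_ee //.
  by rewrite /= /admD aF s3 -dF' -dP dw; lia.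
have [c0 [c1 [c2 [c3 [c4 [[w0 w1 w2 w3 w4] hc e1 e2]]]]]] := SP_counts aP.
rewrite -dP dw in e1; rewrite {}e2 in s4.
have [v0 v1 v2 v3 v4] : [/\ c0 = 1, c1 = 1, c2 = 1, c3 = 1 & c4 = 0]%N.
  have := t_count q_odd q_ge3 c4; clear w0 w1 w2 w3 w4.
  case=> [h|[h|h]]; try subst c4; last by exfalso; lia.
  - case: hc => h0 [h1 [h2 h3]]; move: h0 h1 h2 h3 e1 s4;
    case: c0 => [|[|?]] //; case: c1 => [|[|?]] //; case: c2 => [|[|?]] //;
    case: c3 => [|[|?]] //.
  - exfalso; case: hc => h0 [h1 [h2 h3]]; move: h0 h1 h2 h3 e1 s4;
    case: c0 => [|[|?]] //; case: c1 => [|[|?]] //; case: c2 => [|[|?]] //;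
    case: c3 => [|[|?]] //; rewrite !(mul0n, mul1n); lia.
have pw : perm_eq w [:: 1; 3; 2; 0]%N.
  apply: (perm_count w5) => //.
  by case=> [|[|[|[|[|i]]]]] // _; rewrite ?(w0, w1, w2, w3, w4) ?(v0, v1, v2, v3, v4).
exists ((-1) ^+ (inv (par SU) w + inv (par SU) [:: 1; 3; 2; 0]%N)).
rewrite -(ee_permE SU pw) f_word // (ee_nadm (S := SD)); last first.
  by rewrite /= /admD (leqNgt (size w)) (perm_size pw) andbF.
by rewrite linear0 add0r.
Qed.

(** In this range the two sides of the cone match except for r in D and X = x a y s in the source,
    and these cancel: d (x t) = - X, while f (x t) = d r. The bound 5q - 1 makes the first new
    generators have degree 5q. *)
Lemma base_stage : stage (5 * q - 1) u0 d f.
Proof.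
have [s0 sl] := @lsub_lam q u0.
have dlam i : u0 i -> decomp u0 (degU i).+1 (d (eU [:: i])).
  move=> ui; rewrite dl //.
  case: i ui => [|[|[|[|[|i]]]]] //= _ Y hY hw; case: (hY) => // Y0 _.
    by apply: hw => //; apply: degwU_12.
  by apply: hw => //; apply: degwU_320.
have dd i : u0 i -> d (d (eU [:: i])) = 0.
  move=> ui; rewrite dl //; case: i ui => [|[|[|[|[|i]]]]] //= _; try exact: linear0.
    exact: d_12.
  exact: d_320.
have fd i : u0 i -> f (d (eU [:: i])) = diff D (f (eU [:: i])).
  move=> ui; rewrite dl // fl // [RHS](dD_letter pE hdF dFl).
  case: i ui => [|[|[|[|[|i]]]]] //= _; try exact: linear0.
    exact: f_word.
  exact: f_word.
split=> //.
- move=> i ui; have := degU_small q_odd q_ge3 ui; split; [lia|lia|].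
  by rewrite /u0 in ui; rewrite ui.
- by move=> i ui; split; [exact: dlam|exact: dd|exact: fd].
- by exists (iota 0 5); move=> i ui; rewrite mem_iota.
move=> m z b hm lz hz hb dz fz.
have dclosed := der_lam_closed hd (fun i ui => decomp_lam (dlam i ui)).
have [w [c [lw hw eb hc]]] := base_target hm hb.
(* With b = f w + c r and d r = f (x t), this combination lies in the kernel of [f]. *)
pose z2 := z - d w - c *: eU [:: 1; 4]%N.
have lz2 : lam u0 z2.
  apply: (lsubB (@lsub_lam q u0)); last by apply: (lsubZ _ (@lsub_lam q u0)); apply: lam_ee.
  by apply: (lsubB (@lsub_lam q u0)) => //; apply: dclosed.
have hz2 : homog m.+1 z2.
  apply: homogB; first by apply: homogB => //; apply: (der_homog hd).
  case: hc => [em|->]; last by rewrite scale0r; apply: homog0.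
  apply: homogZ; have -> : m.+1 = degw SU [:: 1; 4]%N by rewrite degwU_14 em; lia.
  exact: homog_ee.
have fz2 : f z2 = 0.
  rewrite /z2 !linearB linearZ /= fz f_word //.
  rewrite (der_lam_ghom hd (diff_der D) fd lw) eb linearD linearZ /=.
  rewrite [dD _ _ (eD [:: 5%N])](dD_letter pE hdF dFl) /=.
  by rewrite [X in X - _]addrAC subrr add0r subrr.
have [|c' ez2] := base_source _ lz2 hz2 fz2; first by lia.
(* The boundary of [z2] is c X, but [z2] is a multiple of the cocycle X. *)
have c0 : c = 0.
  have : d z2 = 0 + c *: X.
    rewrite /z2 !linearB linearZ /= dz d_14 (der_lam_sq hd dd lw) subrr sub0r.
    by rewrite scalerN opprK add0r.
  rewrite ez2 linearZ /= d_X scaler0 add0r => /esym/eqP.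
  by rewrite scaler_eq0 (negPf X_neq0) orbF => /eqP.
exists (w - c' *: eU [:: 1; 4]%N), (c' *: eD [:: 5%N]); split.
- apply: (lsubB (@lsub_lam q u0)) => //.
  by apply: (lsubZ _ (@lsub_lam q u0)); apply: lam_ee.
- rewrite linearB linearZ /= d_14 scalerN opprK.
  by rewrite -ez2 /z2 c0 scale0r subr0 addrC subrK.
rewrite linearB !linearZ /= f_word //.
rewrite [dD _ _ (eD [:: 5%N])](dD_letter pE hdF dFl) /=.
by rewrite eb c0 scale0r addr0 -addrA -scalerDr addNr scaler0 addr0.
Qed.
End BaseStage.
End Base.

(** * The union of all stages *)

Section Limit.
Variable q : nat.
Hypothesis q_odd : odd q.
Hypothesis q_ge3 : (3 <= q)%N.
Local Notation SU := (SU q).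
Local Notation degU := (degU q).
Local Notation U := (galg SU).
Local Notation eU := (@ee SU).
Local Notation lam := (@lam q).
Implicit Types u : pred nat.
Variable D : cdga.
Variable sD : seq D.
Hypothesis D_fin : forall b, lspan sD b.

Definition complete_stage u (d : {linear U -> U}) (f : ghom U D) : Prop :=
  [/\ derivation d,
      forall i, u i -> (2 <= degU i)%N /\ ((i < 5)%N || (5 * q <= degU i)%N),
      forall i, u i -> [/\ decomp u (degU i).+1 (d (eU [:: i])),
        d (d (eU [:: i])) = 0 & f (d (eU [:: i])) = diff D (f (eU [:: i]))],
      forall n, exists l : seq nat, forall i, u i -> (degU i <= n)%N -> i \in l
    & forall k, relacyclic k u d f].

Lemma stage_limit u0 (d0 : {linear U -> U}) (f0 : ghom U D) :
  stage (5 * q - 1) u0 d0 f0 ->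
  exists u d f, complete_stage u d f /\ forall i, u0 i ->
    [/\ u i, d (eU [:: i]) = d0 (eU [:: i]) & f (eU [:: i]) = f0 (eU [:: i])].
Proof.
move=> st0; pose K n := (5 * q - 1 + n)%N.
pose T : Type := (pred nat * {linear U -> U} * ghom U D)%type.
pose P n (t : T) := stage (K n) t.1.1 t.1.2 t.2.
pose R n (t t' : T) :=
  (forall i, t.1.1 i -> [/\ t'.1.1 i, t'.1.2 (eU [:: i]) = t.1.2 (eU [:: i])
                     & t'.2 (eU [:: i]) = t.2 (eU [:: i])]) /\
  forall i, t'.1.1 i -> (degU i <= K n)%N -> t.1.1 i.
have [||s [s0 sP sR]] := @dependent_choice T P R (u0, d0, f0).
- by rewrite /P /K addn0.
- move=> n [[u d] f] st; have [|u' [d' [f' [st' h1 h2]]]] :=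
    @stage_step q q_odd q_ge3 D sD D_fin (K n) u d f _ st; first exact: leq_addr.
  by exists (u', d', f'); split=> //; rewrite /P /K addnS.
pose un n := (s n).1.1; pose dn n := (s n).1.2; pose fn n := (s n).2.
have mono n m i : un n i -> [/\ un (n + m)%N i,
    dn (n + m)%N (eU [:: i]) = dn n (eU [:: i])
    & fn (n + m)%N (eU [:: i]) = fn n (eU [:: i])].
  move=> ui; elim: m => [|m [h1 h2 h3]]; first by rewrite addn0.
  by rewrite addnS -h2 -h3; apply: (sR (n + m)%N).1.
have agree n m i : un n i -> un m i ->
    dn n (eU [:: i]) = dn m (eU [:: i]) /\ fn n (eU [:: i]) = fn m (eU [:: i]).
  move=> hn hm; have [_ <- <-] := mono n m i hn.
  by have [_ <- <-] := mono m n i hm; rewrite addnC.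
have down n m i : un (n + m)%N i -> (degU i <= K n)%N -> un n i.
  elim: m => [|m IH]; first by rewrite addn0.
  rewrite addnS => h hk; apply: IH => //; apply: (sR (n + m)%N).2 => //.
  by apply: leq_trans hk _; rewrite leq_add2l leq_addr.
pose u : pred nat := fun i => `[< exists n, un n i >].
have uP n i : u i -> (degU i <= K n)%N -> un n i.
  move=> /asboolP[m hm] hk; have [nm|/ltnW mn] := leqP n m.
    by apply: (down n (m - n)%N); rewrite ?subnKC.
  by rewrite -(subnKC mn); case: (mono m (n - m)%N i hm).
have unu n i : un n i -> u i by move=> h; apply/asboolP; exists n.
have udeg i : u i -> un (degU i) i by move=> ui; apply: (uP _ _ ui); apply: leq_addl.
have ulow i : ~~ (2 <= degU i)%N -> u i = false.
  move=> h; apply/negP => /udeg ui; have [_ hu _ _ _] := sP (degU i).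
  by have [h2 _ _] := hu i ui; rewrite h2 in h.
(* A letter of degree n that is ever used is present at stage n, so its values can be taken from
   there; later stages do not change them. *)
have [i|i h|d [hd dl]] := @U_der q (fun i => if u i then dn (degU i) (eU [:: i]) else 0).
- case: ifP => _; last exact: homog0.
  by have [h _ _ _ _] := sP (degU i); apply/(der_homog h)/(homog_letter SU).
- by rewrite ulow.
have [i|i h|f fl] := @U_ghom q D (fun i => if u i then fn (degU i) (eU [:: i]) else 0).
- case: ifP => _; last exact: homog0.
  exact/ghom_homog/(homog_letter SU).
- by rewrite ulow.
have du n i : un n i -> d (eU [:: i]) = dn n (eU [:: i]).
  move=> hn; have ui := unu n i hn; rewrite dl ui.
  by case: (agree (degU i) n i (udeg i ui) hn).
have fu n i : un n i -> f (eU [:: i]) = fn n (eU [:: i]).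
  move=> hn; have ui := unu n i hn; rewrite fl ui.
  by case: (agree (degU i) n i (udeg i ui) hn).
have hdn n : derivation (dn n) by case: (sP n).
have dlam n := der_lam hd (hdn n) (du n).
have flam n := ghom_lam (fu n).
exists u, d, f; split; last first.
  have e0 : (un 0%N = u0) * (dn 0%N = d0) * (fn 0%N = f0) by rewrite /un /dn /fn s0.
  by move=> i; rewrite -e0 => ui; rewrite (du 0%N i ui) (fu 0%N i ui) !e0 (unu 0%N).
have lam_un n z : lam u z -> homog n z -> lam (un n) z.
  move=> lz hz; apply: lam_homog (@lsub_lam q _) lz hz _ => w _ _ uw dw.
  apply: lam_ee; apply/allP => i iw; apply: uP; first exact: (allP uw).
  by apply: (leq_trans (@degw_mem q w i iw)); rewrite dw leq_addl.
split=> //.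
- move=> i /udeg ui; have [_ hu _ _ _] := sP (degU i).
  by have [h2 _ h5] := hu i ui.
- move=> i ui; have hi := udeg i ui; have [_ _ h _ _] := sP (degU i).
  have [hdec hdd hfd] := h i hi; have ld := decomp_lam hdec; split.
  + by rewrite (du _ _ hi); apply: (decomp_sub (unu (degU i)) hdec).
  + by rewrite (du _ _ hi) (dlam _ _ ld).
  by rewrite (du _ _ hi) (fu _ _ hi) (flam _ _ ld).
- move=> n; have [_ _ _ [l hl] _] := sP n; exists l => i ui hi.
  by apply/hl/(uP n) => //; apply: leq_trans hi _; apply: leq_addl.
move=> k m z b _ lz hz hb dz fz; have [_ _ _ _ hrel] := sP m.+1.
have lz' := lam_un _ _ lz hz.
have [|||w [b' [lw dw eb]]] := hrel m z b _ lz' hz hb.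
- by apply: leq_trans (leqnSn m) _; apply: leq_addl.
- by rewrite -dlam.
- by rewrite -flam.
exists w, b'; split; first exact: (lam_sub (unu m.+1) lw).
  by rewrite (dlam _ _ lw).
by rewrite (flam _ _ lw).
Qed.
End Limit.

(** * The resulting minimal Sullivan algebra *)

Section Model.
Variable q : nat.
Hypothesis q_odd : odd q.
Hypothesis q_ge3 : (3 <= q)%N.
Local Notation SP := (SP q_odd q_ge3).
Local Notation SU := (SU q).
Local Notation degU := (degU q).
Local Notation AP := (galg SP).
Local Notation U := (galg SU).
Local Notation eP := (@ee SP).
Local Notation eU := (@ee SU).
Local Notation lam := (@lam q).
Variables (D : cdga) (u : pred nat) (dU : {linear U -> U}) (f : ghom U D).
Hypothesis hst : complete_stage u dU f.
Hypothesis u5 : forall i, (i < 5)%N -> u i.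
Hypothesis dU5 : forall i, (i < 5)%N -> dU (eU [:: i]) = oapp eU 0 (dletter i).

Let hd : derivation dU. Proof. by case: hst. Qed.
Let u2 i : u i -> (2 <= degU i)%N. Proof. by case: hst => _ h _ _ _ /h[]. Qed.
Let hdec i : u i -> decomp u (degU i).+1 (dU (eU [:: i])).
Proof. by case: hst => _ _ h _ _ /h[]. Qed.
Let hdd i : u i -> dU (dU (eU [:: i])) = 0.
Proof. by case: hst => _ _ h _ _ /h[]. Qed.
Let hfd i : u i -> f (dU (eU [:: i])) = diff D (f (eU [:: i])).
Proof. by case: hst => _ _ h _ _ /h[]. Qed.

Lemma parME i : odd (degU i) = odd (degU i). Proof. by []. Qed.
Definition SM := freeS u parME.
Local Notation AM := (galg SM).
Local Notation eM := (@ee SM).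

Lemma eM_out i : ~~ u i -> eM [:: i] = 0.
Proof. by move=> h; apply: ee_nadm; rewrite /= (negPf h) /= andbF. Qed.

Lemma ghom_word (S S' : shape) (g : ghom (galg S) (galg S')) (v : pred nat) :
  (forall i, v i -> g (ee S [:: i]) = ee S' [:: i]) ->
  forall w, all v w -> g (ee S w) = ee S' w.
Proof.
move=> gl; elim=> [|i w IH] /=; first by rewrite !ee_nil rmorph1.
by case/andP=> vi /IH e; rewrite (ee_cons S i w) (ee_cons S' i w) rmorphM /= gl // e.
Qed.

(** The model has to be a type of its own, free on the letters of [u]. It is identified with [lam u]
    inside U: [pi] kills the other letters and [sg] is the inclusion. *)
Lemma transfer : exists (pi : ghom U AM) (sg : ghom AM U),
  [/\ forall w, pi (eU w) = eM w,
      forall w, all u w -> sg (eM w) = eU w,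
      forall a, pi (sg a) = a, forall a, lam u (sg a)
    & forall z, lam u z -> sg (pi z) = z].
Proof.
have [i|i h|pi pl] := @free_ghom degU (fun i => odd (degU i)) (fun j => 2 <= degU j)%N
    (parUE q) AM (fun i => eM [:: i]).
- exact: (homog_letter SM).
- by apply: eM_out; apply: contra h => /u2.
have [i|i h|sg sl] := @free_ghom degU (fun i => odd (degU i)) u parME U
    (fun i => if u i then eU [:: i] else 0).
- by case: ifP => _; [exact: (homog_letter SU)|exact: homog0].
- by rewrite (negPf h).
have sl' i : u i -> sg (eM [:: i]) = eU [:: i] by move=> ui; rewrite sl ui.
have sw := ghom_word sl'.
exists pi, sg; split=> //.
- by move=> w; apply: (@ghom_word _ _ pi predT (fun i _ => pl i)); apply: all_predT.
- move=> a; apply: (@ghom_letters SM _ (gcomp pi sg) (gid _)) => i /andP[_ /=].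
  by rewrite andbT => ui; rewrite sl' // pl.
- move=> a; have [s0 ssl] := @lsub_lam q u.
  elim/gee_ind: a => [|c a b ha hb|w /andP[_ uw] _].
  + by rewrite linear0.
  + by rewrite linearP; apply: ssl.
  by rewrite sw //; apply: lam_ee.
move=> z; apply: (ghom_lam (f := gcomp sg pi) (g := gid U)) => i ui /=.
by rewrite pl sl'.
Qed.

Section WithTransfer.
Variables (pi : ghom U AM) (sg : ghom AM U).
Hypothesis piw : forall w, pi (eU w) = eM w.
Hypothesis sgw : forall w, all u w -> sg (eM w) = eU w.
Hypothesis pisg : forall a, pi (sg a) = a.
Hypothesis sglam : forall a, lam u (sg a).
Hypothesis sgpi : forall z, lam u z -> sg (pi z) = z.

Let dclosed := der_lam_closed hd (fun i ui => decomp_lam (hdec ui)).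

Definition dM (a : AM) : AM := pi (dU (sg a)).
Lemma dM_linear : linear dM.
Proof. by move=> c a b; rewrite /dM !linearP. Qed.
HB.instance Definition _ := GRing.isLinear.Build rat AM AM *:%R dM dM_linear.

Lemma sg_dM a : sg (dM a) = dU (sg a).
Proof. by rewrite /dM sgpi //; apply: dclosed. Qed.

Lemma dM_der : derivation dM.
Proof.
split=> [i a ha|i a b ha]; first exact/ghom_homog/(der_homog hd)/ghom_homog.
rewrite /dM rmorphM (derM hd _ (ghom_homog sg ha)).
by rewrite linearD linearZ !rmorphM /= !pisg.
Qed.

Lemma dM_sq a : dM (dM a) = 0.
Proof. by rewrite {1}/dM sg_dM (der_lam_sq hd hdd (sglam a)) linear0. Qed.

Lemma degSM_pos i : adm SM [:: i] -> (0 < deg SM i)%N.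
Proof. by move=> /andP[_ /= /andP[/u2 h _]]; apply: leq_trans h. Qed.

Definition tower_cdga : cdga :=
  @Cdga AM (dM : {linear AM -> AM}) dM_der dM_sq (galg_conn degSM_pos).
Local Notation M := tower_cdga.

Lemma phiM_d a : (gcomp f sg) (diff M a) = diff D ((gcomp f sg) a).
Proof. by rewrite /= sg_dM (der_lam_ghom hd (diff_der D) hfd). Qed.
Definition phiM : dghom M D := @Dghom M D (gcomp f sg) phiM_d.

(** Acyclicity of the cone at (z, b) with f z = d b gives injectivity in cohomology, and at (0, b)
    surjectivity. *)
Lemma phiM_quasi : quasi_iso phiM.
Proof.
have [_ _ _ _ hrel] := hst.
have rel m (z : M) b : homog m.+1 z -> homog m b -> diff M z = 0 ->
    phiM z = diff D b -> exists w b', diff M w = z /\ b = phiM w + diff D b'.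
  move=> hz hb dz fz; have [||w [b' [lw dw eb]]] :=
      hrel m m (sg z) b (leqnn m) (sglam z) (ghom_homog sg hz) hb.
  - by rewrite -sg_dM [dM z]dz linear0.
  - exact: fz.
  exists (pi w), b'; rewrite /= /dM sgpi // dw pisg; split=> //.
split.
  move=> z [_ dz] /exactE[b eb]; apply/exactE.
  have [n ->] := comp_sum z; apply: (lsub_sum _ (lsub_exact M)) => i _.
  have di : diff M (comp M i z) = 0 by rewrite d_comp dz linear0.
  have fi : phiM (comp M i z) = comp D i (phiM z) by rewrite ghom_comp.
  (* Degree 0 is apart, as the cone condition concerns z of positive degree: there z is a scalar,
     and it vanishes because there are no nonzero boundaries in degree 0. *)
  case: {i} (nat_of_ord i) di fi => [|m] dm fm.
    have [c ec] := cdga_conn (homog_comp 0 z).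
    move: fm; rewrite -eb (der_comp0 (diff_der D)) ec linearZ /= !rmorph1.
    move/eqP; rewrite scaler_eq0 oner_eq0 orbF => /eqP ->.
    by exists 0; rewrite linear0 scale0r.
  have [w [b' [dw _]]] := rel m _ _ (homog_comp m.+1 z) (homog_comp m b) dm
    (etrans fm (etrans (congr1 _ (esym eb)) (esym (d_comp m b)))).
  by exists w.
move=> z' [_ dz'].
suff [z [dz /exactE h]] : exists z : M, diff M z = 0 /\ exact (z' - phiM z).
  by exists z; split.
have [n ez'] := comp_sum z'; rewrite ez'.
apply: (lsub_sum (X := fun b => exists z : M, diff M z = 0 /\ exact (b - phiM z))) => [|m _].
  have [e0_ el] := lsub_exact D.
  split=> [|c b b' [z [dz hz]] [z2 [dz2 hz2]]].
    by exists 0; rewrite !linear0 addr0.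
  exists (c *: z + z2); split; first by rewrite (linearP (diff M)) dz dz2 scaler0 addr0.
  by rewrite (linearP phiM) opprD addrACA -scalerBr; apply: el.
have [||w [b' [dw eb]]] := rel m 0 (comp D m z') (homog0 M m.+1) (homog_comp m z').
- exact: linear0.
- by rewrite linear0 d_comp dz' linear0.
exists w; split=> //; exists b'.
by rewrite eb addrAC subrr add0r.
Qed.

Lemma M_finite : finite_type M.
Proof.
have [_ _ _ hfin _] := hst.
move=> n; have [l hl] := hfin n.
exists [seq eM w | w <- allwords [seq i <- l | u i] n] => a ha.
have h := @lam_finite q u [seq i <- l | u i] n u2 _ (sg a) (sglam a) (ghom_homog sg ha).
have {}h : lspan [seq eU w | w <- allwords [seq i <- l | u i] n] (sg a).
  by apply: h => i ui hi; rewrite mem_filter ui hl.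
rewrite -(pisg a).
have ss := span_subspace (A := M) [set x | x \in [seq eM w | w <- allwords [seq i <- l | u i] n]].
apply: (lspan_sub (X := fun z => span (A := M)
  [set x | x \in [seq eM w | w <- allwords [seq i <- l | u i] n]] (pi z)) _ _ h).
  case: ss => s0 sl; split=> [|c x y hx hy]; first by rewrite linear0.
  by rewrite linearP; apply: sl.
by move=> x /mapP[w hw ->]; rewrite piw; apply: span_mem; apply: map_f.
Qed.

Variable dP : {linear AP -> AP}.
Hypothesis hdP : derivation dP.
Hypothesis dPl : forall i,
  dP (eP [:: i]) = if (i < 5)%N then oapp eP 0 (dletter i) else 0.
Local Notation P := (Pq hdP dPl).

Lemma homog_eM i : homog (degU i) (eM [:: i] : AM).
Proof. exact: (homog_letter SM). Qed.

Lemma iota_exists : exists iota : dghom P M,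
  injective iota /\ forall i, (i < 5)%N -> iota (eP [:: i]) = eM [:: i].
Proof.
have dE i : (i < 5)%N -> nth 0%N (degsP q) i = degU i.
  by move=> hi; rewrite /degU hi.
have [i|i h|io iol] := @free_ghom _ _ (fun i => i < 5)%N (parsPE q_odd q_ge3) AM
    (fun i => if (i < 5)%N then eM [:: i] else 0).
- by case: ifP => [/dE ->|_]; [exact: homog_eM|exact: homog0].
- by rewrite (negPf h).
have [i|i h|re rel] := @free_ghom degU (fun i => odd (degU i)) u parME AP
    (fun i => if (i < 5)%N then eP [:: i] else 0).
- by case: ifP => [/dE <-|_]; [exact: (homog_letter SP)|exact: homog0].
- by rewrite (negPf (contra (@u5 i) h)).
have iol' i : (i < 5)%N -> io (eP [:: i]) = eM [:: i] by move=> hi; rewrite iol hi.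
have iow := ghom_word iol'.
have iod a : io (dP a) = diff M (io a).
  apply: (der_words hdP dM_der) => i /andP[_ /=]; rewrite andbT => hi.
  rewrite dPl hi iol' // /dM sgw /=; last by rewrite u5.
  rewrite dU5 //; case: i hi => [|[|[|[|[|i]]]]] //= _; rewrite ?linear0 //.
    by rewrite piw iow.
  by rewrite piw iow.
exists (@Dghom P M io iod); split=> // a b /= e.
have reK : forall a, re (io a) = a.
  move=> c; apply: (@ghom_letters SP _ (gcomp re io) (gid _)) => i /andP[_ /=].
  by rewrite andbT => hi; rewrite iol' // rel hi.
by rewrite -(reK a) e reK.
Qed.

Variable io : dghom P M.
Hypothesis io_inj : injective io.
Hypothesis iol : forall i, (i < 5)%N -> io (eP [:: i]) = eM [:: i].

Let gP : seq P := [seq eP [:: i] | i <- iota 0 5].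
Definition Wgen : set M := [set x | exists i, [/\ u i, (5 <= i)%N & x = eM [:: i]]].
Local Notation W := (span Wgen).
Definition Vgen : set M := sumset (span [set v | v \in map io gP]) W.

Lemma lsub_Vgen : lsub Vgen.
Proof.
have [g0 gl] := span_subspace [set v | v \in map io gP].
have [w0 wl] := span_subspace Wgen.
split=> [|c _ _ [x [y [hx hy ->]]] [x' [y' [hx' hy' ->]]]].
  by exists 0, 0; rewrite addr0.
by exists (c *: x + x'), (c *: y + y'); rewrite scalerDr addrACA; split; [exact: gl|exact: wl|].
Qed.

Lemma Vgen_letter i : u i -> Vgen (eM [:: i]).
Proof.
move=> ui; have [i5|i5] := ltnP i 5.
  exists (eM [:: i]), 0; rewrite addr0; split=> //; last by case: (span_subspace Wgen).
  apply: span_mem; rewrite -iol //; apply/mapP; exists (eP [:: i]) => //.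
  by apply/mapP; exists i; rewrite ?mem_iota.
exists 0, (eM [:: i]); rewrite add0r; split=> //.
  by case: (span_subspace [set v | v \in map io gP]).
by apply: span_mem; exists i.
Qed.

Lemma Vgen_min (Y : M -> Prop) : lsub Y -> (forall i, u i -> Y (eM [:: i])) ->
  forall v, Vgen v -> Y v.
Proof.
move=> hY hl v [x [y [hx hy ->]]]; apply: (lsubD hY).
  apply: (span_min hY) hx => _ /mapP[_ /mapP[i hi ->] ->].
  by rewrite mem_iota in hi; rewrite iol //; apply/hl/u5.
by apply: (span_min hY) hy => _ [i [ui _ ->]]; apply: hl.
Qed.

Lemma Vgen_gsub : gsubspace Vgen.
Proof.
have [v0 vl] := lsub_Vgen; split=> // n; apply: Vgen_min => [|i ui].
  by split=> [|c a b ha hb]; rewrite ?linear0 // linearP; apply: vl.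
rewrite /= acomp_ee; case: eqP => // _; exact: Vgen_letter.
Qed.

Lemma Wgen_gsub : gsubspace W.
Proof.
have [w0 wl] := span_subspace Wgen; split=> // n; apply: span_min.
  by split=> [|c a b ha hb] /=; rewrite ?linear0 // linearP; apply: wl.
move=> _ [i [ui i5 ->]]; rewrite /= acomp_ee; case: eqP => // _.
by apply: span_mem; exists i.
Qed.

Lemma W_zero i : (i <= 5 * q - 1)%N -> zero_in_deg W i.
Proof.
move=> hi w hw <-; apply: (span_min (A := M) (Y := [set w : M | comp M i w = 0])) hw.
  by split=> [|c a b /= ha hb]; rewrite /= ?linear0 // linearP /= ha hb scaler0 addr0.
move=> _ [j [uj j5 ->]] /=; rewrite acomp_ee degw_cons degw_nil addn0.
have [_ h _ _ _] := hst; have [_] := h j uj; rewrite ltnNge j5 /= => h5.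
by rewrite gtn_eqF //; apply: leq_trans h5; lia.
Qed.

Lemma Vgen_pos : Vgen `<=` @pos M.
Proof.
apply: Vgen_min => [|i /u2 h].
  by split=> [|c a b /= ha hb]; rewrite /pos /= ?linear0 // linearP /= ha hb scaler0 addr0.
rewrite /pos /= acomp_ee degw_cons degw_nil addn0 gtn_eqF //.
exact: leq_trans h.
Qed.

Lemma Vgen_free : free_on Vgen.
Proof.
move=> B g gl gh; have [v0 vl] := lsub_Vgen.
have g0 : g 0 = 0.
  by have := gl (-1) 0 0 v0 v0; rewrite scaler0 addr0 scaleN1r addNr.
have [i|i h|G hG] := @free_ghom degU (fun i => odd (degU i)) u parME B
    (fun i => if u i then g (eM [:: i]) else 0).
- case: ifP => ui; last exact: homog0.
  by apply: gh; [exact: Vgen_letter|exact: homog_eM].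
- by rewrite (negPf h).
exists G; split=> [v hv|G' hG'].
  suff [] : Vgen v /\ G v = g v by [].
  apply: (Vgen_min (Y := fun v => Vgen v /\ G v = g v)) hv.
    split=> [|c a b [ha ea] [hb eb]]; first by rewrite linear0 g0.
    by split; [exact: vl|rewrite linearP /= ea eb gl].
  by move=> i ui; split; [exact: Vgen_letter|rewrite hG ui].
apply: (@ghom_letters SM) => i /andP[_ /=]; rewrite andbT => ui.
by rewrite hG ui hG' //; apply: Vgen_letter.
Qed.

Lemma dM_letter (Y : M -> Prop) i : lsub Y -> u i ->
  (forall w, all u w -> (2 <= size w)%N -> degw SU w = (degU i).+1 -> Y (eM w)) ->
  Y (diff M (eM [:: i])).
Proof.
move=> hY ui hw; rewrite /= /dM sgw /= ?ui //.
apply: (hdec ui (Y := fun z => Y (pi z))) => [|w uw sw dw].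
  case: hY => Y0 Yl; split=> [|c a b ha hb]; first by rewrite linear0.
  by rewrite linearP; apply: Yl.
by rewrite piw; apply: hw.
Qed.

Lemma Vgen_decomposable v : Vgen v -> prods_ge Vgen 2 (diff M v).
Proof.
have sp2 := span_subspace (\bigcup_(l in [set l | (2 <= l)%N]) prods Vgen l).
move: v; apply: Vgen_min => [|i ui].
  case: sp2 => s0 sl; split=> [|c a b ha hb]; first by rewrite linear0.
  by rewrite linearP; apply: sl.
apply: dM_letter => // w uw sw _; apply: span_mem; exists (size w) => //.
rewrite ee_evalw /evalw -(big_map (fun i => eM [:: i]) xpredT id).
rewrite -(size_map (fun i => eM [:: i])); apply: (@prods_prod M Vgen).
by move=> _ /mapP[j jw ->]; apply/Vgen_letter/(allP uw).
Qed.

(** The generators are filtered by degree. In a word of at least two letters and degree |v| + 1,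
    each letter leaves degree at least 2 to the others, so its own degree is below |v|; and there
    are no letters in degree 0. *)
Lemma Vgen_filtration : sullivan_filtration Vgen.
Proof.
pose F k : set M := span [set x : M | exists i, [/\ u i, (degU i <= k)%N & x = eM [:: i]]].
have Fs k : subspace (F k) by apply: span_subspace.
have Fmono k l : (k <= l)%N -> F k `<=` F l.
  move=> kl; apply: span_min => // _ [i [ui ik ->]]; apply: span_mem.
  by exists i; rewrite (leq_trans ik).
exists F; split.
- move=> k; have [f0 fl] := Fs k; split=> // n; apply: span_min.
    by split=> [|c a b ha hb] /=; rewrite ?linear0 // linearP; apply: fl.
  move=> _ [i [ui ik ->]]; rewrite /= acomp_ee; case: eqP => // _.
  by apply: span_mem; exists i.
- by move=> k; apply: Fmono.
- apply/seteqP; split=> [v|v [k _]].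
    move: v; apply: Vgen_min => [|i ui].
      split=> [|c a b [k _ ha] [l _ hb]]; first by exists 0%N => //; case: (Fs 0%N).
      exists (maxn k l) => //; have [_ fl] := Fs (maxn k l).
      by apply: fl; [apply: Fmono ha; apply: leq_maxl|apply: Fmono hb; apply: leq_maxr].
    by exists (degU i) => //; apply: span_mem; exists i.
  apply: (span_min lsub_Vgen) => _ [i [ui _ ->]]; exact: Vgen_letter.
- move=> v; apply: (span_min (A := M) (Y := [set v : M | diff M v = 0])).
    split=> [|c a b ha hb]; first exact: (linear0 (diff M)).
    apply: etrans (linearP (diff M) c a b) _.
    by rewrite [diff M a]ha [diff M b]hb scaler0 addr0.
  by move=> x [i [/u2 h2 h0 _]]; move: h2; rewrite ltnNge (leq_trans h0).
move=> k v; have [[s0 sl] s1 sM] := subalg_subalgebra (F k).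
apply: (span_min (A := M) (Y := [set v : M | subalg (F k) (diff M v)])).
  split=> [|c a b ha hb] /=; first by rewrite [dM 0]linear0.
  by rewrite [dM _]linearP; apply: sl.
move=> _ [i [ui ik ->]]; apply: dM_letter => // w uw sw dw.
have {ik} wk j : j \in w -> (degU j <= k)%N.
  move=> jw; have pw := perm_to_rem jw.
  have e1 : degw SU w = (degU j + degw SU (rem j w))%N.
    by rewrite /degw (perm_big _ pw) big_cons.
  have e2 : all u (rem j w) by have := uw; rewrite (perm_all _ pw) /= => /andP[].
  have h2 := degw_size u2 e2.
  have s2 : (0 < size (rem j w))%N by have := perm_size pw; rewrite /= => e; rewrite e in sw.
  by move: (size _) (degw _ (rem j w)) h2 s2 e1 => sz dg h2 s2 e1; lia.
have {dw sw} : all (fun j => u j && (degU j <= k)%N) w.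
  by apply/allP => j jw; rewrite (allP uw) // wk.
elim: w {uw wk} => [|j w IH] /=; first by rewrite ee_nil.
case/andP=> /andP[uj jk] /IH h; rewrite (ee_cons SM j w); apply: sM => //.
by apply: subalg_mem; apply: span_mem; exists j.
Qed.

Lemma M_is_Mq (gD : seq D) : is_Dq q gD ->
  (forall i, (i < 5)%N -> f (eU [:: i]) = nth 0 gD i) -> size gD = 5 -> is_Mq q M.
Proof.
move=> hD fD sD.
have cd a : (gcomp phiM io) (diff P a) = diff D ((gcomp phiM io) a).
  by apply: etrans (phiM_d (io a)); rewrite -(dghom_diff io).
exists D, P, gD, gP, (@Dghom P D (gcomp phiM io) cd), io, W, phiM; split.
  split=> //; first exact: Pq_is_Pq.
  apply: (@eq_from_nth _ 0) => [|i]; rewrite !size_map size_iota // => hi.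
  rewrite (nth_map 0) ?size_map ?size_iota // (nth_map 0%N) ?size_iota //.
  by rewrite nth_iota // add0n [LHS]/= iol // sgw ?fD //= u5.
split; last by split; [exact: phiM_quasi|].
split=> //.
- exact: Wgen_gsub.
- exact: W_zero.
- split; [exact: Vgen_gsub|exact: Vgen_pos|exact: Vgen_free|exact: Vgen_filtration|].
  exact: Vgen_decomposable.
exact: M_finite.
Qed.
End WithTransfer.
End Model.

Lemma Mq_exists (q : nat) : odd q -> (3 <= q)%N -> exists M : cdga, is_Mq q M.
Proof.
move=> q_odd q_ge3.
have [p pE] := proj_exists q_odd q_ge3.
have [dF [hdF dFl]] := dF_exists q_odd q_ge3.
have [dP [hdP dPl]] := dP_exists q_odd q_ge3.
have [d0 [f0 [hd0 d0l f0l]]] := base_exists pE hdF dFl.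
have [u [d [f [hst hu]]]] := @stage_limit q q_odd q_ge3 (Dq pE hdF dFl) _ (@D_finite q q_odd q_ge3) _ _ _
  (base_stage hd0 d0l f0l).
have u5 i : (i < 5)%N -> u i by move=> /hu[].
have d5 i : (i < 5)%N -> d (ee _ [:: i]) = oapp (ee _) 0 (dletter i).
  by move=> hi; case: (hu i hi) => _ -> _; apply: d0l.
have [pi [sg [piw sgw pisg sglam sgpi]]] := transfer hst.
have [io [io_inj iol]] :=
  iota_exists hst u5 d5 piw sgw pisg sglam sgpi hdP dPl.
have h := M_is_Mq u5 piw sgw io_inj iol (Dq_is_Dq pE hdF dFl).
eexists; apply: h => // i hi.
case: (hu i hi) => _ _ ->; rewrite f0l //.
by case: i hi => [|[|[|[|[|i]]]]].
Qed.

Theorem theorem7p5 :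
  (forall (q : nat) (M : cdga), odd q -> (3 <= q)%N -> is_Mq q M ->
     [/\ cd M = enat (7 * q - 3),
         e0 M = nilh M,
         nilh M = enat 3,
         (enat 3 < enat 4)%E /\ enat 4 = Hnil M
       & a_ 3 M = enat (5 * q - 1)]) /\
  ~ Hnil_implication (- 2)%R.
Proof.
split=> [q M q_odd q_ge3 hM|].
  have [[hc he hn hH ha] _] := Mq_invariants q_odd q_ge3 hM.
  by split=> //; rewrite he hn.
have [M hM] := @Mq_exists 3 isT isT.
exact: Mq_not_implication hM.
Qed.
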